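(* Let $X_t=\mu t+\sigma W_t$ with $\mu\in\mathbb{R}$, $\sigma>0$, let $a>0$, $\gamma=2\mu/\sigma^2$, and let $\tilde\tau_a^n$ be the $n$-th drawdown time with recovery. For all $n\in\mathbb{N}$ and $x>0$, $$\mathbb{P}\{M_{\tilde\tau_a^n}>x,\ \tilde\tau_a^n<\infty\}=\begin{cases}\displaystyle e^{-\frac{\gamma x}{e^{\gamma a}-1}}\sum_{m=0}^{n-1}\frac{1}{m!}\left(\frac{\gamma x}{e^{\gamma a}-1}\right)^m,&\text{if }\mu\ge 0,\\[3mm]\displaystyle e^{(n-1)\gamma a}\,e^{-\frac{\gamma x}{e^{\gamma a}-1}}\sum_{m=0}^{n-1}\frac{1}{m!}\left(\frac{\gamma x}{e^{\gamma a}-1}\right)^m,&\text{if }\mu<0.\end{cases}$$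
   Context: $X_t=\mu t+\sigma W_t$ ($X_0=0$) with $W$ a standard Brownian motion, $\mu\in\mathbb{R}$, $\sigma>0$; $M_t=\sup_{0\le s\le t}X_s$; $a>0$ is fixed; $\mathbb{N}=\{1,2,\dots\}$; $\inf\emptyset=\infty$. The drawdown times with recovery are defined by $\tilde\tau_a^0=0$ and $$\tilde\tau_a^n=\inf\{t>\tilde\tau_a^{n-1}:\ M_t-X_t\ge a,\ M_t>M_{\tilde\tau_a^{n-1}}\},$$ with $\tilde\tau_a^n=\infty$ if $\tilde\tau_a^{n-1}=\infty$. When $\mu=0$ the quantity $\gamma/(e^{\gamma a}-1)$ is understood as its limit $1/a$. *)

(* Defs.v *)
From mathcomp Require Import all_boot all_order all_algebra.
From mathcomp Require Import all_classical all_reals all_analysis.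

Set Implicit Arguments.
Unset Strict Implicit.
Unset Printing Implicit Defensive.

Import Order.TTheory GRing.Theory Num.Theory.
Import numFieldNormedType.Exports.

Local Open Scope classical_set_scope.
Local Open Scope ring_scope.

(* Since A i = setT is allowed, the product rule over the whole family contains
   the product rule over each of its subfamilies. *)
Definition mutually_independent d (T : measurableType d) (R : realType)
    (P : probability T R) (I : finType) (Y : I -> T -> R) : Prop :=
  forall A : I -> set R, (forall i, measurable (A i)) ->
    P [set w | forall i, A i (Y i w)] =
    (\prod_(i : I) P (Y i @^-1` A i))%E.

(* The time set is [0, +oo[: nothing is required of W t for t < 0.
   The second parameter of normal_prob is the standard deviation. *)
Record standard_brownian_motion d (T : measurableType d) (R : realType)
    (P : probability T R) (W : R -> T -> R) : Prop := {
  bm_measurable : forall t, 0 <= t -> measurable_fun [set: T] (W t) ;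
  bm_start : forall w, W 0 w = 0 ;
  bm_continuous : forall w,
    {within `[0, +oo[, continuous (fun t => W t w)} ;
  bm_normal : forall s t, 0 <= s -> s < t ->
    forall A : set R, measurable A ->
      P [set w | A (W t w - W s w)] = normal_prob 0 (Num.sqrt (t - s)) A ;
  bm_independent : forall (n : nat) (t : nat -> R), 0 <= t 0%N ->
    (forall i, (i < n)%N -> t i < t i.+1) ->
    mutually_independent P (fun (i : 'I_n) w => W (t i.+1) w - W (t i) w)
}.

Definition drifted_process (T : Type) (R : realType) (mu sigma : R)
    (W : R -> T -> R) (t : R) (w : T) : R :=
  mu * t + sigma * W t w.

Definition running_max (T : Type) (R : realType) (X : R -> T -> R)
    (t : R) (w : T) : R :=
  sup [set X s w | s in `[0, t]].

Fixpoint drawdown_time (T : Type) (R : realType) (X : R -> T -> R) (a : R)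
    (n : nat) (w : T) : \bar R :=
  match n with
  | 0 => 0%:E
  | n'.+1 =>
    match drawdown_time X a n' w with
    | EFin r => ereal_inf [set t%:E | t in
        [set t : R | [/\ r < t, a <= running_max X t w - X t w &
                         running_max X r w < running_max X t w]]]
    | _ => +oo%E
    end
  end.

(* gamma / (e^(gamma a) - 1), with its limit 1 / a at gamma = 0 *)
Definition drawdown_rate (R : realType) (gamma a : R) : R :=
  if gamma == 0 then a^-1 else gamma / (expR (gamma * a) - 1).

(* Main.v *)
(* Let S be the scale function, l = 1 / S(a), r(z) = exp(min(gamma, 0) z) the
   probability of ever climbing a height z, and rho = r(a).  For a payoff that
   is a function of the maximum at the n-th drawdown, let F_k(m) be its mean
   value when k drawdowns remain and the path is at its maximum m.  These
   functions solve F_(k+1) - F'_(k+1) S(a) = rho F_k.  The value at a later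
   time is F_k(M) - F'_k(M) S(M - X) if the maximum has exceeded its level at
   the last drawdown (the stage is hunting), and r(M - X) F_k(M) if it has not
   (recovering).

   The value process has constant mean.  No strong Markov property is needed:
   on a grid, with the stage frozen over each step, the mean change of the
   value vanishes because exp(-gamma X) and X - mu t are martingales; updating
   the stage costs at most the oscillation of the path over the step times the
   increase of a bounded monotone quantity, so the total error vanishes with
   the mesh.  At infinite time the value becomes the payoff, for a drawdown
   almost surely occurs after each recovery, while a recovery almost surely
   occurs if mu >= 0, and r(M - X) tends to 0 in mean if mu < 0.

   For a ramp of width eps at x, F_n is an explicit integral of Erlang tails
   over a window of width l eps, which tends to rho^(n-1) times the Erlang tail
   at l x. *)
Require Import Defs.
From mathcomp Require Import all_boot all_order all_algebra.
From mathcomp Require Import all_classical all_reals all_analysis.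
From mathcomp Require Import measurable_realfun ring lra zify.

Set Implicit Arguments.
Unset Strict Implicit.
Unset Printing Implicit Defensive.

Import Order.TTheory GRing.Theory Num.Theory.
Import numFieldNormedType.Exports.

Local Open Scope classical_set_scope.
Local Open Scope ring_scope.

(** * Erlang tails *)

(** The payoff is a ramp and not an indicator because the pathwise estimates need value functions
    with Lipschitz derivatives. Beyond the end [K] of the ramp these are constant, so only
    [Num.min M K] counts, and the monotone quantity is bounded. Three fits make a change of stage or
    of maximum cheap: [S 0 = 0] and [S' 0 = 1] cancel the first-order effect of a new maximum;
    [r 0 = 1] fits a recovery; the differential equation with [r a = rho] fits a drawdown.

    [S] is unbounded, so [S] and [r] are truncated. With mesh [(m+1)^-2], exponential moments of
    order about [m+1] bound the mean defect of one step by a constant times [exp(-(m+1))], which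
    beats the number [N0 (m+1)^2] of steps.

    The errors from updating the stage are summed path by path. The modulus of continuity depends on
    the path, but the sum also has a deterministic bound, so bounded convergence gives the limit of
    its mean. *)

Section MeanValue.
Variable R : realType.
Implicit Types (f df : R -> R) (a b c : R).

(** The endpoints may come in either order, as the drawdowns and heights compared later are not
    ordered. *)
Lemma mean_value f df : (forall x : R, is_derive x 1 f (df x)) ->
  forall a b, exists c, [/\ `|c - a| <= `|b - a|, `|c - b| <= `|b - a| &
    f b - f a = df c * (b - a)] /\ (Num.min a b <= c <= Num.max a b).
Proof.
move=> fdf.
have cf x : {for x, continuous f}.
  by apply: differentiable_continuous; apply/derivable1_diffP; case: (fdf x).
have main a b : a <= b -> exists2 c, c \in `[a, b]%R & f b - f a = df c * (b - a).
  move=> ab; apply: MVT_segment => //.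
  by apply: continuous_subspaceT => x; exact: cf.
move=> a b; have [ab|/ltW ab] := leP a b.
- have [c + e] := main _ _ ab; rewrite in_itv/= => /andP[ac cb].
  exists c; split; last by rewrite ac cb.
  split => //; rewrite [X in _ <= X]ger0_norm ?subr_ge0//.
    by rewrite ger0_norm ?subr_ge0// lerB.
  by rewrite ler0_norm ?subr_le0// opprB lerB.
- have [c + e] := main _ _ ab; rewrite in_itv/= => /andP[ac cb].
  exists c; split; last by rewrite ac cb.
  split.
  + rewrite [X in X <= _]ler0_norm ?subr_le0//.
    by rewrite ler0_norm ?subr_le0// !opprB lerB.
  + rewrite [X in X <= _]ger0_norm ?subr_ge0//.
    by rewrite ler0_norm ?subr_le0// !opprB lerB.
  + by rewrite -[LHS]opprK opprB e -mulrN opprB.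
Qed.

Lemma mean_value_ge f df a C : (forall x : R, is_derive x 1 f (df x)) ->
  (forall x, a <= x -> `|df x| <= C) ->
  forall x y, a <= x -> a <= y -> `|f x - f y| <= C * `|x - y|.
Proof.
move=> fdf dfC x y xb yb; have [c [[_ _ ->]]] := mean_value fdf y x.
move=> /andP[c1 _]; rewrite normrM ler_wpM2r// dfC// (le_trans _ c1)//.
by rewrite le_min xb yb.
Qed.

Lemma max_lipschitz c (x y : R) : `|Num.max x c - Num.max y c| <= `|x - y|.
Proof.
have h u v : u <= v -> `|Num.max v c - Num.max u c| <= `|v - u|.
  move=> uv; have h1 : Num.max u c <= Num.max v c by rewrite ge_max !le_max uv lexx orbT.
  rewrite ger0_norm ?subr_ge0// ger0_norm ?subr_ge0//.
  by rewrite /Num.max; do 2 (case: ltP => ?); lra.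
by have [xy|/ltW/h//] := leP x y; rewrite distrC [leRHS]distrC h.
Qed.

Lemma min_lipschitz c (x y : R) : `|Num.min x c - Num.min y c| <= `|x - y|.
Proof.
have h u v : u <= v -> `|Num.min v c - Num.min u c| <= `|v - u|.
  move=> uv; have h1 : Num.min u c <= Num.min v c.
    by rewrite le_min !ge_min uv lexx orbT.
  rewrite ger0_norm ?subr_ge0// ger0_norm ?subr_ge0//.
  by rewrite /Num.min; do 2 (case: ltP => ?); lra.
by have [xy|/ltW/h//] := leP x y; rewrite distrC [leRHS]distrC h.
Qed.

End MeanValue.

Section ErlangTail.
Variable R : realType.
Implicit Types (u v x y : R) (k : nat).

Definition exp_psum k u : R := \sum_(0 <= m < k) (m`!%:R)^-1 * u ^+ m.

(** The tail at [u] of a sum of [k] independent unit exponentials, or the probability that a Poisson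
    variable of mean [u] is below [k]. *)
Definition erlang k u : R := expR (- u) * exp_psum k u.

Lemma exp_psumS k u : exp_psum k.+1 u = exp_psum k u + (k`!%:R)^-1 * u ^+ k.
Proof. by rewrite /exp_psum big_nat_recr. Qed.

Lemma is_derive_exp_psum k u : is_derive u 1 (exp_psum k.+1) (exp_psum k u).
Proof.
elim: k u => [|k IH] u.
  rewrite (_ : exp_psum 1 = cst 1); last first.
    by apply/funext => v; rewrite /exp_psum big_nat1 fact0 invr1 expr0 mulr1.
  by rewrite /exp_psum big_geq//; exact: is_derive_cst.
rewrite (_ : exp_psum k.+2 = exp_psum k.+1 + (k.+1`!%:R)^-1 *: (id ^+ k.+1)); last first.
  by apply/funext => v; rewrite exp_psumS fctE/= exprfctE.
rewrite exp_psumS.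
apply: (is_derive_eq (is_deriveD (IH u) (is_deriveZ _ (is_deriveX _ (is_derive_id _ _))))).
rewrite /GRing.scale/= !mulr1 mulrA; congr (_ + _ * _).
by rewrite factS natrM invfM mulrC mulrA mulfV ?mul1r// pnatr_eq0.
Qed.

Lemma is_derive_erlang k u :
  is_derive u 1 (erlang k.+1) (erlang k u - erlang k.+1 u).
Proof.
have h := is_derive_exp_psum k u.
rewrite [X in is_derive _ _ X _](_ : _ = (expR \o -%R) * exp_psum k.+1)//.
apply: is_derive_eq.
by rewrite /erlang/= /GRing.scale/=; ring.
Qed.

Lemma erlangB k u : erlang k u - erlang k.+1 u = - (expR (- u) * ((k`!%:R)^-1 * u ^+ k)).
Proof. by rewrite /erlang exp_psumS; ring. Qed.

(** Up to sign this is a Poisson weight, at most 1 because [expR u] dominates each term of its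
    series. *)
Lemma erlang_derive_bound k u : 0 <= u -> -1 <= erlang k u - erlang k.+1 u <= 0.
Proof.
move=> u0; rewrite erlangB oppr_le0 lerN2 mulrC.
have -> : 0 <= k`!%:R^-1 * u ^+ k * expR (- u).
  by rewrite !mulr_ge0 ?expR_ge0 ?exprn_ge0.
rewrite expRN ler_pdivrMr ?expR_gt0// mul1r andbT mulrC.
case: k => [|k]; first by rewrite expr0 fact0 invr1 mulr1 (le_trans _ (expR_ge1Dx u))// lerDl.
by rewrite (le_trans _ (expR_ge1Dxn k u0))// lerDr.
Qed.

Lemma erlang0 k : erlang k.+1 0 = 1.
Proof.
rewrite /erlang oppr0 expR0 mul1r; elim: k => [|k IH].
  by rewrite exp_psumS /exp_psum big_geq// expr0 fact0 invr1 mulr1 add0r.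
by rewrite exp_psumS IH expr0n/= mulr0 addr0.
Qed.

Lemma erlang_ge0 k u : 0 <= u -> 0 <= erlang k u.
Proof.
move=> u0; rewrite mulr_ge0 ?expR_ge0// sumr_ge0// => i _.
by rewrite mulr_ge0 ?exprn_ge0.
Qed.

Lemma erlang_lipschitz k u v : 0 <= u -> 0 <= v ->
  `|erlang k.+1 u - erlang k.+1 v| <= `|u - v|.
Proof.
move=> u0 v0; rewrite -[leRHS]mul1r.
apply: (mean_value_ge (is_derive_erlang k) (a := 0)) => // x x0.
by have /andP[h1 h2] := erlang_derive_bound k x0; rewrite ler_norml h1 (le_trans h2).
Qed.

Lemma erlang_le1 k u : 0 <= u -> erlang k.+1 u <= 1.
Proof.
move=> u0; rewrite -subr_le0 -(erlang0 k).
have [c [[_ _ ->]]] := mean_value (is_derive_erlang k) 0 u.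
rewrite (min_idPl u0) => /andP[c0 _]; rewrite subr0 mulr_le0_ge0//.
by case/andP: (erlang_derive_bound k c0).
Qed.

Definition erlang_sum k u : R := \sum_(0 <= i < k) erlang i.+1 u.

(** The derivatives [erlang i u - erlang i.+1 u] telescope, and [erlang 0] vanishes. *)
Lemma is_derive_erlang_sum k u : is_derive u 1 (erlang_sum k) (- erlang k u).
Proof.
elim: k => [|k IH].
  rewrite (_ : erlang_sum 0 = cst 0); last first.
    by apply/funext => v; rewrite /erlang_sum big_geq.
  by rewrite /erlang /exp_psum big_geq// mulr0 oppr0; exact: is_derive_cst.
rewrite (_ : erlang_sum k.+1 = erlang_sum k + erlang k.+1); last first.
  by apply/funext => v; rewrite /erlang_sum big_nat_recr.
have h := is_derive_erlang k u.
by apply: is_derive_eq; rewrite addrA addNr sub0r.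
Qed.

(** The tail continued by its value 1 to negative arguments. At index 0 the tail would jump at 0;
    the constant 0 keeps the Lipschitz bound valid for every index. *)
Definition erlang_pos k y : R := if k is k'.+1 then erlang k'.+1 (Num.max y 0) else 0.

(* An antiderivative of [- erlang_pos k]; it is [0] at infinity. *)
Definition erlang_int k y : R := Num.max (- y) 0 + \sum_(0 <= i < k) erlang_pos i.+1 y.

Lemma erlang_intS k y : erlang_int k.+1 y = erlang_int k y + erlang_pos k.+1 y.
Proof. by rewrite /erlang_int big_nat_recr//= addrA. Qed.

Lemma erlang_posE k y : 0 <= y -> erlang_pos k.+1 y = erlang k.+1 y.
Proof. by move=> y0; rewrite /erlang_pos (max_idPl y0). Qed.

Lemma erlang_pos_neg k y : y <= 0 -> erlang_pos k.+1 y = 1.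
Proof. by move=> y0; rewrite /erlang_pos (max_idPr y0) erlang0. Qed.

Lemma erlang_pos_bound k y : 0 <= erlang_pos k y <= 1.
Proof.
case: k => [|k]; first by rewrite lexx ler01.
by rewrite /erlang_pos erlang_ge0 ?erlang_le1// le_max lexx orbT.
Qed.

Lemma erlang_pos_lipschitz k x y : `|erlang_pos k x - erlang_pos k y| <= `|x - y|.
Proof.
case: k => [|k]; first by rewrite subrr normr0.
rewrite (le_trans (erlang_lipschitz _ _ _)) ?le_max ?lexx ?orbT//.
exact: max_lipschitz.
Qed.

Lemma erlang_int_neg k y : y <= 0 -> erlang_int k y = k%:R - y.
Proof.
move=> y0; elim: k => [|k IH].
  by rewrite /erlang_int big_geq// addr0 sub0r (max_idPl _)// oppr_ge0.
by rewrite erlang_intS erlang_pos_neg// IH -[in RHS]natr1 addrAC.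
Qed.

Lemma erlang_int_lipschitz k x y :
  `|erlang_int k x - erlang_int k y| <= (k.+1)%:R * `|x - y|.
Proof.
elim: k => [|k IH].
  rewrite /erlang_int !big_geq// !addr0 mul1r (le_trans (max_lipschitz _ _ _))//.
  by rewrite -opprD normrN.
rewrite !erlang_intS opprD addrACA (le_trans (ler_normD _ _))//.
by rewrite -[k.+2%:R]natr1 mulrDl mul1r lerD// erlang_pos_lipschitz.
Qed.

(** For a positive index the slope is 1-Lipschitz even across 0, because the tail equals 1 there.
    The kink and the smooth part each contribute one square, hence the constant 2. *)
Lemma erlang_int_taylor k x y :
  `|erlang_int k.+1 y - erlang_int k.+1 x + erlang_pos k.+1 x * (y - x)|
   <= 2 * (y - x) ^+ 2.
Proof.
have E z : erlang_int k.+1 z = (Num.max z 0 - z) + erlang_sum k.+1 (Num.max z 0).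
  rewrite /erlang_int /erlang_sum; congr (_ + _).
  by rewrite /Num.max; do 2 (case: ltP => ?); lra.
rewrite !E.
set u := Num.max x 0; set v := Num.max y 0.
have u0 : 0 <= u by rewrite le_max lexx orbT.
have v0 : 0 <= v by rewrite le_max lexx orbT.
have uv : `|v - u| <= `|y - x| by exact: max_lipschitz.
have [c [[cu cv e] /andP[c1 _]]] := mean_value (is_derive_erlang_sum k.+1) u v.
have c0 : 0 <= c by rewrite (le_trans _ c1)// le_min u0 v0.
(* The first product is the effect of the kink: its first factor vanishes for [x <= 0], and its
   second one when both points are nonnegative. The second product is the smooth part, by the mean
   value theorem on [[0, +oo[]. *)
rewrite [X in `|X|](_ : _ = (1 - erlang_pos k.+1 x) * ((v - y) - (u - x)) +
   (erlang_pos k.+1 x - erlang k.+1 c) * (v - u)); last first.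
  by rewrite -[erlang_sum _ v](subrK (erlang_sum k.+1 u)) e; ring.
have sq : `|y - x| * `|y - x| = (y - x) ^+ 2 by rewrite -expr2 real_normK ?num_real.
rewrite (le_trans (ler_normD _ _))// mulr_natl [leRHS]mulr2n lerD//.
  have [x0|x0] := leP x 0.
    by rewrite erlang_pos_neg// subrr mul0r normr0 sqr_ge0.
  have -> : u = x by apply/max_idPl/ltW.
  rewrite subrr subr0 normrM.
  have [y0|y0] := leP 0 y.
    by rewrite /v (max_idPl y0) subrr normr0 mulr0 sqr_ge0.
  have -> : v = 0 by apply/max_idPr/ltW.
  rewrite -sq ler_pM//.
    rewrite -(erlang_pos_neg k (lexx 0)) (le_trans (erlang_pos_lipschitz _ _ _))//.
    by rewrite sub0r normrN gtr0_norm// ltr0_norm; lra.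
  by rewrite sub0r normrN ltr0_norm// ltr0_norm; lra.
rewrite normrM -sq ler_pM//.
rewrite (le_trans (erlang_lipschitz _ u0 c0))//.
by rewrite distrC (le_trans cu).
Qed.

End ErlangTail.

(** * Scale and value functions *)

Section ScaleFunction.
Variable R : realType.
Implicit Types (gamma a x y z : R).

(* Solves [1/2 sigma^2 S'' - mu S' = 0], [S 0 = 0], [S' 0 = 1]. *)
Definition scale gamma z : R :=
  if gamma == 0 then z else (expR (gamma * z) - 1) / gamma.

Lemma is_derive_expRM gamma z :
  is_derive z 1 (fun z => expR (gamma * z)) (gamma * expR (gamma * z)).
Proof.
rewrite [X in is_derive _ _ X _](_ : _ = expR \o (gamma \*: id)) //.
by apply: is_derive_eq; rewrite /GRing.scale/= mulr1 mulrC.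
Qed.

Lemma is_derive_scale gamma z : is_derive z 1 (scale gamma) (expR (gamma * z)).
Proof.
rewrite /scale; have [->|g0] := eqVneq gamma 0.
  by rewrite mul0r expR0; exact: is_derive_id.
have h := is_derive_expRM gamma z.
rewrite [X in is_derive _ _ X _](_ : _ =
  gamma^-1 *: ((fun z => expR (gamma * z)) - cst 1)); last first.
  by apply/funext => u; rewrite mulrC.
by apply: is_derive_eq; rewrite subr0 /GRing.scale/= mulrA mulVf// mul1r.
Qed.

Lemma scale0 gamma : scale gamma 0 = 0.
Proof. by rewrite /scale; case: ifP => // _; rewrite mulr0 expR0 subrr mul0r. Qed.

(** Separates the drawdown [z] before a step from the increment [y] over it: the last term is a past
    factor times a function of the increment that has mean zero. *)
Lemma scaleB gamma z y : scale gamma (z - y) = scale gamma z + expR (gamma * z) * scale gamma (- y).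
Proof.
rewrite /scale; case: ifPn => [/eqP ->|g0]; first by rewrite mul0r expR0 mul1r.
by rewrite mulrBr expRD mulrN; field.
Qed.

Lemma scale_bound gamma z : `|scale gamma z| <= `|z| * expR (`|gamma| * `|z|).
Proof.
have [c [[c1 _ e] _]] := mean_value (is_derive_scale gamma) 0 z.
move: e; rewrite scale0 !subr0 => ->.
rewrite normrM mulrC ler_wpM2l// gtr0_norm ?expR_gt0// ler_expR.
rewrite (le_trans (ler_norm _))// normrM ler_wpM2l//.
by move: c1; rewrite !subr0.
Qed.

Lemma drawdown_rate_scale gamma a : 0 < a ->
  0 < drawdown_rate gamma a /\ drawdown_rate gamma a * scale gamma a = 1.
Proof.
move=> a0; rewrite /drawdown_rate /scale; case: ifPn => [_|g0].
  by rewrite invr_gt0 a0 mulVf// gt_eqF.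
have ne : expR (gamma * a) - 1 != 0.
  by rewrite subr_eq0 -(expR0 R) (inj_eq (@expR_inj R)) mulf_neq0// gt_eqF.
split; last by rewrite mulf_div [X in _ / X]mulrC divff// mulf_neq0.
have [g|g|g] := ltgtP gamma 0; last by rewrite g eqxx in g0.
  rewrite -[X in 0 < X]opprK -mulNr oppr_gt0 pmulr_rlt0 ?oppr_gt0//.
  by rewrite invr_lt0 subr_lt0 expR_lt1 pmulr_llt0.
by rewrite divr_gt0// subr_gt0 expR_gt1 mulr_gt0.
Qed.

(** Clamping to [[-1, a + 1]] gives a bounded Lipschitz function that still agrees with [scale]
    after an increment of size at most 1 from any drawdown in [[0, a]]. *)
Definition scale_trunc gamma a z : R :=
  scale gamma (Num.min (Num.max z (-1)) (a + 1)).

Definition recover gamma z : R := expR (Num.min gamma 0 * z).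

(** Clamped only from below: the exponent [Num.min gamma 0] is nonpositive, so large drawdowns cause
    no growth. *)
Definition recover_trunc gamma z : R := recover gamma (Num.max z (-1)).

Lemma trunc_lipschitz a x y :
  `|Num.min (Num.max x (-1)) (a + 1) - Num.min (Num.max y (-1)) (a + 1)| <= `|x - y|.
Proof. by rewrite (le_trans (min_lipschitz _ _ _))// max_lipschitz. Qed.

Lemma trunc_norm a x : 0 < a -> `|Num.min (Num.max x (-1)) (a + 1)| <= a + 1.
Proof.
move=> a0; rewrite ler_norml ge_min lexx orbT andbT le_min le_max.
by apply/andP; split; [apply/orP; right|]; lra.
Qed.

Lemma trunc_id a z : -1 <= z <= a + 1 -> Num.min (Num.max z (-1)) (a + 1) = z.
Proof. by move=> /andP[h1 h2]; rewrite (max_idPl h1) (min_idPl h2). Qed.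

Lemma scale_truncE gamma a z : -1 <= z <= a + 1 -> scale_trunc gamma a z = scale gamma z.
Proof. by move=> h; rewrite /scale_trunc trunc_id. Qed.

Lemma recover_truncE gamma z : -1 <= z -> recover_trunc gamma z = recover gamma z.
Proof. by move=> h; rewrite /recover_trunc (max_idPl h). Qed.

Definition scale_cst gamma a : R := expR (`|gamma| * (a + 1)).

Lemma scale_trunc_bound gamma a z : 0 < a ->
  `|scale_trunc gamma a z| <= (a + 1) * scale_cst gamma a.
Proof.
move=> a0; rewrite (le_trans (scale_bound _ _))// ler_pM ?expR_ge0 ?trunc_norm//.
by rewrite ler_expR ler_wpM2l ?trunc_norm.
Qed.

Lemma mean_value_norm (f df : R -> R) b C : (forall x : R, is_derive x 1 f (df x)) ->
  (forall x, `|x| <= b -> `|df x| <= C) ->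
  forall x y, `|x| <= b -> `|y| <= b -> `|f x - f y| <= C * `|x - y|.
Proof.
move=> fdf dfC x y; rewrite ![`|_| <= b]ler_norml => /andP[x1 x2] /andP[y1 y2].
have [c [[_ _ ->]]] := mean_value fdf y x.
move=> /andP[c1 c2]; rewrite normrM ler_wpM2r// dfC// ler_norml.
apply/andP; split; first by rewrite (le_trans _ c1)// le_min y1.
by rewrite (le_trans c2)// ge_max y2.
Qed.

Lemma scale_trunc_lipschitz gamma a x y : 0 < a ->
  `|scale_trunc gamma a x - scale_trunc gamma a y| <= scale_cst gamma a * `|x - y|.
Proof.
move=> a0.
apply: (@le_trans _ _ (scale_cst gamma a *
  `|Num.min (Num.max x (-1)) (a + 1) - Num.min (Num.max y (-1)) (a + 1)|)); last first.
  by rewrite ler_wpM2l ?expR_ge0 ?trunc_lipschitz.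
apply: (mean_value_norm (is_derive_scale gamma) (b := a + 1)); rewrite ?trunc_norm//.
move=> z za; rewrite gtr0_norm ?expR_gt0// ler_expR (le_trans (ler_norm _))//.
by rewrite normrM ler_wpM2l.
Qed.

Lemma expRM_lipschitz gamma b x y : `|x| <= b -> `|y| <= b ->
  `|expR (gamma * x) - expR (gamma * y)| <= `|gamma| * expR (`|gamma| * b) * `|x - y|.
Proof.
apply: (mean_value_norm (is_derive_expRM gamma)) => z zb.
rewrite normrM ler_wpM2l// gtr0_norm ?expR_gt0// ler_expR (le_trans (ler_norm _))//.
by rewrite normrM ler_wpM2l.
Qed.

(** The derivative of [scale] is 1 at 0, hence within a multiple of [e] of 1 on [[-e, e]]. This is
    one of the ingredients of the smooth fit at the maximum. *)
Lemma scale_trunc_linear gamma a x y e : 0 < a -> e <= 1 -> `|x| <= e -> `|y| <= e ->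
  `|scale_trunc gamma a x - scale_trunc gamma a y - (x - y)| <=
  `|gamma| * scale_cst gamma a * e * `|x - y|.
Proof.
move=> a0 e1 xe ye.
have e0 : 0 <= e by exact: le_trans (normr_ge0 _) xe.
have h z : `|z| <= e -> -1 <= z <= a + 1 by rewrite ler_norml => /andP[? ?]; lra.
rewrite !scale_truncE ?h//.
have [c [[_ _ ->]]] := mean_value (is_derive_scale gamma) y x.
move=> /andP[c1 c2]; rewrite -[X in _ - X]mul1r -mulrBl normrM ler_wpM2r//.
have ce : `|c| <= e.
  move: xe ye; rewrite !ler_norml => /andP[x1 x2] /andP[y1 y2]; apply/andP; split.
    by rewrite (le_trans _ c1)// le_min y1.
  by rewrite (le_trans c2)// ge_max y2.
rewrite -[X in _ - X]expR0 -(mulr0 gamma).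
have a1 : e <= a + 1 by lra.
rewrite (le_trans (@expRM_lipschitz gamma (a + 1) _ _ _ _))//.
- by rewrite (le_trans ce).
- by rewrite normr0; lra.
- by rewrite subr0 ler_wpM2l// mulr_ge0// expR_ge0.
Qed.

Lemma min0_norm gamma : `|Num.min gamma 0| <= `|gamma|.
Proof. by have := min_lipschitz 0 gamma 0; rewrite minxx !subr0. Qed.

Lemma recover_le1 gamma z : 0 <= z -> recover gamma z <= 1.
Proof.
by move=> z0; rewrite /recover expR_le1 mulr_le0_ge0// ge_min lexx orbT.
Qed.

Lemma recover_trunc_bound gamma z : `|recover_trunc gamma z| <= expR `|gamma|.
Proof.
rewrite gtr0_norm ?expR_gt0// ler_expR.
have h : -1 <= Num.max z (-1) by rewrite le_max lexx orbT.
have g : Num.min gamma 0 <= 0 by rewrite ge_min lexx orbT.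
rewrite (le_trans _ (min0_norm _))// ler0_norm//.
by move: (Num.min gamma 0) (Num.max z (-1)) h g => u v; nra.
Qed.

Lemma recover_trunc_lipschitz gamma x y :
  `|recover_trunc gamma x - recover_trunc gamma y| <= `|gamma| * expR `|gamma| * `|x - y|.
Proof.
apply: (@le_trans _ _ (`|gamma| * expR `|gamma| * `|Num.max x (-1) - Num.max y (-1)|)); last first.
  by rewrite ler_wpM2l ?max_lipschitz// mulr_ge0// expR_ge0.
apply: (mean_value_ge (is_derive_expRM (Num.min gamma 0)) (a := -1)).
- move=> z z1; rewrite normrM ler_pM ?min0_norm//.
  have := recover_trunc_bound gamma z.
  by rewrite recover_truncE.
- by rewrite le_max lexx orbT.
- by rewrite le_max lexx orbT.
Qed.

Lemma recover0 gamma : recover gamma 0 = 1.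
Proof. by rewrite /recover mulr0 expR0. Qed.

Lemma recoverB gamma z y :
  recover gamma (z - y) = recover gamma z * recover gamma (- y).
Proof. by rewrite /recover mulrDr expRD. Qed.

End ScaleFunction.

(** * Explicit value functions for a ramp payoff *)

Section ValueFunctions.
Variable R : realType.

(* [F k] is the value, as a function of the running maximum, of the payoff
   [rho * F 0] when [k] drawdowns remain and the process is at its maximum;
   [dF k] is the derivative of [F k]. *)
Record value_functions (F dF : nat -> R -> R) (S r : R -> R) (a rho K B : R)
    (n : nat) : Prop := ValueFunctions {
  vf_bound : forall k m, (k <= n)%N -> `|F k m| <= B ;
  vf_dbound : forall k m, (k <= n)%N -> `|dF k m| <= B ;
  vf_lip : forall k x y, (k <= n)%N -> `|F k x - F k y| <= B * `|x - y| ;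
  vf_dlip : forall k x y, (k <= n)%N -> `|dF k x - dF k y| <= B * `|x - y| ;
  vf_taylor : forall k x y, (0 < k <= n)%N ->
    `|F k y - F k x - dF k x * (y - x)| <= B * (y - x) ^+ 2 ;
  vf_const : forall k (m : R), (k <= n)%N -> K <= m -> F k m = F k K ;
  vf_dconst : forall k (m : R), (k <= n)%N -> K <= m -> dF k m = 0 ;
  vf_ode : forall k m, (k < n)%N -> F k.+1 m - dF k.+1 m * S a = rho * F k m ;
  vf_S : forall z, `|S z| <= B ;
  vf_Slip : forall x y, `|S x - S y| <= B * `|x - y| ;
  vf_Slin : forall x y (e : R), e <= 1 -> `|x| <= e -> `|y| <= e ->
    `|S x - S y - (x - y)| <= B * e * `|x - y| ;
  vf_S0 : S 0 = 0 ;
  vf_r : forall z, `|r z| <= B ;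
  vf_rlip : forall x y, `|r x - r y| <= B * `|x - y| ;
  vf_r0 : r 0 = 1 ;
  vf_ra : r a = rho
}.

Variables (l rho x eps : R).

(** The payoff is [rho * F 0], so that the last drawdown, which no recovery has to follow, obeys the
    same equation as the others; the factor [rho ^+ k / rho] compensates for this. *)
Definition value (k : nat) (m : R) : R :=
  rho ^+ k / rho *
  ((erlang_int k (l * (x - m)) - erlang_int k (l * (x + eps - m))) / (l * eps)).

Definition dvalue (k : nat) (m : R) : R :=
  rho ^+ k / rho *
  ((erlang_pos k (l * (x - m)) - erlang_pos k (l * (x + eps - m))) / eps).

Hypotheses (l0 : 0 < l) (rho0 : 0 < rho) (rho1 : rho <= 1) (eps0 : 0 < eps).

Let c_bound k : 0 <= rho ^+ k / rho <= rho^-1.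
Proof.
rewrite divr_ge0 ?exprn_ge0 ?(ltW rho0)//= ler_piMl ?invr_ge0 ?(ltW rho0)//.
by rewrite exprn_ile1// ltW.
Qed.

Let le0 : 0 < l * eps. Proof. by rewrite mulr_gt0. Qed.

Lemma value_bound k m : `|value k m| <= rho^-1 * k.+1%:R.
Proof.
have /andP[c0 c1] := c_bound k.
rewrite normrM (ger0_norm c0) ler_pM// normrM [`|_^-1|]gtr0_norm ?invr_gt0//.
rewrite ler_pdivrMr// (le_trans (erlang_int_lipschitz _ _ _))//.
rewrite ler_wpM2l// [X in `|X|](_ : _ = - (l * eps)) ?normrN ?gtr0_norm//.
by ring.
Qed.

Lemma dvalue_bound k m : `|dvalue k m| <= rho^-1 * eps^-1.
Proof.
have /andP[c0 c1] := c_bound k.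
rewrite normrM (ger0_norm c0) ler_pM// normrM [`|_^-1|]gtr0_norm ?invr_gt0//.
rewrite ler_piMl ?invr_ge0 ?(ltW eps0)//.
have /andP[? ?] := erlang_pos_bound k (l * (x - m)).
have /andP[? ?] := erlang_pos_bound k (l * (x + eps - m)).
by rewrite ler_norml; apply/andP; split; lra.
Qed.

Let ldist u v w : `|l * (u - v) - l * (u - w)| = l * `|v - w|.
Proof.
rewrite [X in `|X| = _](_ : _ = - (l * (v - w))); last by ring.
by rewrite normrN normrM gtr0_norm.
Qed.

Lemma value_lipschitz k u v :
  `|value k u - value k v| <= rho^-1 * (k.+1%:R * 2 / eps) * `|u - v|.
Proof.
have /andP[c0 c1] := c_bound k.
rewrite -mulrBr -mulrBl normrM (ger0_norm c0) -mulrA ler_pM// normrM.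
rewrite [`|_^-1|]gtr0_norm ?invr_gt0// ler_pdivrMr//.
rewrite [X in `|X|](_ : _ = (erlang_int k (l * (x - u)) - erlang_int k (l * (x - v)))
  - (erlang_int k (l * (x + eps - u)) - erlang_int k (l * (x + eps - v)))); last by ring.
rewrite (le_trans (ler_normB _ _))//.
apply: (le_trans (lerD (erlang_int_lipschitz _ _ _) (erlang_int_lipschitz _ _ _))).
rewrite !ldist.
rewrite le_eqVlt; apply/orP; left; apply/eqP.
by field; rewrite gt_eqF.
Qed.

Lemma dvalue_lipschitz k u v :
  `|dvalue k u - dvalue k v| <= rho^-1 * (2 * l / eps) * `|u - v|.
Proof.
have /andP[c0 c1] := c_bound k.
rewrite -mulrBr -mulrBl normrM (ger0_norm c0) -mulrA ler_pM// normrM.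
rewrite [`|_^-1|]gtr0_norm ?invr_gt0// ler_pdivrMr//.
rewrite [X in `|X|](_ : _ = (erlang_pos k (l * (x - u)) - erlang_pos k (l * (x - v)))
  - (erlang_pos k (l * (x + eps - u)) - erlang_pos k (l * (x + eps - v)))); last by ring.
rewrite (le_trans (ler_normB _ _))//.
apply: (le_trans (lerD (erlang_pos_lipschitz _ _ _) (erlang_pos_lipschitz _ _ _))).
rewrite !ldist.
rewrite le_eqVlt; apply/orP; left; apply/eqP.
by field; rewrite gt_eqF.
Qed.

Lemma value_taylor k u v : (0 < k)%N ->
  `|value k v - value k u - dvalue k u * (v - u)| <=
  rho^-1 * (4 * l / eps) * (v - u) ^+ 2.
Proof.
case: k => // k _.
have /andP[c0 c1] := c_bound k.+1.
(* The Taylor remainder of a difference quotient is the difference of the remainders at the two ends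
   of the window. *)
pose t z := erlang_int k.+1 (l * (z - v)) - erlang_int k.+1 (l * (z - u))
  + erlang_pos k.+1 (l * (z - u)) * (l * (z - v) - l * (z - u)).
rewrite [X in `|X|](_ : _ = rho ^+ k.+1 / rho * ((t x - t (x + eps)) / (l * eps))); last first.
  rewrite /value /dvalue /t; field.
  by rewrite !gt_eqF//= mulr_gt0.
have tE z : `|t z| <= 2 * (l ^+ 2 * (v - u) ^+ 2).
  rewrite (le_trans (erlang_int_taylor _ _ _))//.
  by rewrite le_eqVlt; apply/orP; left; apply/eqP; ring.
rewrite normrM (ger0_norm c0) -mulrA ler_pM// normrM.
rewrite [`|_^-1|]gtr0_norm ?invr_gt0// ler_pdivrMr//.
rewrite (le_trans (ler_normB _ _))// (le_trans (lerD (tE _) (tE _)))//.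
rewrite le_eqVlt; apply/orP; left; apply/eqP.
by field; rewrite gt_eqF.
Qed.

Let nonpos (z m : R) : z <= m -> l * (z - m) <= 0.
Proof. by move=> zm; rewrite pmulr_rle0// subr_le0. Qed.

Lemma value_const k (m : R) : x + eps <= m -> value k m = rho ^+ k / rho.
Proof.
move=> h; have xm : x <= m by rewrite (le_trans _ h)// lerDl ltW.
rewrite /value !erlang_int_neg ?nonpos//.
by field; rewrite !gt_eqF.
Qed.

Lemma dvalue_const k (m : R) : x + eps <= m -> dvalue k m = 0.
Proof.
move=> h; rewrite /dvalue; case: k => [|k]; first by rewrite subrr mul0r mulr0.
have xm : x <= m by rewrite (le_trans _ h)// lerDl ltW.
by rewrite !erlang_pos_neg ?nonpos// subrr mul0r mulr0.
Qed.

(** This is [erlang_intS] in disguise: [erlang_pos k.+1] is both minus the slope of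
    [erlang_int k.+1] and its increment over [erlang_int k]. *)
Lemma value_ode k m : value k.+1 m - dvalue k.+1 m / l = rho * value k m.
Proof.
rewrite /value /dvalue !erlang_intS exprS; field.
by rewrite !gt_eqF.
Qed.

Lemma value0_le x' : 0 <= rho * value 0 x' <= 1.
Proof.
rewrite /value expr0 mul1r mulrA mulfV ?gt_eqF// mul1r.
rewrite /erlang_int !big_geq// !addr0.
rewrite ler_pdivlMr// mul0r ler_pdivrMr// mul1r.
rewrite (_ : l * (x + eps - x') = l * (x - x') + l * eps); last by ring.
move: (l * (x - x')) (l * eps) le0 => u v v0.
by rewrite /Num.max; do 2 (case: ltP => ?); apply/andP; split; lra.
Qed.

Lemma value0_gt (m : R) : m <= x -> rho * value 0 m = 0.
Proof.
move=> h; rewrite /value /erlang_int !big_geq// !addr0.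
have xm : m <= x + eps by rewrite (le_trans h)// lerDl ltW.
by rewrite !(max_idPr _) ?subrr ?mul0r ?mulr0// oppr_le0 mulr_ge0 ?subr_ge0// ltW.
Qed.

Lemma value0_lt (m : R) : x + eps <= m -> rho * value 0 m = 1.
Proof. by move=> h; rewrite value_const// expr0 mul1r mulfV// gt_eqF. Qed.

(** The difference quotient of [erlang_int] over a window of width [l * eps] is replaced by minus
    its slope at [l * x]; the quadratic remainder divided by the width leaves [2 * (l * eps)]. *)
Lemma value_start n : 0 <= x ->
  `|value n.+1 0 - rho ^+ n * erlang n.+1 (l * x)| <= 2 * (l * eps).
Proof.
move=> x0; rewrite /value !subr0 (_ : rho ^+ n.+1 / rho = rho ^+ n); last first.
  by rewrite exprS mulrAC mulfV ?gt_eqF// mul1r.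
rewrite -mulrBr.
rewrite normrM [`|rho ^+ n|]gtr0_norm ?exprn_gt0//.
apply: (@le_trans _ _ (1 * (2 * (l * eps)))); last by rewrite mul1r.
apply: ler_pM => //; first by rewrite exprn_ge0 // ltW.
  by rewrite exprn_ile1// ltW.
have := erlang_int_taylor n (l * x) (l * (x + eps)).
rewrite erlang_posE; last by rewrite mulr_ge0// ltW.
rewrite (_ : l * (x + eps) - l * x = l * eps); last by ring.
set u := erlang_int _ _; set v := erlang_int _ _; set w := erlang _ _ => h.
rewrite [X in `|X|](_ : _ = - ((u - v + w * (l * eps)) / (l * eps))); last first.
  by field; rewrite !gt_eqF.
rewrite normrN normrM [`|_^-1|]gtr0_norm ?invr_gt0// ler_pdivrMr//.
by rewrite (le_trans h)// expr2 mulrA.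
Qed.

End ValueFunctions.

Lemma value_functionsP (R : realType) (gamma a x eps : R) n :
  0 < a -> 0 < eps ->
  let l := drawdown_rate gamma a in let rho := recover gamma a in
  exists B, value_functions (value l rho x eps) (dvalue l rho x eps)
    (scale_trunc gamma a) (recover_trunc gamma) a rho (x + eps) B n.
Proof.
move=> a0 eps0 l rho.
have [l0 lS] := drawdown_rate_scale gamma a0.
have rho0 : 0 < rho by exact: expR_gt0.
have rho1 : rho <= 1 by apply: recover_le1; exact: ltW.
pose c1 := rho^-1 * n.+1%:R.
pose c2 := rho^-1 * eps^-1.
pose c3 := rho^-1 * (n.+1%:R * 2 / eps).
pose c4 := rho^-1 * (2 * l / eps).
pose c5 := rho^-1 * (4 * l / eps).
pose c6 := (a + 1) * scale_cst gamma a.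
pose c7 := scale_cst gamma a.
pose c8 := `|gamma| * scale_cst gamma a.
pose c9 := expR `|gamma|.
pose c10 := `|gamma| * expR `|gamma|.
have ri : 0 <= rho^-1 by rewrite invr_ge0 ltW.
have ei : 0 <= eps^-1 by rewrite invr_ge0 ltW.
have h1 : 0 <= c1 by rewrite mulr_ge0.
have h2 : 0 <= c2 by rewrite mulr_ge0.
have h3 : 0 <= c3 by rewrite !mulr_ge0.
have h4 : 0 <= c4 by rewrite !mulr_ge0// ltW.
have h5 : 0 <= c5 by rewrite !mulr_ge0// ltW.
have h7 : 0 <= c7 by exact: expR_ge0.
have h6 : 0 <= c6 by rewrite mulr_ge0//; lra.
have h8 : 0 <= c8 by rewrite mulr_ge0.
have h9 : 0 <= c9 by exact: expR_ge0.
have h10 : 0 <= c10 by rewrite mulr_ge0// expR_ge0.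
pose B := c1 + c2 + c3 + c4 + c5 + c6 + c7 + c8 + c9 + c10.
have w c t y : 0 <= t -> y <= c * t -> c <= B -> y <= B * t.
  by move=> t0 yc cB; rewrite (le_trans yc)// ler_wpM2r.
exists B; split.
- move=> k m kn; apply: (@le_trans _ _ c1); last by rewrite /B; lra.
  rewrite (le_trans (value_bound _ _ _ _ _ _ _))//.
  by rewrite ler_wpM2l// ler_nat ltnS.
- move=> k m _; apply: (@le_trans _ _ c2); last by rewrite /B; lra.
  exact: dvalue_bound.
- move=> k u v kn; apply: (w c3) => //; last by rewrite /B; lra.
  rewrite (le_trans (value_lipschitz _ _ _ _ _ _ _ _))//.
  by rewrite ler_wpM2r// ler_wpM2l// ler_wpM2r// ler_wpM2r// ler_nat ltnS.
- move=> k u v _; apply: (w c4) => //; last by rewrite /B; lra.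
  exact: dvalue_lipschitz.
- move=> k u v /andP[k0 _]; apply: (w c5) => //; first exact: sqr_ge0.
    exact: value_taylor.
  by rewrite /B; lra.
- by move=> k m _ h; rewrite !value_const.
- by move=> k m _ h; rewrite dvalue_const.
- move=> k m _; rewrite scale_truncE; last by apply/andP; split; lra.
  rewrite -(value_ode x l0 rho0 eps0); congr (_ - _ * _).
  by rewrite -[LHS]mul1r -[X in X * _](mulVf (lt0r_neq0 l0)) -mulrA lS mulr1.
- move=> z; apply: (@le_trans _ _ c6); last by rewrite /B; lra.
  exact: scale_trunc_bound.
- move=> u v; apply: (w c7) => //; last by rewrite /B; lra.
  exact: scale_trunc_lipschitz.
- move=> u v e e1 ue ve; rewrite -mulrA; apply: (w c8).
  + by rewrite mulr_ge0// (le_trans _ ue).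
  + by rewrite mulrA; exact: scale_trunc_linear.
  + by rewrite /B; lra.
- rewrite scale_truncE ?scale0//; apply/andP; split; lra.
- move=> z; apply: (@le_trans _ _ c9); last by rewrite /B; lra.
  exact: recover_trunc_bound.
- move=> u v; apply: (w c10) => //; last by rewrite /B; lra.
  exact: recover_trunc_lipschitz.
- by rewrite recover_truncE ?recover0//; lra.
- by rewrite recover_truncE//; lra.
Qed.

(** * Running maximum and drawdown times *)

Section RunningMax.
Context (R : realType) (T : Type) (X : R -> T -> R) (w : T).
Hypothesis cX : continuous (X^~ w).
Local Notation p t := (X t w).
Local Notation M t := (running_max X t w).
Implicit Types (s t u v e c : R).

Let path_max t : 0 <= t -> exists2 u, 0 <= u <= t &
  forall v, 0 <= v <= t -> p v <= p u.
Proof.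
move=> t0; have [||u + h] := @EVT_max R (X^~ w) 0 t; first by [].
  exact: continuous_subspaceT.
by rewrite in_itv/= => ut; exists u => // v vt; apply: h; rewrite in_itv.
Qed.

Lemma running_max_attained t : 0 <= t -> exists2 u, 0 <= u <= t & M t = p u.
Proof.
move=> t0; have [u ut h] := path_max t0; exists u => //.
apply/eqP; rewrite eq_le; apply/andP; split.
  apply: ge_sup; first by exists (p u), u => //; rewrite /= in_itv.
  by move=> _ [v + <-]; rewrite /= in_itv/=; exact: h.
apply: ub_le_sup; last by exists u => //=; rewrite in_itv.
by exists (p u) => _ [v + <-]; rewrite /= in_itv/=; exact: h.
Qed.

Lemma running_max_ge s t : 0 <= s -> s <= t -> p s <= M t.
Proof.
move=> s0 st; have [u ut h] := path_max (le_trans s0 st).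
apply: ub_le_sup; last by exists s => //=; rewrite in_itv/= s0.
by exists (p u) => _ [v + <-]; rewrite /= in_itv/=; exact: h.
Qed.

Lemma running_max_le t c : 0 <= t -> (forall u, 0 <= u -> u <= t -> p u <= c) ->
  M t <= c.
Proof.
by move=> t0 h; have [u /andP[u0 ut] ->] := running_max_attained t0; exact: h.
Qed.

Lemma running_max_homo s t : 0 <= s -> s <= t -> M s <= M t.
Proof.
move=> s0 st; apply: running_max_le => // u u0 us.
by apply: running_max_ge => //; exact: le_trans us st.
Qed.

Lemma running_max0 : M 0 = p 0.
Proof.
have [u /andP[u0 u1] ->] := running_max_attained (lexx 0).
by have -> : u = 0 by apply/eqP; rewrite eq_le u0 u1.
Qed.

Lemma running_max_increase s t : 0 <= s -> s <= t -> M s < M t ->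
  exists u, [/\ s <= u, u <= t & M t = p u].
Proof.
move=> s0 st st'; have [u /andP[u0 ut] e] := running_max_attained (le_trans s0 st).
exists u; split => //; rewrite leNgt; apply/negP => us; move: st'.
by rewrite e ltNge running_max_ge// ltW.
Qed.

Definition osc_le s t e := forall u v, s <= u -> u <= t -> s <= v -> v <= t ->
  `|p u - p v| <= e.

Lemma osc_leW s t s' t' e : s <= s' -> t' <= t -> osc_le s t e -> osc_le s' t' e.
Proof.
move=> ss tt h u v su ut sv vt; apply: h.
- exact: le_trans su.
- exact: le_trans tt.
- exact: le_trans sv.
- exact: le_trans tt.
Qed.

Lemma running_max_osc s t e : 0 <= s -> s <= t -> osc_le s t e ->
  M t <= M s + e.
Proof.
move=> s0 st h; have e0 : 0 <= e by apply: le_trans (normr_ge0 _) (h s s _ _ _ _).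
have [ts|ts] := leP (M t) (M s); first by lra.
have [u [su ut ->]] := running_max_increase s0 st ts.
have := running_max_ge s0 (lexx s); have := h u s su ut (lexx s) st.
by rewrite ler_norml => /andP[_ ?] ?; lra.
Qed.

Lemma path_unif_cont c e : 0 < e -> exists2 d, 0 < d &
  forall s t, 0 <= s -> s <= t -> t <= c -> t - s < d -> osc_le s t e.
Proof.
move=> e0.
have /compact_near_coveringP h := @segment_compact R 0 c.
(* The window size [d] runs through the right neighbourhoods of 0, so compactness merges the local
   moduli of continuity into a single one. *)
have [|d /= d0 hd] := h R (0^'+) (fun (d : R) x => forall u, `|u - x| < d -> `|p u - p x| < e / 2) _.
  move=> x _.
  have e4 : 0 < e / 4 by rewrite divr_gt0.
  have /cvgrPdist_lt/(_ _ e4)[d/= d0 hd] := @cX x.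
  exists (ball x (d / 2), [set z | z < d / 2]) => /=.
    split; first exact/nbhsx_ballx/divr_gt0.
    by apply: nbhs_right_lt; rewrite divr_gt0.
  move=> [y z] /= [xy zd] u uy.
  have h1 := hd y; have h2 := hd u; rewrite /ball/= in xy h1 h2.
  rewrite -(subrKA (p x)).
  have xu : `|x - u| < d.
    rewrite -(subrKA y) (le_lt_trans (ler_normD _ _))//.
    by rewrite [d]splitr ltrD// distrC (lt_trans uy).
  have xy' : `|x - y| < d by rewrite (lt_trans xy)// ltr_pdivrMr// ltr_pMr// ltr1n.
  rewrite (le_lt_trans (ler_normD _ _))//.
  have -> : e / 2 = e / 4 + e / 4 by lra.
  by rewrite ltrD// ?h1// distrC h2.
have d20 : 0 < d / 2 by rewrite divr_gt0.
exists (d / 2) => // s t s0 st tc ts u v su ut sv vt.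
have hs x : s <= x -> x <= t -> `|p x - p s| <= e / 2.
  move=> sx xt; apply/ltW/(hd (d / 2)) => //=.
  - by rewrite sub0r normrN gtr0_norm// ltr_pdivrMr// ltr_pMr// ltr1n.
  - by rewrite in_itv/= s0 (le_trans st).
  - by rewrite ger0_norm ?subr_ge0// (le_lt_trans _ ts)// lerB.
rewrite -(subrKA (p s)) (le_trans (ler_normD _ _))// [e]splitr lerD ?hs//.
by rewrite distrC hs.
Qed.

Lemma path_right_osc t e : 0 <= t -> 0 < e -> exists2 d, 0 < d & osc_le t (t + d) e.
Proof.
move=> t0 e0; have [d d0 h] := path_unif_cont (t + 1) e0.
have m0 : 0 < Num.min (d / 2) 1 by rewrite lt_min ltr01 divr_gt0.
exists (Num.min (d / 2) 1) => //; apply: h => //.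
- by rewrite lerDl ltW.
- by rewrite lerD2l ge_min lexx orbT.
- by rewrite addrC addKr (le_lt_trans (_ : _ <= d / 2))// ?ge_min ?lexx//; lra.
Qed.

End RunningMax.

Section DrawdownTimes.
Context (R : realType) (T : Type) (X : R -> T -> R) (w : T) (a : R).
Hypotheses (cX : continuous (X^~ w)) (a0 : 0 < a).
Local Notation p t := (X t w).
Local Notation M t := (running_max X t w).
Local Notation tau k := (drawdown_time X a k w).
Implicit Types (s t u v e r : R) (k : nat).

Let hit r := [set t : R | [/\ r < t, a <= M t - p t & M r < M t]].

(** The hitting set is not obviously closed, since [M r < M t] is strict. At its infimum [s] the
    drawdown is at least [a] by continuity; just after [s] the path is therefore still below [M s],
    so the nearby hitting times can have exceeded [M r] only if [M s] already does. *)
Let hit_first r : 0 <= r -> hit r !=set0 ->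
  exists2 s, hit r s & forall t, hit r t -> s <= t.
Proof.
move=> r0 H0; have a0' := a0.
have Hlb : has_lbound (hit r) by exists r => t [/ltW].
have Hinf : has_inf (hit r) by [].
pose s := inf (hit r).
have sle t : hit r t -> s <= t by move=> Ht; exact: ge_inf.
have rs : r <= s by apply: lb_le_inf => // t [/ltW].
have s0 := le_trans r0 rs.
exists s => //.
have close e : 0 < e -> exists t, [/\ hit r t, s <= t & osc_le X w s t e].
  move=> e0; have [d d0 hd] := path_right_osc cX s0 e0.
  have [t Ht td] := inf_adherent d0 Hinf.
  exists t; split => //; first exact: sle.
  exact: osc_leW (lexx s) (ltW td) hd.
have Ds : a <= M s - p s.
  rewrite leNgt; apply/negP => Ds.
  have e0 : 0 < (a - (M s - p s)) / 3 by lra.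
  have [t [[_ Dt _] st ot]] := close _ e0.
  have := running_max_osc cX s0 st ot.
  have := ot s t (lexx s) st st (lexx t).
  by rewrite ler_norml => /andP[? ?] ?; lra.
have Ms : M r < M s.
  rewrite ltNge; apply/negP => Ms.
  have e0 : 0 < a / 2 by lra.
  have [t [[rt Dt Mt] st ot]] := close _ e0.
  have [u [su ut eu]] := running_max_increase cX s0 st (le_lt_trans Ms Mt).
  have := ot u s su ut (lexx s) st.
  rewrite ler_norml => /andP[? ?].
  by move: Mt; rewrite eu; lra.
split => //; rewrite lt_neqAle rs andbT; apply/eqP => e.
by rewrite -e ltxx in Ms.
Qed.

Lemma drawdown_time_ge0 k : (0 <= tau k)%E.
Proof.
elim: k => //= k; case: (tau k) => [r| |] //= r0.
apply: le_ereal_inf_tmp => _ [t [rt _ _] <-].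
by rewrite lee_fin (le_trans _ (ltW rt)).
Qed.

(** Turns the recursive infimum into an attained first hitting time. The second alternative covers
    both an infinite [tau k], where its last clause is vacuous, and a finite one with an empty
    hitting set. *)
Lemma drawdown_timeS k :
  (exists r s, [/\ tau k = r%:E, tau k.+1 = s%:E, 0 <= r,
      [/\ r < s, a <= M s - p s & M r < M s] &
      forall t, r < t -> a <= M t - p t -> M r < M t -> s <= t]) \/
  (tau k.+1 = +oo%E /\ forall r, tau k = r%:E ->
     forall t, r < t -> a <= M t - p t -> M t <= M r).
Proof.
have := drawdown_time_ge0 k; rewrite /=; case: (tau k) => [r| |] //=; last first.
  by right.
rewrite lee_fin => r0; have [H0|H0] := pselect (hit r !=set0).
  left; have [s hs hmin] := hit_first r0 H0; exists r, s; split => //; last first.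
    by move=> t *; apply: hmin; split.
  apply/eqP; rewrite eq_le; apply/andP; split.
    by apply: ereal_inf_lbound; exists s.
  by apply: le_ereal_inf_tmp => _ [t ht <-]; rewrite lee_fin; exact: hmin.
right; split.
  rewrite [X in ereal_inf X](_ : _ = set0) ?ereal_inf0//.
  by rewrite -subset0 => _ [t ht <-]; apply: H0; exists t.
move=> _ [<-] t rt Dt; rewrite leNgt; apply/negP => Mt.
by apply: H0; exists t; split.
Qed.

End DrawdownTimes.

(** * Stages of a path *)

Section Stages.
Context (R : realType) (T : Type) (X : R -> T -> R) (a : R).
Implicit Types (w : T) (s t u v e r : R) (k j : nat).

Definition past k t w : bool := (drawdown_time X a k w <= t%:E)%E.

(** At an infinite drawdown time [fine] returns 0, so this is the maximum at time 0; it is therefore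
    always paired with [past] or with finiteness. *)
Definition max_at k w : R := running_max X (fine (drawdown_time X a k w)) w.

(** Stays true after the next drawdown, unlike [hunting]; being monotone in [t], it can be counted
    in [progress]. *)
Definition recovered k t w : bool :=
  past k t w && (max_at k w < running_max X t w).

(* Between the k-th drawdown and the next one, the process is either below the
   maximum [max_at k] ([recovering]) or has exceeded it ([hunting]). *)
Definition recovering k t w : bool := past k t w && ~~ recovered k t w.

Definition hunting k t w : bool := recovered k t w && ~~ past k.+1 t w.

Variable w : T.
Hypotheses (cX : continuous (X^~ w)) (a0 : 0 < a).
Local Notation p t := (X t w).
Local Notation M t := (running_max X t w).

Lemma past0 t : past 0 t w = (0 <= t).
Proof. by rewrite /past /= lee_fin. Qed.

Lemma past_fin k t : past k t w ->
  exists r, [/\ drawdown_time X a k w = r%:E, 0 <= r, r <= t & max_at k w = M r].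
Proof.
rewrite /past /max_at; have := drawdown_time_ge0 X w a k.
case: drawdown_time => [r| |]//; rewrite lee_fin => r0; rewrite lee_fin => rt.
by exists r.
Qed.

Lemma past_ge0 k t : past k t w -> 0 <= t.
Proof. by move=> /past_fin[r [_ r0 rt _]]; exact: le_trans rt. Qed.

Lemma past_homo k s t : s <= t -> past k s w -> past k t w.
Proof. by move=> st h; rewrite /past (le_trans h)// lee_fin. Qed.

Lemma recovered_homo k s t : s <= t -> recovered k s w -> recovered k t w.
Proof.
move=> st /andP[ps ls]; rewrite /recovered (past_homo st ps)/=.
by rewrite (lt_le_trans ls)// running_max_homo// (past_ge0 ps).
Qed.

Lemma pastS_recovered k t : past k.+1 t w -> recovered k t w.
Proof.
rewrite /recovered /past /max_at.
have [[r [s [-> -> r0 [rs _ Ms] _]]]|[-> _]] := drawdown_timeS cX a0 k; last first.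
  by rewrite leye_eq.
rewrite !lee_fin /= => st; rewrite (le_trans (ltW rs))//=.
by rewrite (lt_le_trans Ms)// running_max_homo// (le_trans r0)// ltW.
Qed.

Lemma recovered_pastS k t : recovered k t w -> a <= M t - p t -> past k.+1 t w.
Proof.
rewrite /recovered => /andP[pk lk] Dt.
have [r [e r0 rt em]] := past_fin pk; rewrite em in lk.
have rt' : r < t.
  by rewrite lt_neqAle rt andbT; apply/eqP => e'; rewrite e' ltxx in lk.
rewrite /past; have [[r' [s [e1 -> _ _ h]]]|[_ h]] := drawdown_timeS cX a0 k.
  by rewrite lee_fin; move: e1; rewrite e => -[e1]; apply: h; rewrite -?e1.
by have := h _ e _ rt' Dt; rewrite leNgt lk.
Qed.

Lemma pastS_cross k s t : ~~ past k.+1 s w -> past k.+1 t w ->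
  exists v, [/\ s < v, v <= t, a <= M v - p v, max_at k.+1 w = M v & past k.+1 v w].
Proof.
rewrite /past /max_at.
have [[r [v [_ -> r0 [rv Dv _] _]]]|[-> _]] := drawdown_timeS cX a0 k; last first.
  by rewrite leye_eq.
rewrite !lee_fin -ltNge => sv vt; exists v; split => //.
Qed.

Lemma past_le k j t : (j <= k)%N -> past k t w -> past j t w.
Proof.
move=> jk; rewrite -(subnK jk); elim: (k - j)%N => // m IH.
by rewrite addSn => /pastS_recovered/andP[/IH].
Qed.

Lemma past_recovered k j t : (j < k)%N -> past k t w -> recovered j t w.
Proof. by move=> jk /(past_le jk)/pastS_recovered. Qed.

Lemma not_recovered k t : past k t w -> ~~ recovered k t w -> M t = max_at k w.
Proof.
rewrite /recovered => pk; rewrite pk/= -leNgt => h.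
have [r [e r0 rt em]] := past_fin pk.
by apply/eqP; rewrite eq_le h em running_max_homo.
Qed.

Lemma hunting_drawdown k t : hunting k t w -> M t - p t < a.
Proof.
move=> /andP[rk nk]; rewrite ltNge; apply/negP => /(recovered_pastS rk) h.
by rewrite h in nk.
Qed.

Lemma stageP n t : 0 <= t ->
  past n t w \/ exists2 k, (k < n)%N & recovering k t w || hunting k t w.
Proof.
move=> t0; elim: n => [|n [IH|[k kn IH]]]; first by left; rewrite past0.
  have [rn|rn] := boolP (recovered n t w).
    have [pn|pn] := boolP (past n.+1 t w); first by left.
    by right; exists n => //; rewrite /hunting rn pn orbT.
  by right; exists n => //; rewrite /recovering IH rn.
by right; exists k => //; rewrite ltnW.
Qed.

Lemma recovering_neq k j t : recovering k t w ->
  hunting j t w = false /\ (j != k -> recovering j t w = false).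
Proof.
move=> /andP[pk nk]; have [jk|kj|->] := ltngtP j k.
- by rewrite /hunting /recovering (past_le jk pk) (past_recovered jk pk)/= !andbF.
- have nj : ~~ past j t w by apply: contra nk; exact: past_recovered.
  by rewrite /hunting /recovering /recovered (negbTE nj).
- by rewrite /hunting (negbTE nk).
Qed.

Lemma hunting_neq k j t : hunting k t w ->
  (j != k -> hunting j t w = false) /\ recovering j t w = false.
Proof.
move=> /andP[rk nk]; have pk : past k t w by case/andP: rk.
have [jk|kj|->] := ltngtP j k.
- by rewrite /hunting /recovering (past_le jk pk) (past_recovered jk pk)/= !andbF.
- have nj : ~~ past j t w by apply: contra nk; exact: past_le.
  by rewrite /hunting /recovering /recovered (negbTE nj).
- by rewrite /recovering rk andbF.
Qed.

Lemma past_neq k j t : (j < k)%N -> past k t w ->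
  hunting j t w = false /\ recovering j t w = false.
Proof.
move=> jk pk.
by rewrite /hunting /recovering (past_le jk pk) (past_recovered jk pk) !andbF.
Qed.

End Stages.

(** * The value process and the progress along a path *)

Section ValueProcess.
Context (R : realType) (T : Type) (X : R -> T -> R) (a : R).
Variables (F dF : nat -> R -> R) (S r : R -> R) (rho K B : R) (n : nat).
Implicit Types (t : R) (w : T).

Definition val_cst t w : R :=
  \sum_(k < n) (hunting X a k t w)%:R * F (n - k) (running_max X t w)
  + (past X a n t w)%:R * (rho * F 0 (max_at X a n w)).

Definition val_scale t w : R :=
  - \sum_(k < n) (hunting X a k t w)%:R * dF (n - k) (running_max X t w).

Definition val_recover t w : R :=
  \sum_(k < n) (recovering X a k t w)%:R * F (n - k) (running_max X t w).

(* The coefficients depend on the path up to time [t] only: when the stage is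
   frozen and [y] moves with the path, each term is a product of a past factor
   and of a function of the increment. *)
Definition stage_value t w y : R :=
  val_cst t w + val_scale t w * S (running_max X t w - y)
  + val_recover t w * r (running_max X t w - y).

(* Counts the stages gone through, plus the maximum below the level [K] above
   which the value functions are constant. *)
Definition progress t w : R :=
  \sum_(k < n) ((recovered X a k t w)%:R + (past X a k.+1 t w)%:R)
  + Num.min (running_max X t w) K.

Lemma sum_indicator (b : nat -> bool) (f : nat -> R) k : (k < n)%N -> b k ->
  (forall j, j != k -> b j = false) ->
  \sum_(j < n) (b j)%:R * f j = f k.
Proof.
move=> kn bk bj; rewrite (bigD1 (Ordinal kn))//= bk mul1r big1 ?addr0// => j jk.
by rewrite bj ?mul0r.
Qed.

Lemma sum_indicator0 (b : nat -> bool) (f : nat -> R) :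
  (forall j, (j < n)%N -> b j = false) ->
  \sum_(j < n) (b j)%:R * f j = 0.
Proof. by move=> bj; rewrite big1// => j _; rewrite bj ?mul0r. Qed.

Variable w : T.
Hypotheses (cX : continuous (X^~ w)) (a0 : 0 < a).
Local Notation p t := (X t w).
Local Notation M t := (running_max X t w).

Let not_past k t : (k < n)%N -> ~~ past X a k.+1 t w -> past X a n t w = false.
Proof.
by move=> kn pk; apply/negbTE; apply: contra pk; exact: past_le.
Qed.

Let sum_hunting t (f : nat -> R) := \sum_(k < n) (hunting X a k t w)%:R * f k.
Let sum_recovering t (f : nat -> R) := \sum_(k < n) (recovering X a k t w)%:R * f k.

Let valE t y : stage_value t w y =
  sum_hunting t (fun k => F (n - k) (M t))
  + (past X a n t w)%:R * (rho * F 0 (max_at X a n w))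
  - sum_hunting t (fun k => dF (n - k) (M t)) * S (M t - y)
  + sum_recovering t (fun k => F (n - k) (M t)) * r (M t - y).
Proof. by rewrite /stage_value /val_scale mulNr. Qed.

Lemma val_done t y : past X a n t w -> stage_value t w y = rho * F 0 (max_at X a n w).
Proof.
move=> pn; rewrite valE pn mul1r.
have h f : sum_hunting t f = 0.
  by apply: (sum_indicator0 (b := fun j => hunting X a j t w)) => j jn; case: (past_neq cX a0 jn pn).
have h' f : sum_recovering t f = 0.
  by apply: (sum_indicator0 (b := fun j => recovering X a j t w)) => j jn; case: (past_neq cX a0 jn pn).
by rewrite !h h' !mul0r subr0 addr0 add0r.
Qed.

Lemma val_hunting k t y : (k < n)%N -> hunting X a k t w ->
  stage_value t w y = F (n - k) (M t) - dF (n - k) (M t) * S (M t - y).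
Proof.
move=> kn hk; rewrite valE (not_past kn) ?mul0r ?addr0; last by case/andP: hk.
have h f : sum_hunting t f = f k.
  by apply: (sum_indicator (b := fun j => hunting X a j t w) _ kn hk) => j; case: (hunting_neq cX a0 j hk).
have h' f : sum_recovering t f = 0.
  by apply: (sum_indicator0 (b := fun j => recovering X a j t w)) => j _; case: (hunting_neq cX a0 j hk).
by rewrite !h h' mul0r addr0.
Qed.

Lemma val_recovering k t y : (k < n)%N -> recovering X a k t w ->
  stage_value t w y = r (M t - y) * F (n - k) (M t).
Proof.
move=> kn hk; rewrite valE.
have -> : past X a n t w = false.
  have /andP[_] := hk; apply: contraNF; exact: past_recovered.
have h f : sum_recovering t f = f k.
  by apply: (sum_indicator (b := fun j => recovering X a j t w) _ kn hk) => j; case: (recovering_neq cX a0 j hk).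
have h' f : sum_hunting t f = 0.
  by apply: (sum_indicator0 (b := fun j => hunting X a j t w)) => j _; case: (recovering_neq cX a0 j hk).
by rewrite !h' h !mul0r subr0 !add0r mulrC.
Qed.

Lemma val_recover_done t : past X a n t w -> val_recover t w = 0.
Proof.
move=> pn; apply: (sum_indicator0 (b := fun j => recovering X a j t w)
  (fun k => F (n - k) (M t))) => j jn.
by case: (past_neq cX a0 jn pn).
Qed.

Lemma val_recoverE k t : (k < n)%N -> recovering X a k t w ->
  val_recover t w = F (n - k) (M t).
Proof.
move=> kn hk; apply: (sum_indicator (b := fun j => recovering X a j t w)
  (fun k => F (n - k) (M t)) kn hk) => j.
by case: (recovering_neq cX a0 j hk).
Qed.

End ValueProcess.

(** * Change of the value over a step *)

Section StepBound.
Context (R : realType) (T : Type) (X : R -> T -> R) (a : R).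
Variables (F dF : nat -> R -> R) (S r : R -> R) (rho K B : R) (n : nat).
Hypothesis V : value_functions F dF S r a rho K B n.
Implicit Types (t : R) (w : T).

Lemma vf_B1 : 1 <= B.
Proof. by have := vf_r V 0; rewrite (vf_r0 V) normr1. Qed.

Let B0 : 0 <= B. Proof. exact: le_trans ler01 vf_B1. Qed.

Let psi j m y := F j m - dF j m * S (m - y).

Let psi_bound j m y : (j <= n)%N -> `|psi j m y| <= B + B ^+ 2.
Proof.
move=> jn; rewrite /psi (le_trans (ler_normB _ _))// lerD ?(vf_bound V)//.
by rewrite normrM expr2 ler_pM// ?(vf_dbound V)// (vf_S V).
Qed.

Let psi_lip j u v y : (j <= n)%N ->
  `|psi j v y - psi j u y| <= (B + 2 * B ^+ 2) * `|v - u|.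
Proof.
move=> jn; rewrite /psi.
rewrite [X in `|X|](_ : _ = (F j v - F j u) -
  ((dF j v - dF j u) * S (v - y) + dF j u * (S (v - y) - S (u - y)))); last by ring.
rewrite (le_trans (ler_normB _ _))// [leRHS]mulrDl lerD ?(vf_lip V)//.
rewrite (le_trans (ler_normD _ _))// mulr_natl mulr2n [leRHS]mulrDl expr2 lerD// normrM.
  by rewrite mulrAC ler_pM// ?(vf_S V) ?(vf_dlip V).
rewrite -mulrA ler_pM// ?(vf_dbound V)// (le_trans (vf_Slip V _ _))//.
by rewrite opprB addrA subrK.
Qed.

(** Smooth fit: at [m = y] the derivative of [psi j m y] in [m] is [F' - F' S'(0) - F'' S(0) = 0].
    Within [e] of the diagonal, what is left is the Taylor remainder of [F], the variation of [dF]
    times a small [S], and the deviation of [S] from the identity. *)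
Let psi_near j u v y e : (0 < j <= n)%N -> e <= 1 -> `|u - y| <= e -> `|v - y| <= e ->
  `|psi j v y - psi j u y| <= 4 * (B + B ^+ 2) * e * `|v - u|.
Proof.
move=> /andP[j0 jn] e1 ue ve; rewrite /psi.
have e0 : 0 <= e by apply: le_trans ue.
rewrite [X in `|X|](_ : _ = (F j v - F j u - dF j u * (v - u)) -
  (dF j v - dF j u) * S (v - y)
  - dF j u * (S (v - y) - S (u - y) - ((v - y) - (u - y)))); last by ring.
have vu : `|v - u| <= 2 * e.
  rewrite (_ : v - u = (v - y) - (u - y)); last by ring.
  by rewrite (le_trans (ler_normB _ _))// mulr_natl mulr2n lerD.
have h1 : `|F j v - F j u - dF j u * (v - u)| <= B * (2 * e * `|v - u|).
  rewrite (le_trans (vf_taylor V _ _ _))// ?j0// ler_wpM2l//.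
  by rewrite -real_normK ?num_real// expr2 ler_wpM2r.
have h2 : `|(dF j v - dF j u) * S (v - y)| <= B ^+ 2 * (e * `|v - u|).
  rewrite normrM [leRHS](_ : _ = (B * `|v - u|) * (B * e)); last by ring.
  rewrite ler_pM// ?(vf_dlip V)// -[S _]subr0 -(vf_S0 V).
  by rewrite (le_trans (vf_Slip V _ _))// subr0 ler_wpM2l.
have h3 : `|dF j u * (S (v - y) - S (u - y) - ((v - y) - (u - y)))| <= B ^+ 2 * (e * `|v - u|).
  rewrite normrM expr2 -mulrA ler_pM// ?(vf_dbound V)//.
  rewrite (le_trans (vf_Slin V e1 _ _))// -mulrA ler_wpM2l// ler_wpM2l//.
  by rewrite opprB addrA subrK.
have B20 := sqr_ge0 B; have B0' := B0.
have z0 : 0 <= e * `|v - u| by rewrite mulr_ge0.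
rewrite (le_trans (ler_normB _ _))// (le_trans (lerD (ler_normB _ _) (lexx _)))//.
rewrite (le_trans (lerD (lerD h1 h2) h3))//.
rewrite -[2 * e * _]mulrA -[X in _ <= X]mulrA.
by move: (e * _) z0 (B ^+ 2) B20 => z z0 B2 B20; nra.
Qed.

Variable w : T.
Hypotheses (cX : continuous (X^~ w)) (a0 : 0 < a).
Local Notation p t := (X t w).
Local Notation M t := (running_max X t w).
Local Notation val t y := (stage_value X a F dF S r rho n t w y).
Local Notation prog t := (progress X a K n t w).
Local Notation C := (4 * (B + B ^+ 2)).

Lemma val_bound t y : 0 <= t -> `|val t y| <= B + B ^+ 2.
Proof.
move=> t0; have [pn|[k kn /orP[rk|hk]]] := stageP X a w n t0.
- rewrite (val_done _ _ _ _ _ cX a0 _ pn) normrM -[leLHS]add0r lerD// expr2.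
  by rewrite ler_pM// ?(vf_bound V)// -(vf_ra V) (vf_r V).
- rewrite (val_recovering _ _ _ _ _ cX a0 _ kn rk) normrM -[leLHS]add0r lerD// expr2.
  by rewrite ler_pM// ?(vf_bound V) ?leq_subr// (vf_r V).
- rewrite (val_hunting _ _ _ _ _ cX a0 _ kn hk).
  by rewrite psi_bound// leq_subr.
Qed.

(** The last clause keeps the truncation of [S] harmless: the scale term is present only while
    hunting, when the drawdown is below [a]. *)
Lemma val_coefficients t : 0 <= t ->
  [/\ `|val_scale X a dF n t w| <= B, `|val_recover X a F n t w| <= B &
    val_scale X a dF n t w != 0 -> M t - p t < a].
Proof.
move=> t0; rewrite /val_scale /val_recover.
have S0 (b : nat -> bool) (f : nat -> R) : (forall j, (j < n)%N -> b j = false) ->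
    \sum_(j < n) (b j)%:R * f j = 0 :> R by exact: (@sum_indicator0 R n b f).
have [pn|[k kn /orP[rk|hk]]] := stageP X a w n t0.
- rewrite (S0 (fun j => hunting X a j t w) (fun j => dF (n - j) (M t))); last first.
    by move=> j jn; case: (past_neq cX a0 jn pn).
  rewrite (S0 (fun j => recovering X a j t w) (fun j => F (n - j) (M t))); last first.
    by move=> j jn; case: (past_neq cX a0 jn pn).
  by rewrite oppr0 normr0 eqxx.
- rewrite (S0 (fun j => hunting X a j t w) (fun j => dF (n - j) (M t))); last first.
    by move=> j jn; case: (recovering_neq cX a0 j rk).
  rewrite (sum_indicator (b := fun j => recovering X a j t w) (fun j => F (n - j) (M t)) kn rk); last first.
    by move=> j; case: (recovering_neq cX a0 j rk).
  by rewrite oppr0 normr0 eqxx (vf_bound V) ?leq_subr.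
- rewrite (S0 (fun j => recovering X a j t w) (fun j => F (n - j) (M t))); last first.
    by move=> j jn; case: (hunting_neq cX a0 j hk).
  rewrite (sum_indicator (b := fun j => hunting X a j t w) (fun j => dF (n - j) (M t)) kn hk); last first.
    by move=> j; case: (hunting_neq cX a0 j hk).
  by rewrite normr0 normrN (vf_dbound V) ?leq_subr//; split => // _; exact: hunting_drawdown hk.
Qed.

(** Above [K] the maximum no longer influences the value, which allows [progress] to count it only
    up to [K]. *)
Let min_psi j m y : (j <= n)%N -> psi j m y = psi j (Num.min m K) y.
Proof.
move=> jn; have [//|Km] := leP m K.
by rewrite /psi (vf_const V jn (ltW Km)) !(vf_dconst V) ?(ltW Km)// !mul0r.
Qed.

Let stage_diff s t k : s <= t -> 0 <= (recovered X a k t w)%:R - (recovered X a k s w)%:R :> R /\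
  0 <= (past X a k.+1 t w)%:R - (past X a k.+1 s w)%:R :> R.
Proof.
move=> st; split; rewrite subr_ge0 ler_nat.
  have := @recovered_homo _ _ _ a _ cX k _ _ st.
  by case: recovered => // /(_ isT) ->.
have := @past_homo _ _ X a w k.+1 _ _ st.
by case: past => // /(_ isT) ->.
Qed.

Let progressB s t : prog t - prog s =
  \sum_(k < n) (((recovered X a k t w)%:R - (recovered X a k s w)%:R) +
    ((past X a k.+1 t w)%:R - (past X a k.+1 s w)%:R)) +
  (Num.min (M t) K - Num.min (M s) K).
Proof.
rewrite /progress opprD addrACA; congr (_ + _).
by rewrite -sumrB; apply: eq_bigr => k _; rewrite opprD addrACA.
Qed.

Let min_homo s t : 0 <= s -> s <= t -> Num.min (M s) K <= Num.min (M t) K.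
Proof.
by move=> s0 st; rewrite le_min !ge_min lexx orbT andbT running_max_homo.
Qed.

Lemma progress_min s t : 0 <= s -> s <= t ->
  Num.min (M t) K - Num.min (M s) K <= prog t - prog s.
Proof.
move=> s0 st; rewrite progressB lerDr sumr_ge0// => k _.
by have [? ?] := stage_diff k st; rewrite addr_ge0.
Qed.

Lemma progress_homo s t : 0 <= s -> s <= t -> 0 <= prog t - prog s.
Proof.
by move=> s0 st; rewrite (le_trans _ (progress_min s0 st))// subr_ge0 min_homo.
Qed.

(** A change of stage is paid for by a whole unit of progress, so the resulting change of value need
    only be bounded, or small, and not proportional to anything finer. *)
Let progress_stage s t k : 0 <= s -> s <= t -> (k < n)%N ->
  ~~ recovered X a k s w && recovered X a k t w ||
  ~~ past X a k.+1 s w && past X a k.+1 t w ->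
  1 <= prog t - prog s.
Proof.
move=> s0 st kn h; rewrite progressB -[leLHS]addr0 lerD ?subr_ge0 ?min_homo//.
rewrite (bigD1 (Ordinal kn))//= -[leLHS]addr0 lerD//; last first.
  by rewrite sumr_ge0// => j _; have [? ?] := stage_diff j st; rewrite addr_ge0.
have [h1 h2] := stage_diff k st.
case/orP: h => /andP[/negbTE E1 E2]; move: h1 h2; rewrite E1 E2 subr0 => h1 h2.
  by rewrite lerDl.
by rewrite lerDr.
Qed.

Let C0 : 0 <= C. Proof. by rewrite mulr_ge0// addr_ge0// sqr_ge0. Qed.

Let coarse s t : 0 <= s -> s <= t -> 1 <= prog t - prog s ->
  `|val t (p t) - val s (p t)| <= C * (prog t - prog s).
Proof.
move=> s0 st h; rewrite (@le_trans _ _ (C * 1))// ?ler_wpM2l// mulr1.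
have t0 := le_trans s0 st.
rewrite (le_trans (ler_normB _ _))// (le_trans (lerD (val_bound _ t0) (val_bound _ s0)))//.
rewrite -mulr2n -[leLHS]mulr_natl ler_wpM2r ?ler_nat//.
by rewrite addr_ge0// sqr_ge0.
Qed.

(* The only comparisons of values that are not trivial: the maximum increases
   while hunting, the lost maximum is recovered, or a drawdown occurs. *)
Let stage_cases s t : 0 <= s -> s <= t ->
  [\/ val t (p t) = val s (p t),
   exists2 k, (k < n)%N & hunting X a k s w /\ hunting X a k t w,
   exists2 k, (k < n)%N & recovering X a k s w /\ recovered X a k t w |
   exists2 k, (k < n)%N & hunting X a k s w /\ past X a k.+1 t w].
Proof.
move=> s0 st; have [pn|[k kn /orP[rk|hk]]] := stageP X a w n s0.
- by constructor 1; rewrite !(val_done _ _ _ _ _ cX a0)// (past_homo st pn).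
- have /andP[pk nk] := rk.
  have [rt|rt] := boolP (recovered X a k t w); first by constructor 3; exists k.
  constructor 1; have rkt : recovering X a k t w by rewrite /recovering (past_homo st pk).
  rewrite !(val_recovering _ _ _ _ _ cX a0 _ kn)//.
  by rewrite (not_recovered cX pk nk) (not_recovered cX (past_homo st pk) rt).
- have /andP[pk nk] := hk.
  have [rt|rt] := boolP (past X a k.+1 t w); first by constructor 4; exists k.
  by constructor 2; exists k => //; split => //; rewrite /hunting rt (recovered_homo cX st).
Qed.

(** No smallness of the step is assumed: this is the source of the deterministic bound on the summed
    errors. *)
Lemma val_step s t : 0 <= s -> s <= t ->
  `|val t (p t) - val s (p t)| <= C * (prog t - prog s).
Proof.
move=> s0 st; case: (stage_cases s0 st).
- by move=> ->; rewrite subrr normr0 mulr_ge0// progress_homo.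
- move=> [k kn [hs ht]].
  have jn : (n - k <= n)%N by exact: leq_subr.
  rewrite !(val_hunting _ _ _ _ _ cX a0 _ kn)//.
  have /= := psi_lip (Num.min (M s) K) (Num.min (M t) K) (p t) jn.
  rewrite -!min_psi// => /le_trans; apply.
  rewrite ger0_norm ?subr_ge0 ?min_homo//.
  apply: ler_pM => //; last exact: progress_min.
  - by rewrite addr_ge0// mulr_ge0// sqr_ge0.
  - by rewrite subr_ge0 min_homo.
  - by have B0' := B0; have := sqr_ge0 B; lra.
- move=> [k kn [/andP[_ nk] hk]]; apply: coarse => //.
  by apply: (progress_stage s0 st kn); rewrite nk hk.
- move=> [k kn [/andP[_ nk] hk]]; apply: coarse => //.
  by apply: (progress_stage s0 st kn); rewrite nk hk orbT.
Qed.

(** If the maximum grows during the step, the path visits the new maximum within the step, so its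
    endpoint is close to both the old and the new maximum. *)
Let osc_gain s t e : 0 <= s -> s <= t -> osc_le X w s t e -> M s < M t ->
  `|M t - p t| <= e /\ `|M s - p t| <= e.
Proof.
move=> s0 st ot Mst; have [u [su ut eu]] := running_max_increase cX s0 st Mst.
have h1 := ot u t su ut st (lexx t).
have := ot s t (lexx s) st st (lexx t); have := running_max_ge cX s0 (lexx s).
move: h1; rewrite -eu !ler_norml => /andP[? ?] ? /andP[? ?].
by split; apply/andP; split; lra.
Qed.

(** A new maximum reached in the step before [v] would have to be followed by a fall of at least [a]
    within the same step, which the oscillation forbids. *)
Let no_drawdown s t e v : 0 <= s -> osc_le X w s t e -> e < a ->
  s <= v -> v <= t -> a <= M v - p v -> M v = M s.
Proof.
move=> s0 ot ea sv vt Dv; apply/eqP; rewrite eq_le (running_max_homo cX s0 sv) andbT leNgt.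
apply/negP => Msv; have [u [su uv eu]] := running_max_increase cX s0 sv Msv.
have := ot u v su (le_trans uv vt) sv vt; rewrite -eu => h.
by have := le_lt_trans (le_trans (ler_norm _) h) ea; rewrite ltNge Dv.
Qed.

(** Each nontrivial transition takes place where the value expressions fit: near the maximum for a
    gain or a recovery, near drawdown [a] for a drawdown. The mismatch is then of order [e]. *)
Lemma val_step_osc s t e : 0 <= s -> s <= t -> osc_le X w s t e ->
  e <= 1 -> e < a ->
  `|val t (p t) - val s (p t)| <= C * e * (prog t - prog s).
Proof.
move=> s0 st ot e1 ea.
have e0 : 0 <= e by apply: le_trans (normr_ge0 _) (ot s s _ _ _ _).
have B0' := B0; have B20 := sqr_ge0 B.
case: (stage_cases s0 st).
- by move=> ->; rewrite subrr normr0 !mulr_ge0 ?progress_homo// addr_ge0.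
- move=> [k kn [hs ht]].
  have jn : (0 < n - k <= n)%N by rewrite subn_gt0 kn leq_subr.
  rewrite !(val_hunting _ _ _ _ _ cX a0 _ kn)//.
  rewrite -/(psi _ _ _) -/(psi _ (M s) _).
  rewrite (min_psi (M t) _ (leq_subr k n)) (min_psi (M s) _ (leq_subr k n)).
  apply: (@le_trans _ _ (C * e * `|Num.min (M t) K - Num.min (M s) K|)); last first.
    rewrite ler_wpM2l ?mulr_ge0 ?addr_ge0//.
    by rewrite ger0_norm ?progress_min// subr_ge0 min_homo.
  have [E|E] := eqVneq (Num.min (M s) K) (Num.min (M t) K).
    by rewrite E !subrr normr0 mulr0.
  have lt : Num.min (M s) K < Num.min (M t) K by rewrite lt_neqAle E min_homo.
  have sK : M s < K.
    rewrite ltNge; apply/negP => Ks; move: lt.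
    by rewrite (min_idPr Ks) lt_min ltxx andbF.
  have Mst : M s < M t by move: lt; rewrite (min_idPl (ltW sK)) lt_min => /andP[].
  have [] := osc_gain s0 st ot Mst; rewrite ![`|_| <= e]ler_norml => /andP[? ?] /andP[? ?].
  apply: psi_near => //; rewrite ler_norml.
    by rewrite (min_idPl (ltW sK)); apply/andP; split; lra.
  (* [Num.min (M t) K] lies between [M s] and [M t], both of which are within [e] of the endpoint of
     the path. *)
  have h1 : Num.min (M t) K <= M t by rewrite ge_min lexx.
  have h2 : M s < Num.min (M t) K by rewrite lt_min Mst.
  by apply/andP; split; lra.
- move=> [k kn [rk rt]]; have /andP[pk nk] := rk.
  have h1 : 1 <= prog t - prog s.
    by apply: (progress_stage s0 st kn); rewrite nk rt.
  apply: (@le_trans _ _ (C * e * 1)); last by rewrite ler_wpM2l// !mulr_ge0// addr_ge0.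
  have ms := not_recovered cX pk nk.
  have Mst : M s < M t by rewrite ms; case/andP: rt.
  (* Recovery and the next drawdown cannot share a step: the drawdown would occur with the maximum
     still at [M s], that is, before recovery. *)
  have nt : ~~ past X a k.+1 t w.
    apply/negP => pt.
    have ns : ~~ past X a k.+1 s w.
      by apply: contra nk => /(pastS_recovered cX a0).
    have [v [sv vt Dv ev pv]] := pastS_cross cX a0 ns pt.
    have Mv := no_drawdown s0 ot ea (ltW sv) vt Dv.
    have := pastS_recovered cX a0 pv.
    by rewrite /recovered Mv ms ltxx andbF.
  have ht : hunting X a k t w by rewrite /hunting rt.
  have [D1 D2] := osc_gain s0 st ot Mst.
  rewrite (val_hunting _ _ _ _ _ cX a0 _ kn ht).
  rewrite (val_recovering _ _ _ _ _ cX a0 _ kn rk).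
  set j := (n - k)%N; have jn : (j <= n)%N by exact: leq_subr.
  rewrite [X in `|X|](_ : _ = (F j (M t) - F j (M s)) - dF j (M t) * S (M t - p t) -
     (r (M s - p t) - 1) * F j (M s)); last by ring.
  have k1 : `|F j (M t) - F j (M s)| <= B * (2 * e).
    rewrite (le_trans (vf_lip V _ _ jn))// ler_wpM2l//.
    move: D1 D2; rewrite !ler_norml => /andP[? ?] /andP[? ?].
    by apply/andP; split; lra.
  have k2 : `|dF j (M t) * S (M t - p t)| <= B * (B * e).
    rewrite normrM ler_pM// ?(vf_dbound V)// -[S _]subr0 -(vf_S0 V).
    by rewrite (le_trans (vf_Slip V _ _))// subr0 ler_wpM2l.
  have k3 : `|(r (M s - p t) - 1) * F j (M s)| <= (B * e) * B.
    rewrite normrM ler_pM// ?(vf_bound V)// -(vf_r0 V).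
    by rewrite (le_trans (vf_rlip V _ _))// subr0 ler_wpM2l.
  rewrite (le_trans (ler_normB _ _))// (le_trans (lerD (ler_normB _ _) (lexx _)))//.
  rewrite (le_trans (lerD (lerD k1 k2) k3))// expr2.
  have q1 : 0 <= B * e by rewrite mulr_ge0.
  have q2 : 0 <= B * (B * e) by rewrite mulr_ge0.
  by lra.
- move=> [k kn [hk pt]]; have /andP[rk nk] := hk.
  have h1 : 1 <= prog t - prog s.
    by apply: (progress_stage s0 st kn); rewrite nk pt orbT.
  apply: (@le_trans _ _ (C * e * 1)); last by rewrite ler_wpM2l// !mulr_ge0// addr_ge0.
  have [v [sv vt Dv ev pv]] := pastS_cross cX a0 nk pt.
  have v0 := past_ge0 pv.
  have Mv := no_drawdown s0 ot ea (ltW sv) vt Dv.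
  (* After the drawdown at [v], a new maximum would need a rise of more than [a] within the step. *)
  have Mt : M t = M v.
    apply/eqP; rewrite eq_le (running_max_homo cX v0 vt) andbT leNgt; apply/negP => Mvt.
    have [u [vu ut eu]] := running_max_increase cX v0 vt Mvt.
    have := ot u v (le_trans (ltW sv) vu) ut (ltW sv) vt.
    by move: Mvt; rewrite eu ler_norml => ? /andP[_ ?]; lra.
  have Dt : `|M t - p t - a| <= 2 * e.
    have Ds := hunting_drawdown cX a0 hk.
    have := ot s v (lexx s) st (ltW sv) vt; have := ot v t (ltW sv) vt st (lexx t).
    rewrite Mt !ler_norml => /andP[? ?] /andP[? ?].
    by rewrite Mv in Dv *; apply/andP; split; lra.
  (* Either the last drawdown has occurred and the payoff is fixed, or a recovery begins. As
     [M t - p t] is within [2 * e] of [a], both values are close to [rho * F j (M t)], which the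
     differential equation equates to the hunting value at drawdown [a]. *)
  have Et : val t (p t) = rho * F (n - k.+1) (M t) \/
       val t (p t) = r (M t - p t) * F (n - k.+1) (M t).
    move: (kn); rewrite leq_eqVlt => /orP[/eqP kn'|kn'].
      left; rewrite (val_done _ _ _ _ _ cX a0); last by rewrite -kn'.
      by rewrite -kn' subnn ev Mt.
    right; rewrite (val_recovering _ _ _ _ _ cX a0 _ kn')//.
    by rewrite /recovering pt /recovered pt/= ev Mt ltxx.
  rewrite (val_hunting _ _ _ _ _ cX a0 _ kn hk).
  have jn : (n - k.+1 < n)%N by rewrite ltn_subrL (leq_ltn_trans _ kn).
  have ode := vf_ode V (M t) jn.
  rewrite -Mv -Mt -(subnSK kn).
  set j := (n - k.+1)%N in jn ode Et *.
  rewrite [X in `|X|](_ : _ = (val t (p t) - rho * F j (M t)) +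
     dF j.+1 (M t) * (S (M t - p t) - S a)); last by rewrite -ode; ring.
  have k1 : `|val t (p t) - rho * F j (M t)| <= (B * (2 * e)) * B.
    case: Et => ->; first by rewrite subrr normr0 !mulr_ge0.
    rewrite -mulrBl normrM ler_pM// ?(vf_bound V) ?(ltnW jn)// -(vf_ra V).
    by rewrite (le_trans (vf_rlip V _ _))// ler_wpM2l.
  have k2 : `|dF j.+1 (M t) * (S (M t - p t) - S a)| <= B * (B * (2 * e)).
    rewrite normrM ler_pM// ?(vf_dbound V)//.
    by rewrite (le_trans (vf_Slip V _ _))// ler_wpM2l.
  rewrite (le_trans (ler_normD _ _))// (le_trans (lerD k1 k2))// expr2.
  have q1 : 0 <= B * e by rewrite mulr_ge0.
  have q2 : 0 <= B * (B * e) by rewrite mulr_ge0.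
  by lra.
Qed.

End StepBound.

(** * Accumulated cost of the stage updates on a grid *)

Section GridSum.
Context (R : realType) (T : Type) (X : R -> T -> R) (a : R).
Variables (F dF : nat -> R -> R) (S r : R -> R) (rho K B : R) (n : nat).
Hypothesis V : value_functions F dF S r a rho K B n.
Variable w : T.
Hypotheses (cX : continuous (X^~ w)) (a0 : 0 < a) (X0 : X 0 w = 0) (K0 : 0 <= K).
Local Notation stv s y := (stage_value X a F dF S r rho n s w y).
Local Notation C := (4 * (B + B ^+ 2)).

(** The update of stage and maximum with the path held at the end of the step; the motion of the
    path with the stage frozen is treated in mean. *)
Definition step_error (h : R) (i : nat) : R :=
  stv (i.+1%:R * h) (X (i.+1%:R * h) w) - stv (i%:R * h) (X (i.+1%:R * h) w).

Lemma progress_range t : 0 <= t ->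
  progress X a K n t w - progress X a K n 0 w <= 2 * n%:R + K.
Proof.
move=> t0; rewrite /progress running_max0// X0 (min_idPl K0) addr0.
rewrite [X in _ + _ - X]big1 ?subr0; last first.
  move=> k _; have h : past X a k.+1 0 w = false.
    rewrite /past; have [[r' [s [_ -> r0 [rs _ _] _]]]|[-> _]] := drawdown_timeS cX a0 k.
      by rewrite lee_fin leNgt (le_lt_trans r0 rs).
    by rewrite leye_eq.
  rewrite h; case E : (recovered X a k 0 w) => //; last by rewrite addr0.
  move: E; rewrite /recovered => /andP[p0]; have [r' [_ r0 r1 ->]] := past_fin p0.
  have -> : r' = 0 by apply/eqP; rewrite eq_le r0 r1.
  by rewrite ltxx.
rewrite lerD ?ge_min ?lexx ?orbT//.
apply: (@le_trans _ _ (\sum_(k < n) 2)); last by rewrite sumr_const card_ord mulr_natr.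
by apply: ler_sum => k _; rewrite -natrD ler_nat; case: recovered; case: past.
Qed.

Lemma sum_step_error h N : 0 <= h ->
  `|\sum_(i < N) step_error h i| <= C * (2 * n%:R + K).
Proof.
move=> h0; have ih i : 0 <= i%:R * h by rewrite mulr_ge0.
rewrite (le_trans (ler_norm_sum _ _ _))//.
apply: (@le_trans _ _ (\sum_(i < N) C * (progress X a K n (i.+1%:R * h) w -
    progress X a K n (i%:R * h) w))).
  by apply: ler_sum => i _; apply: val_step => //; rewrite ler_wpM2r// ler_nat.
rewrite -big_distrr/= -(big_mkord xpredT (fun i => progress X a K n (i.+1%:R * h) w -
    progress X a K n (i%:R * h) w)) telescope_sumr// mul0r.
rewrite ler_wpM2l ?progress_range//.
have B1 := vf_B1 V.
by rewrite mulr_ge0// addr_ge0 ?sqr_ge0// (le_trans ler01).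
Qed.

Lemma sum_step_error_osc h N e : 0 <= h -> 0 <= e -> e <= 1 -> e < a ->
  (forall i, (i < N)%N -> osc_le X w (i%:R * h) (i.+1%:R * h) e) ->
  `|\sum_(i < N) step_error h i| <= C * e * (2 * n%:R + K).
Proof.
move=> h0 e0 e1 ea osc; have ih i : 0 <= i%:R * h by rewrite mulr_ge0.
rewrite (le_trans (ler_norm_sum _ _ _))//.
apply: (@le_trans _ _ (\sum_(i < N) C * e * (progress X a K n (i.+1%:R * h) w -
    progress X a K n (i%:R * h) w))).
  apply: ler_sum => i _; apply: val_step_osc => //; last exact: osc.
  by rewrite ler_wpM2r// ler_nat.
rewrite -big_distrr/= -(big_mkord xpredT (fun i => progress X a K n (i.+1%:R * h) w -
    progress X a K n (i%:R * h) w)) telescope_sumr// mul0r.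
rewrite ler_wpM2l ?progress_range// mulr_ge0//.
have B1 := vf_B1 V.
by rewrite mulr_ge0// addr_ge0 ?sqr_ge0// (le_trans ler01).
Qed.

End GridSum.

(** * Continuity of the running maximum and countable descriptions of the stages *)

Section RunningMaxContinuity.
Context (R : realType) (T : Type) (X : R -> T -> R) (w : T).
Hypothesis cX : continuous (X^~ w).
Local Notation p t := (X t w).
Local Notation M t := (running_max X t w).
Implicit Types (s t u v e c : R).

Lemma running_max_near t e : 0 <= t -> 0 < e -> exists2 d, 0 < d &
  forall s, 0 <= s -> `|s - t| < d ->
    `|M s - M t| <= e /\ `|p s - p t| <= e.
Proof.
move=> t0 e0; have [d d0 h] := path_unif_cont cX (t + 1) e0.
exists (Num.min d 1); first by rewrite lt_min d0 ltr01.
move=> s s0; rewrite lt_min => /andP[sd s1].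
have [st|ts] := leP s t.
  have o : osc_le X w s t e.
    apply: h => //; first by lra.
    by move: sd; rewrite ler0_norm; lra.
  have h1 := running_max_osc cX s0 st o.
  have h2 := running_max_homo cX s0 st.
  by split; [rewrite ler_norml; apply/andP; split; lra|apply: o].
have o : osc_le X w t s e.
  apply: h => //; [exact: ltW|by move: s1; rewrite gtr0_norm; lra|].
  by move: sd; rewrite gtr0_norm; lra.
have h1 := running_max_osc cX t0 (ltW ts) o.
have h2 := running_max_homo cX t0 (ltW ts).
split; [rewrite ler_norml; apply/andP; split; lra|apply: o => //; exact: ltW].
Qed.

(** Before time 0 the supremum runs over an empty set, hence the clamped argument. *)
Lemma running_max_continuous :
  continuous (fun t => M (Num.max t 0)).
Proof.
move=> t; apply/cvgrPdist_le => e e0.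
have t0 : 0 <= Num.max t 0 by rewrite le_max lexx orbT.
have [d d0 h] := running_max_near t0 e0.
exists d => //= s ts; rewrite distrC.
have [] := h (Num.max s 0) => //; first by rewrite le_max lexx orbT.
rewrite (le_lt_trans (max_lipschitz _ _ _))// distrC.
exact: ts.
Qed.

Definition grid_time (t : R) (m j : nat) : R := t * (j%:R / m.+1%:R).

Lemma grid_time_itv t m j : 0 <= t -> (j <= m.+1)%N ->
  0 <= grid_time t m j /\ grid_time t m j <= t.
Proof.
move=> t0 jm; rewrite /grid_time; split; first by rewrite mulr_ge0// divr_ge0.
by rewrite ler_piMr// ler_pdivrMr// mul1r ler_nat.
Qed.

Lemma grid_time_end t m : grid_time t m m.+1 = t.
Proof. by rewrite /grid_time mulfV ?mulr1// pnatr_eq0. Qed.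

Lemma grid_time_dense t u v : 0 <= u -> u < v -> v <= t ->
  exists m j, [/\ (j <= m.+1)%N, u < grid_time t m j & grid_time t m j < v].
Proof.
move=> u0 uv vt; have t0 : 0 < t by lra.
(* The mesh [t / m.+1] is less than [v - u], and [j] below is the first index whose grid time
   exceeds [u]. *)
pose m := Num.truncn (t / (v - u)).
have hm : t / (v - u) < m.+1%:R by exact: truncnS_gt.
pose j := (Num.truncn (u * m.+1%:R / t)).+1.
have uj0 : 0 <= u * m.+1%:R / t by rewrite divr_ge0 ?mulr_ge0// ltW.
have /andP[j1 j2] := truncn_itv uj0.
have m0 : 0 < m.+1%:R :> R by rewrite ltr0n.
have h1 : u < grid_time t m j.
  by rewrite /grid_time mulrA ltr_pdivlMr// [ltRHS]mulrC -ltr_pdivrMr.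
have h2 : grid_time t m j < v.
  rewrite /grid_time mulrA ltr_pdivrMr// /j -natr1 mulrDr mulr1.
  have j1' : t * (Num.truncn (u * m.+1%:R / t))%:R <= u * m.+1%:R.
    by rewrite mulrC -ler_pdivlMr.
  have hm' : t < m.+1%:R * (v - u) by rewrite -ltr_pdivrMr// subr_gt0.
  by nra.
exists m, j; split => //.
have : grid_time t m j < t by exact: lt_le_trans vt.
rewrite /grid_time gtr_pMr// ltr_pdivrMr// mul1r ltr_nat.
exact: ltnW.
Qed.

Lemma running_max_le_grid t c : 0 <= t ->
  (M t <= c) <-> (forall m j, (j <= m.+1)%N -> p (grid_time t m j) <= c).
Proof.
move=> t0; split=> [h m j jm|h].
  have [g0 gt] := grid_time_itv t0 jm.
  by rewrite (le_trans _ h)// running_max_ge.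
apply: running_max_le => // u u0 ut.
have [->|ut'] := eqVneq u t.
  by have := h 0%N 1%N isT; rewrite grid_time_end.
have {}ut : u < t by rewrite lt_neqAle ut'.
rewrite leNgt; apply/negP => cu.
have e0 : 0 < (p u - c) / 2 by lra.
have [d d0 hd] := running_max_near u0 e0.
have [||m [j [jm j1 j2]]] := @grid_time_dense t u (Num.min t (u + d)) u0.
  by rewrite lt_min ut; lra.
  by rewrite ge_min lexx.
have [g0 gt] := grid_time_itv t0 jm.
move: j2; rewrite lt_min => /andP[_ j2].
have [|_] := hd (grid_time t m j) g0; first by rewrite ger0_norm; lra.
by have := h m j jm; rewrite ler_norml => ? /andP[? ?]; lra.
Qed.

Variables (a : R) (a0 : 0 < a).

(** The drawdown time itself need not be a grid time; by continuity of the maximum, a grid time just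
    after it serves as a witness. *)
Lemma recovered_grid k t : 0 <= t ->
  recovered X a k t w <->
  exists m j, [/\ (j <= m.+1)%N, past X a k (grid_time t m j) w &
                 M (grid_time t m j) < M t].
Proof.
move=> t0; split.
  move=> /andP[pk]; have [r [er r0 rt ->]] := past_fin pk => lt.
  have rt' : r < t by rewrite lt_neqAle rt andbT; apply: contraTneq lt => ->; rewrite ltxx.
  have e0 : 0 < (M t - M r) / 2 by lra.
  have [d d0 hd] := running_max_near r0 e0.
  have [||m [j [jm j1 j2]]] := @grid_time_dense t r (Num.min t (r + d)) r0.
    by rewrite lt_min rt'; lra.
    by rewrite ge_min lexx.
  exists m, j; split => //.
    by rewrite /past er lee_fin ltW.
  move: j2; rewrite lt_min => /andP[_ j2].
  have [g0 gt] := grid_time_itv t0 jm.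
  have [|+ _] := hd (grid_time t m j) g0; first by rewrite ger0_norm; lra.
  by rewrite ler_norml => /andP[? ?]; lra.
move=> [m [j [jm pk lt]]].
have [g0 gt] := grid_time_itv t0 jm.
rewrite /recovered (past_homo gt pk)/=.
have [r [er r0 rt ->]] := past_fin pk.
by rewrite (le_lt_trans _ lt)// running_max_homo.
Qed.

Lemma max_at_grid k t c : 0 <= t ->
  (past X a k t w /\ max_at X a k w < c) <->
  exists m j, [/\ (j <= m.+1)%N, past X a k (grid_time t m j) w &
                 M (grid_time t m j) < c].
Proof.
move=> t0; split.
  move=> [pk]; have [r [er r0 rt ->]] := past_fin pk => lt.
  have [rt'|rt'] := eqVneq r t.
    by exists 0%N, 1%N; rewrite grid_time_end -rt' /past er lexx.
  have {}rt' : r < t by rewrite lt_neqAle rt'.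
  have e0 : 0 < (c - M r) / 2 by lra.
  have [d d0 hd] := running_max_near r0 e0.
  have [||m [j [jm j1 j2]]] := @grid_time_dense t r (Num.min t (r + d)) r0.
    by rewrite lt_min rt'; lra.
    by rewrite ge_min lexx.
  exists m, j; split => //.
    by rewrite /past er lee_fin ltW.
  move: j2; rewrite lt_min => /andP[_ j2].
  have [g0 gt] := grid_time_itv t0 jm.
  have [|+ _] := hd (grid_time t m j) g0; first by rewrite ger0_norm; lra.
  by rewrite ler_norml => /andP[? ?]; lra.
move=> [m [j [jm pk lt]]].
have [g0 gt] := grid_time_itv t0 jm.
split; first exact: past_homo pk.
have [r [er r0 rt ->]] := past_fin pk.
by rewrite (le_lt_trans _ lt)// running_max_homo.
Qed.

(** Reaching drawdown [a] exactly is approximated by drawdowns above [a - i.+1%:R^-1] at grid times.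
    The gap [l.+1%:R^-1] is common to all [i], so it survives the passage to a limit and keeps the
    new maximum strictly above the one at the k-th drawdown. *)
Lemma pastS_grid k t : 0 <= t ->
  past X a k.+1 t w <->
  exists l, forall i, exists m j m' j',
    [/\ (j <= m.+1)%N, (j' <= m'.+1)%N, grid_time t m j <= grid_time t m' j',
        past X a k (grid_time t m j) w &
        M (grid_time t m j) + l.+1%:R^-1 <= M (grid_time t m' j') /\
        a - i.+1%:R^-1 < M (grid_time t m' j') - p (grid_time t m' j')].
Proof.
move=> t0; split.
  rewrite /past; have [[r [s [er -> r0 [rs Ds Ms] _]]]|[-> _]] := drawdown_timeS cX a0 k; last first.
    by rewrite leye_eq.
  rewrite lee_fin => st.
  have s0 : 0 <= s by rewrite (le_trans r0)// ltW.
  (* One third for the excess of [M q] over [M r], one for the deficit of [M q'] below [M s], and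
     one for the gap that remains. *)
  pose e := (M s - M r) / 3.
  have e0 : 0 < e by rewrite /e; lra.
  have [l hl] : exists l : nat, l.+1%:R^-1 < e.
    exists (Num.truncn e^-1); rewrite invf_plt ?posrE// ?ltr0n//.
    exact: truncnS_gt.
  have [d d0 hd] := running_max_near r0 e0.
  have [||m [j [jm j1 j2]]] := @grid_time_dense t r (Num.min s (r + d)) r0.
    by rewrite lt_min rs; lra.
    by rewrite ge_min st.
  set q := grid_time t m j in j1 j2 *.
  move: j2; rewrite lt_min => /andP[qs qd].
  have q0 : 0 <= q by rewrite (le_trans r0)// ltW.
  have Mq : M q <= M r + e.
    have [|+ _] := hd q q0; first by rewrite ger0_norm; lra.
    by rewrite ler_norml => /andP[? ?]; lra.
  exists l => i; pose f := Num.min e (i.+1%:R^-1 / 3).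
  have i0 : 0 < i.+1%:R^-1 :> R by rewrite invr_gt0.
  have f0 : 0 < f by rewrite lt_min e0/= divr_gt0.
  have [d' d'0 hd'] := running_max_near s0 f0.
  have qs' : Num.max q (s - d') < s by rewrite gt_max qs; lra.
  have [|m' [j' [jm' j1' j2']]] := @grid_time_dense t (Num.max q (s - d')) s _ qs' st.
    by rewrite le_max q0.
  set q' := grid_time t m' j' in j1' j2' *.
  move: j1'; rewrite gt_max => /andP[qq' dq'].
  have q'0 : 0 <= q' by rewrite (le_trans q0)// ltW.
  have [|] := hd' q' q'0; first by rewrite ltr0_norm; lra.
  rewrite !ler_norml => /andP[M1 M2] /andP[p1 p2].
  have fe : f <= e by rewrite ge_min lexx.
  have fi : f <= i.+1%:R^-1 / 3 by rewrite ge_min lexx orbT.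
  exists m, j, m', j'; split => //; first exact: ltW.
    by rewrite er lee_fin ltW.
  rewrite -/q -/q'; have ee : M s - M r = 3 * e by rewrite /e; lra.
  clearbody e f q q'.
  move: (i.+1%:R^-1) (l.+1%:R^-1) i0 fi hl => ii li *.
  by split; lra.
move=> [l hl].
have l0 : 0 < l.+1%:R^-1 :> R by rewrite invr_gt0.
have [m [j [m' [j' [jm _ _ pk _]]]]] := hl 0%N.
have [_ gt] := grid_time_itv t0 jm.
have [r [er r0 rt _]] := past_fin (past_homo gt pk).
pose c := M r + l.+1%:R^-1.
(* The later grid times found for each [i] all lie in this compact set, on which the drawdown
   attains its maximum; that maximum is at least [a - i.+1%:R^-1] for all [i]. *)
pose A : set R := [set v | v \in `[0, t]] `&` [set v | c <= M (Num.max v 0)].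
have cA : compact A.
  apply: compact_closedI; first exact: segment_compact.
  apply: (closed_comp (f := fun v : R => M (Num.max v 0)) _ (@closed_ge R c)) => v _.
  exact: running_max_continuous.
have hA i : exists q', A q' /\ a - i.+1%:R^-1 < M q' - p q'.
  have [m1 [j1 [m1' [j1' [jm1 jm1' _ pk1 [M1 D1]]]]]] := hl i.
  exists (grid_time t m1' j1'); split => //.
  have [g0 gt1] := grid_time_itv t0 jm1.
  have [g0' gt1'] := grid_time_itv t0 jm1'.
  split; first by rewrite /= in_itv/= g0'.
  rewrite /= (max_idPl g0') /c (le_trans _ M1)// lerD2r.
  have [r' [er' r0' rt' _]] := past_fin pk1.
  move: er'; rewrite er => -[rr]; rewrite -rr in rt'.
  exact: running_max_homo.
have A0 : A !=set0 by have [q' [Aq' _]] := hA 0%N; exists q'.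
have [|v Av hv] := @compact_EVT_max R R (fun v => M (Num.max v 0) - p v) A A0 cA.
  apply: continuous_subspaceT => v.
  by apply: continuousB; [exact: running_max_continuous|exact: cX].
have [+ cv] : A v by rewrite inE in Av.
rewrite /= in_itv/= => /andP[v0 vt].
have vE : Num.max v 0 = v by apply/max_idPl.
rewrite /= vE in cv.
have Dv : a <= M v - p v.
  apply/ler_addgt0Pl => e e0.
  have [i hi] : exists i : nat, i.+1%:R^-1 < e.
    exists (Num.truncn e^-1); rewrite invf_plt ?posrE// ?ltr0n//.
    exact: truncnS_gt.
  have [q' [Aq' Dq']] := hA i.
  have := hv q'; rewrite inE => /(_ Aq') /=; rewrite vE.
  have -> : Num.max q' 0 = q'.
    by apply/max_idPl; case: Aq' => /=; rewrite in_itv/= => /andP[].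
  by move: (i.+1%:R^-1) hi Dq' => z *; lra.
apply: (past_homo vt); apply: recovered_pastS => //.
have rv : r <= v.
  rewrite leNgt; apply/negP => vr.
  have := le_trans cv (running_max_homo cX v0 (ltW vr)).
  by rewrite /c gerDl leNgt l0.
rewrite /recovered /past /max_at er lee_fin rv /=.
by rewrite (lt_le_trans _ cv)// /c ltrDl.
Qed.

End RunningMaxContinuity.

(** * History of the path and independence of the increments *)

Section IndependentSets.
Context d (T : measurableType d) (R : realType) (P : probability T R).

(* Dynkin's pi-lambda theorem for the class of events independent of [E]. *)
Lemma sigma_algebra_indep (G : set (set T)) (E : set T) :
  setI_closed G -> measurable E ->
  (forall A, G A -> measurable A /\ P (A `&` E) = (P A * P E)%E) ->
  forall A, <<s G >> A -> measurable A /\ P (A `&` E) = (P A * P E)%E.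
Proof.
move=> GI mE GE; rewrite -(setI_closed_g_dynkin_g_sigma_algebra GI).
apply: (@smallest_sub _ _ _ [set A | measurable A /\ P (A `&` E) = (P A * P E)%E]); last exact: GE.
split.
- by rewrite /= setTI probability_setT mul1e.
- move=> A [mA hA]; split; first exact: measurableC.
  rewrite setIC -setDE measureD//; last by rewrite ltey_eq fin_num_measure.
  transitivity (P E - P A * P E)%E; first by congr (_ - _)%E; rewrite setIC.
  rewrite probability_setC// muleBl ?mul1e//; first exact: fin_num_measure.
- move=> A tA hA; split; first by apply: bigcupT_measurable => k; case: (hA k).
  rewrite setI_bigcupl measure_bigcup//=; last 2 first.
    by move=> k _; apply: measurableI => //; case: (hA k).
    exact: trivIset_setIr.
  rewrite measure_bigcup//=; last by move=> k _; case: (hA k).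
  rewrite muleC -[in RHS](fineK (fin_num_measure P _ mE)) -nneseriesZl//.
  apply: eq_eseriesr => k _; rewrite fineK ?fin_num_measure// muleC.
  by case: (hA k).
Qed.

End IndependentSets.

Section Filtration.
Context (T : pointedType) (R : realType) (Z : R -> T -> R).
Implicit Types (s t : R) (m j : nat).

Definition cylinder t m (A : nat -> set R) : set T :=
  [set w | forall j, (j <= m.+1)%N -> A j (Z (grid_time t m j) w)].

Definition cylinders t : set (set T) :=
  [set C | exists m A, (forall j, measurable (A j)) /\ C = cylinder t m A].

(* The sigma-algebra of the process on the rational multiples of [t]. *)
Definition history t := g_sigma_algebraType (cylinders t).

(** The finer grid has [m.+1 * q.+1] steps and contains the old one at the multiples of [q.+1]. Two
    cylinders thus live on a common grid, whence the closure under intersection. *)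
Lemma cylinder_refine t m q (A : nat -> set R) : cylinder t m A =
  cylinder t (q * m.+1 + m)%N
    (fun j => if (q.+1 %| j)%N then A (j %/ q.+1)%N else setT).
Proof.
have e : (q * m.+1 + m).+1 = (m.+1 * q.+1)%N by nia.
have g j : grid_time t (q * m.+1 + m) (j * q.+1) = grid_time t m j.
  by rewrite /grid_time e !natrM -mulf_div [q.+1%:R / _]divff ?mulr1.
apply/seteqP; split => w h j jm /=.
  case: ifP => // /dvdnP[i e']; rewrite e' mulnK// g.
  by apply: h; move: jm; rewrite e' e leq_pmul2r.
have := h (j * q.+1)%N; rewrite e leq_pmul2r// => /(_ jm) /=.
by rewrite dvdn_mull// mulnK// g.
Qed.

Lemma cylinders_setI t : setI_closed (cylinders t).
Proof.
move=> _ _ [m [A [mA ->]]] [m' [A' [mA' ->]]].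
rewrite (cylinder_refine t m m') (cylinder_refine t m' m).
have -> : (m * m'.+1 + m' = m' * m.+1 + m)%N by nia.
set M := (_ + _)%N; set B := (X in cylinder t M X); set B' := (X in _ `&` cylinder t M X).
exists M, (fun j => B j `&` B' j); split.
  by move=> j; apply: measurableI; rewrite /B /B'; case: ifP.
apply/seteqP; split => [w [h1 h2] j jm|w h]; first by split; [exact: h1|exact: h2].
by split => j /h[].
Qed.

Lemma measurable_fun_le_cst dd (Y : measurableType dd) (f : Y -> R) :
  (forall c, measurable [set y | f y <= c]) -> measurable_fun setT f.
Proof.
move=> h; apply: (measurability _ (measurable_realfun.RGenOInfty.measurableE R)) => _ [_ [c ->] <-].
rewrite setTI (_ : _ @^-1` _ = ~` [set y | f y <= c]); first exact: measurableC.
by apply/seteqP; split => y /=; rewrite in_itv/= andbT ltNge => /negP.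
Qed.

Lemma measurable_fun_lt_cst dd (Y : measurableType dd) (f : Y -> R) :
  (forall c, measurable [set y | f y < c]) -> measurable_fun setT f.
Proof.
move=> h; apply: (measurability _ (measurable_realfun.RGenCInfty.measurableE R)) => _ [_ [c ->] <-].
rewrite setTI (_ : _ @^-1` _ = ~` [set y | f y < c]); first exact: measurableC.
by apply/seteqP; split => y /=; rewrite in_itv/= andbT leNgt => /negP.
Qed.

Lemma measurable_history t m j : (j <= m.+1)%N ->
  measurable_fun [set: history t] (Z (grid_time t m j)).
Proof.
move=> jm _ A mA; rewrite setTI; apply: sub_sigma_algebra.
exists m, (fun i => if i == j then A else setT); split.
  by move=> i; case: ifP.
apply/seteqP; split => w /=; first by move=> Aw i _; case: eqP => // ->.
by move=> /(_ j jm); rewrite eqxx.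
Qed.

End Filtration.

Section BrownianIncrements.
Context d (T : measurableType d) (R : realType) (P : probability T R)
  (W : R -> T -> R).
Hypothesis BM : standard_brownian_motion P W.

Lemma measurable_increment (s t : R) : 0 <= s -> s <= t ->
  measurable_fun [set: T] (fun w => W t w - W s w).
Proof.
move=> s0 st; apply: measurable_funB; apply: (bm_measurable BM) => //.
exact: le_trans st.
Qed.

(** The increments along the grid, followed by the one over [[t, t + h]], are mutually independent.
    Events of the grid increments form a pi-system, and the sigma-algebra that it generates contains
    the cylinders. *)
Lemma cylinders_indep (t h : R) (C : set R) : 0 <= t -> 0 < h -> measurable C ->
  forall A, cylinders W t A -> measurable A /\
  P (A `&` [set w | C (W (t + h) w - W t w)%R]) =
  (P A * P [set w | C (W (t + h) w - W t w)%R])%E.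
Proof.
move=> t0 h0 mC _ [m [B [mB ->]]].
set E := [set w | C _].
have mE : measurable E.
  rewrite /E -[X in measurable X]setTI; apply: measurable_increment => //.
  by rewrite lerDl ltW.
(* At [t = 0] the grid times coincide and independence of increments says nothing, but the cylinder
   is then trivial because [W 0 = 0]. *)
have [t00|t00] := eqVneq t 0.
  have g0 j : grid_time t m j = 0 by rewrite /grid_time t00 mul0r.
  have [hB|hB] := pselect (forall j, (j <= m.+1)%N -> B j 0).
    rewrite (_ : cylinder _ _ _ _ = setT); last first.
      apply/seteqP; split => // w _ j jm /=.
      by rewrite g0 (bm_start BM); exact: hB.
    by rewrite setTI probability_setT mul1e.
  rewrite (_ : cylinder _ _ _ _ = set0); last first.
    by apply/seteqP; split => // w hw; apply: hB => j /hw; rewrite g0 (bm_start BM).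
  by rewrite set0I measure0 mul0e.
have tpos : 0 < t by rewrite lt_neqAle eq_sym t00.
(* Index [m.+1] is time [t] and index [m.+2] is time [t + h], so the last of the [m.+2] increments
   is the future one. *)
pose tt j := if (j <= m.+1)%N then grid_time t m j else t + h.
have ttS j : (j < m.+2)%N -> tt j < tt j.+1.
  rewrite ltnS leq_eqVlt /tt => /orP[/eqP ->|jm].
    by rewrite leqnn ltnn grid_time_end ltrDl.
  rewrite jm (ltnW jm) /grid_time ltr_pM2l// ltr_pM2r ?invr_gt0 ?ltr0n//.
  by rewrite ltr_nat.
have tt0 j : 0 <= tt j.
  rewrite /tt; case: ifP => _; last by rewrite addr_ge0// ltW.
  by rewrite /grid_time mulr_ge0// divr_ge0.
have ind := @bm_independent _ _ _ _ _ BM m.+2 tt (tt0 0%N) ttS.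
pose Y j w := W (tt j.+1) w - W (tt j) w.
have mY j : (j < m.+2)%N -> measurable_fun setT (Y j).
  by move=> jm; apply: measurable_increment => //; apply: ltW; exact: ttS.
pose G : set (set T) := [set D | exists2 A : nat -> set R, forall j, measurable (A j) &
  D = [set w | forall j, (j < m.+1)%N -> A j (Y j w)]].
have GI : setI_closed G.
  move=> _ _ [A mA ->] [A' mA' ->]; exists (fun j => A j `&` A' j).
    by move=> j; exact: measurableI.
  apply/seteqP; split => [w [h1 h2] j jm|w hw]; first by split; [exact: h1|exact: h2].
  by split => j /hw[].
have YE w : Y m.+1 w = W (t + h) w - W t w.
  by rewrite /Y /tt leqnn ltnn grid_time_end.
have prodE (A : nat -> set R) : (forall j, measurable (A j)) ->
    P ([set w | forall j, (j < m.+1)%N -> A j (Y j w)] `&` [set w | A m.+1 (Y m.+1 w)]) =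
    ((\prod_(j < m.+1) P (Y j @^-1` A j)) * P [set w | A m.+1 (Y m.+1 w)])%E.
  move=> mA; have := ind (fun i => A i) (fun i => mA i).
  rewrite big_ord_recr/= => <-; congr (P _); apply/seteqP; split => w /=.
    move=> [h1 h2] i; have := ltn_ord i; rewrite ltnS leq_eqVlt => /orP[/eqP ->//|].
    exact: h1.
  move=> hw; split => [j jm|]; last exact: (hw ord_max).
  exact: (hw (Ordinal (leqW jm))).
have GE D : G D -> measurable D /\ P (D `&` E) = (P D * P E)%E.
  move=> [A mA ->]; split.
    rewrite (_ : [set w | _] = \bigcap_(j in [set j | (j < m.+1)%N]) (Y j @^-1` A j)); last first.
      by apply/seteqP; split => w.
    apply: bigcap_measurableType => j /= jm.
    by rewrite -[X in measurable X]setTI; apply: mY => //; exact: leqW.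
  (* With [C] in the last place the product rule gives the probability of the intersection; with
     [setT] there it identifies the remaining product as the probability of the past event. *)
  have h1 := prodE (fun j => if j == m.+1 then C else A j).
  have h2 := prodE (fun j => if j == m.+1 then setT else A j).
  have e1 : [set w | forall j, (j < m.+1)%N -> A j (Y j w)] =
     [set w | forall j, (j < m.+1)%N -> (if j == m.+1 then C else A j) (Y j w)].
    by apply/seteqP; split => w /= hw j jm; have := hw j jm; rewrite ltn_eqF.
  have e2 : [set w | forall j, (j < m.+1)%N -> A j (Y j w)] =
     [set w | forall j, (j < m.+1)%N -> (if j == m.+1 then setT else A j) (Y j w)].
    by apply/seteqP; split => w /= hw j jm; have := hw j jm; rewrite ltn_eqF.
  have eE : E = [set w | (if m.+1 == m.+1 then C else A m.+1) (Y m.+1 w)].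
    by rewrite eqxx; apply/seteqP; split => w /=; rewrite YE.
  rewrite {1}e1 {1}eE h1; last by move=> j; case: ifP.
  rewrite -eE; congr (_ * _)%E.
  have -> : P [set w | forall j, (j < m.+1)%N -> A j (Y j w)] =
      P ([set w | forall j, (j < m.+1)%N -> (if j == m.+1 then setT else A j) (Y j w)] `&`
      [set w | (if m.+1 == m.+1 then setT else A m.+1) (Y m.+1 w)]).
    rewrite -e2 eqxx; congr (P _); apply/seteqP; split => w //=.
    by case.
  rewrite h2; last by move=> j; case: ifP.
  rewrite eqxx (_ : [set w | setT _] = setT); last by apply/seteqP; split.
  rewrite probability_setT mule1; apply: eq_bigr => j _.
  by rewrite ltn_eqF.
apply: (sigma_algebra_indep GI mE GE).
pose GT : measurableType _ := g_sigma_algebraType G.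
have mYG j : (j < m.+1)%N -> measurable_fun [set: GT] (Y j).
  move=> jm _ A mA; rewrite setTI; apply: sub_sigma_algebra.
  exists (fun i => if i == j then A else setT); first by move=> i; case: ifP.
  apply/seteqP; split => w /=; first by move=> Aw i _; case: eqP => // ->.
  by move=> /(_ j jm); rewrite eqxx.
(* As [W 0 = 0], the value at a grid time is a sum of grid increments. *)
have mWG j : (j <= m.+1)%N -> measurable_fun [set: GT] (W (tt j)).
  elim: j => [|j IH] jm.
    rewrite (_ : W (tt 0%N) = cst 0); first exact: measurable_cst.
    by apply/funext => w; rewrite /tt /grid_time mul0r mulr0 (bm_start BM).
  rewrite (_ : W (tt j.+1) = fun w => Y j w + W (tt j) w); last first.
    by apply/funext => w; rewrite /Y subrK.
  by apply: measurable_funD; [exact: mYG|apply: IH; exact: ltnW].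
rewrite (_ : cylinder _ _ _ _ = \bigcap_(j in [set j | (j <= m.+1)%N]) (W (tt j) @^-1` B j)); last first.
  by apply/seteqP; split => w hw j jm; have := hw j jm;
    have jm' : (j <= m.+1)%N := jm; rewrite /preimage/= /tt jm'.
change (measurable ((\bigcap_(j in [set j | (j <= m.+1)%N]) (W (tt j) @^-1` B j)) : set GT)).
apply: bigcap_measurableType => j jm.
by rewrite -[X in measurable X]setTI; apply: mWG.
Qed.

Lemma history_indep (t h : R) (C : set R) (A : set T) : 0 <= t -> 0 < h -> measurable C ->
  <<s cylinders W t >> A -> measurable A /\
  P (A `&` [set w | C (W (t + h) w - W t w)%R]) =
  (P A * P [set w | C (W (t + h) w - W t w)%R])%E.
Proof.
move=> t0 h0 mC; apply: sigma_algebra_indep.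
- exact: cylinders_setI.
- rewrite -[X in measurable X]setTI; apply: measurable_increment => //.
  by rewrite lerDl ltW.
- exact: cylinders_indep.
Qed.

End BrownianIncrements.

(** * Measurability of the stages *)

Section MeasurableConnectives.
Context d (Y : measurableType d).
Implicit Types (b : Y -> bool).

Lemma measurable_exists (A : nat -> Y -> Prop) :
  (forall i, measurable [set y | A i y]) -> measurable [set y | exists i, A i y].
Proof.
move=> mA; rewrite (_ : [set y | _] = \bigcup_i [set y | A i y]).
  exact: bigcupT_measurable.
by apply/seteqP; split => y /= [i]; [exists i|move=> _ Ai; exists i].
Qed.

Lemma measurable_forall (A : nat -> Y -> Prop) :
  (forall i, measurable [set y | A i y]) -> measurable [set y | forall i, A i y].
Proof.
move=> mA; rewrite (_ : [set y | _] = \bigcap_i [set y | A i y]).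
  exact: bigcapT_measurable.
by apply/seteqP; split => y /= h i; [move=> _|]; apply: h.
Qed.

Lemma measurable_bool_set b : measurable_fun setT b <-> measurable [set y | b y].
Proof.
have e : b @^-1` [set true] = [set y | b y] by apply/seteqP; split => y.
split=> [mb|mb]; first by rewrite -e -[X in measurable X]setTI; exact: mb.
by apply: (measurable_fun_bool true); rewrite setTI e.
Qed.

Lemma measurable_natr_bool (R : realType) b : measurable_fun setT b ->
  measurable_fun setT (fun y => (b y)%:R : R).
Proof.
move=> mb; rewrite (_ : (fun y => _) = fun y => if b y then 1 else 0 : R).
  exact: measurable_fun_ifT.
by apply/funext => y; case: (b y).
Qed.

End MeasurableConnectives.

Section MeasurableStages.
Context d (Y : measurableType d) (R : realType) (X : R -> Y -> R) (a t : R).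
Hypotheses (cX : forall y, continuous (X^~ y)) (a0 : 0 < a) (t0 : 0 <= t).
Hypothesis mX : forall m j, (j <= m.+1)%N -> measurable_fun setT (X (grid_time t m j)).

Let grid s := exists m j, (j <= m.+1)%N /\ s = grid_time t m j.

Let grid_ge0 s : grid s -> 0 <= s.
Proof. by move=> [m [j [jm ->]]]; have [] := grid_time_itv t0 jm. Qed.

(** Grid times of grid times of [t] are again grid times of [t], so the countable descriptions can
    be nested while using only the path at rational multiples of [t]. *)
Let grid_trans s m j : grid s -> (j <= m.+1)%N -> grid (grid_time s m j).
Proof.
move=> [m' [j' [jm' ->]]] jm; exists (m' * m.+1 + m)%N, (j' * j)%N; split.
  by have := leq_mul jm' jm; nia.
rewrite /grid_time (_ : (m' * m.+1 + m).+1 = (m'.+1 * m.+1)%N); last by nia.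
by rewrite !natrM -mulrA mulf_div.
Qed.

Let grid_t : grid t.
Proof. by exists 0%N, 1%N; rewrite grid_time_end. Qed.

Let mXg s : grid s -> measurable_fun setT (X s).
Proof. by move=> [m [j [jm ->]]]; exact: mX. Qed.

Let mM s : grid s -> measurable_fun setT (running_max X s).
Proof.
move=> gs; apply: measurable_fun_le_cst => c.
rewrite (_ : [set y | _] = [set y | forall m j, (j <= m.+1)%N -> X (grid_time s m j) y <= c]).
  apply: measurable_forall => m; apply: measurable_forall => j.
  have [jm|jm] := boolP (j <= m.+1)%N; last first.
    rewrite (_ : [set y | _] = setT)//.
    by apply/seteqP; split => y //= _ h.
  rewrite (_ : [set y | _] = [set y | X (grid_time s m j) y <= c]); last first.
    by apply/seteqP; split => y /=; [exact|move=> h _].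
  apply/measurable_bool_set; apply: measurable_fun_ler => //.
  by apply: mXg; exact: grid_trans.
by apply/seteqP; split => y /= h; exact/(running_max_le_grid (@cX y) c (grid_ge0 gs)).
Qed.

Let mpast k s : grid s -> measurable_fun setT (past X a k s).
Proof.
elim: k s => [|k IH] s gs.
  rewrite (_ : past X a 0 s = fun=> true)//.
  by apply/funext => y; rewrite past0 grid_ge0.
apply/measurable_bool_set.
rewrite (_ : [set y | _] = [set y | exists l, forall i, exists m j m' j',
    [/\ (j <= m.+1)%N, (j' <= m'.+1)%N, grid_time s m j <= grid_time s m' j',
        past X a k (grid_time s m j) y &
        running_max X (grid_time s m j) y + l.+1%:R^-1 <= running_max X (grid_time s m' j') y /\
        a - i.+1%:R^-1 < running_max X (grid_time s m' j') y - X (grid_time s m' j') y]]); last first.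
  by apply/seteqP; split => y /= h; exact/(pastS_grid (@cX y) a0 k (grid_ge0 gs)).
apply: measurable_exists => l; apply: measurable_forall => i.
apply: measurable_exists => m; apply: measurable_exists => j.
apply: measurable_exists => m'; apply: measurable_exists => j'.
have [/and3P[jm jm' jj]|h] := boolP [&& (j <= m.+1)%N, (j' <= m'.+1)%N &
  grid_time s m j <= grid_time s m' j']; last first.
  rewrite (_ : [set y | _] = set0)//.
  by apply/seteqP; split => y // [h1 h2 h3]; rewrite h1 h2 h3 in h.
rewrite (_ : [set y | _] = [set y | [&& past X a k (grid_time s m j) y,
   running_max X (grid_time s m j) y + l.+1%:R^-1 <= running_max X (grid_time s m' j') y &
   a - i.+1%:R^-1 < running_max X (grid_time s m' j') y - X (grid_time s m' j') y]]); last first.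
  apply/seteqP; split => y /=; first by move=> [_ _ _ -> [-> ->]].
  by move=> /and3P[? ? ?].
have g1 := grid_trans gs jm; have g2 := grid_trans gs jm'.
apply/measurable_bool_set; apply: measurable_and; first exact: IH.
apply: measurable_and.
  by apply: measurable_fun_ler; [apply: measurable_funD => //; exact: mM|exact: mM].
by apply: measurable_fun_ltr => //; apply: measurable_funB; [exact: mM|exact: mXg].
Qed.

Let mrecovered k : measurable_fun setT (recovered X a k t).
Proof.
apply/measurable_bool_set.
rewrite (_ : [set y | _] = [set y | exists m j, [/\ (j <= m.+1)%N,
  past X a k (grid_time t m j) y &
  running_max X (grid_time t m j) y < running_max X t y]]); last first.
  by apply/seteqP; split => y /= h; exact/(recovered_grid (@cX y) a k t0).
apply: measurable_exists => m; apply: measurable_exists => j.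
have [jm|jm] := boolP (j <= m.+1)%N; last first.
  rewrite (_ : [set y | _] = set0)//.
  by apply/seteqP; split => y // [h1]; case/negP: jm.
rewrite (_ : [set y | _] = [set y | past X a k (grid_time t m j) y &&
   (running_max X (grid_time t m j) y < running_max X t y)]); last first.
  by apply/seteqP; split => y /=; [move=> [_ -> ->]|move=> /andP[? ?]].
have g := grid_trans grid_t jm.
apply/measurable_bool_set; apply: measurable_and; first exact: mpast.
by apply: measurable_fun_ltr; exact: mM.
Qed.

Lemma measurable_past k : measurable_fun setT (past X a k t).
Proof. exact: mpast. Qed.

Lemma measurable_hunting k : measurable_fun setT (hunting X a k t).
Proof.
by apply: measurable_and => //; apply: measurable_neg; exact: mpast.
Qed.

Lemma measurable_recovering k : measurable_fun setT (recovering X a k t).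
Proof.
by apply: measurable_and; [exact: mpast|exact: measurable_neg].
Qed.

Lemma measurable_running_max : measurable_fun setT (running_max X t).
Proof. exact: mM. Qed.

(** Before the k-th drawdown [max_at] is determined by the path after [t], so it is replaced by 0 to
    remain a function of the history. *)
Lemma measurable_max_at k :
  measurable_fun setT (fun y => if past X a k t y then max_at X a k y else 0).
Proof.
apply: measurable_fun_lt_cst => c.
rewrite (_ : [set y | _] = [set y | exists m j, [/\ (j <= m.+1)%N,
  past X a k (grid_time t m j) y &
  running_max X (grid_time t m j) y < c]] `|` [set y | ~~ past X a k t y && (0 < c)]).
  apply: measurableU; last first.
    apply/measurable_bool_set; apply: measurable_and => //.
    by apply: measurable_neg; exact: mpast.
  apply: measurable_exists => m; apply: measurable_exists => j.
  have [jm|jm] := boolP (j <= m.+1)%N; last first.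
    rewrite (_ : [set y | _] = set0)//.
    by apply/seteqP; split => y // [h1]; case/negP: jm.
  rewrite (_ : [set y | _] = [set y | past X a k (grid_time t m j) y &&
     (running_max X (grid_time t m j) y < c)]); last first.
    by apply/seteqP; split => y /=; [move=> [_ -> ->]|move=> /andP[? ?]].
  have g := grid_trans grid_t jm.
  apply/measurable_bool_set; apply: measurable_and; first exact: mpast.
  by apply: measurable_fun_ltr => //; exact: mM.
apply/seteqP; split => y /=.
  case: ifPn => py hc; last by right.
  by left; apply/(max_at_grid (@cX y) a k c t0).
case=> [/(max_at_grid (@cX y) a k c t0)[-> //]|/andP[py c0]].
by rewrite (negbTE py).
Qed.

Variables (F dF : nat -> R -> R) (rho : R) (n : nat).
Hypotheses (mF : forall k, (k <= n)%N -> measurable_fun setT (F k))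
  (mdF : forall k, (k <= n)%N -> measurable_fun setT (dF k)).

Lemma measurable_val_cst : measurable_fun setT (val_cst X a F rho n t).
Proof.
rewrite /val_cst; apply: measurable_funD.
  apply: measurable_sum => k; apply: measurable_funM.
    by apply: measurable_natr_bool; exact: measurable_hunting.
  by apply: measurableT_comp; [apply: mF; exact: leq_subr|exact: mM].
apply: (eq_measurable_fun (fun y => (past X a n t y)%:R * (rho *
  F 0%N (if past X a n t y then max_at X a n y else 0)))).
  by move=> y _; case: past; rewrite ?mul0r.
apply: measurable_funM; first by apply: measurable_natr_bool; exact: mpast.
apply: measurable_funM => //; apply: measurableT_comp; first exact: mF.
exact: measurable_max_at.
Qed.

Lemma measurable_val_scale : measurable_fun setT (val_scale X a dF n t).
Proof.
apply: measurableT_comp => //; apply: measurable_sum => k; apply: measurable_funM.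
  by apply: measurable_natr_bool; exact: measurable_hunting.
by apply: measurableT_comp; [apply: mdF; exact: leq_subr|exact: mM].
Qed.

Lemma measurable_val_recover : measurable_fun setT (val_recover X a F n t).
Proof.
apply: measurable_sum => k; apply: measurable_funM.
  by apply: measurable_natr_bool; exact: measurable_recovering.
by apply: measurableT_comp; [apply: mF; exact: leq_subr|exact: mM].
Qed.

End MeasurableStages.

(** * Expectations *)

Section Expectations.
Context d (T : measurableType d) (R : realType) (P : probability T R).
Implicit Types (f g : T -> R).

Lemma bounded_integrable f (C : R) : measurable_fun setT f -> (forall w, `|f w| <= C) ->
  P.-integrable setT (EFin \o f).
Proof.
move=> mf fC; apply: (le_integrable measurableT (g := EFin \o cst C)).
- exact/measurable_EFinP.
- by move=> w _; rewrite /= lee_fin (le_trans (fC w))// ler_norm.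
- exact: finite_measure_integrable_cst.
Qed.

Lemma RintegrableZl (c : R) f : P.-integrable setT (EFin \o f) ->
  P.-integrable setT (EFin \o (fun w => c * f w)).
Proof. exact: (integrableZl measurableT c). Qed.

Lemma RintegrableD f g : P.-integrable setT (EFin \o f) ->
  P.-integrable setT (EFin \o g) -> P.-integrable setT (EFin \o (fun w => f w + g w)).
Proof. exact: (integrableD measurableT). Qed.

Lemma RintegrableB f g : P.-integrable setT (EFin \o f) ->
  P.-integrable setT (EFin \o g) -> P.-integrable setT (EFin \o (fun w => f w - g w)).
Proof. exact: (integrableB measurableT). Qed.

Lemma Rintegrable_cst (c : R) : P.-integrable setT (EFin \o (fun=> c)).
Proof. exact: finite_measure_integrable_cst. Qed.

Lemma Rintegral_norm_le f g : measurable_fun setT f -> 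
  P.-integrable setT (EFin \o g) -> (forall w, `|f w| <= g w) ->
  `|\int[P]_w f w| <= \int[P]_w g w.
Proof.
move=> mf ig fg; have if' : P.-integrable setT (EFin \o f).
  apply: (le_integrable measurableT _ _ ig); first exact/measurable_EFinP.
  by move=> w _; rewrite /= lee_fin (le_trans (fg w))// ler_norm.
rewrite (le_trans (le_normr_Rintegral _ if'))//.
apply: le_Rintegral => //.
by have /integrable_norm := if'.
Qed.

Lemma Rintegral_prob_cst (c : R) : \int[P]_w c = c.
Proof. by rewrite Rintegral_cst//= [X in fine X](probability_setT P) mulr1. Qed.

(** The joint law agrees with the product of the marginals on rectangles, hence everywhere, and
    Fubini applies. Boundedness of [U] makes the product integrable. *)
Lemma indep_expectation (U V : T -> R) (C : R) :
  measurable_fun setT U -> (forall w, `|U w| <= C) ->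
  P.-integrable setT (EFin \o V) ->
  (forall A B, measurable A -> measurable B ->
    P (U @^-1` A `&` V @^-1` B) = (P (U @^-1` A) * P (V @^-1` B))%E) ->
  \int[P]_w (U w * V w) = (\int[P]_w U w) * (\int[P]_w V w).
Proof.
move=> mU UC iV ind.
have mV : measurable_fun setT V by apply/measurable_EFinP; case/integrableP: iV.
have iU := bounded_integrable mU UC.
have mUV : measurable_fun setT (fun w => (U w, V w)) by exact/measurable_fun_pair.
have iUV : P.-integrable setT (fun w => (U w * V w)%:E).
  apply: (le_integrable measurableT (g := fun w => (C%:E * (V w)%:E)%E)).
  - by apply/measurable_EFinP; exact: measurable_funM.
  - move=> w _; rewrite /= lee_fin !normrM ler_wpM2r//.
    by rewrite (le_trans (UC w))// ler_norm.
  - exact: integrableZl.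
pose U' : {mfun T >-> R} := mfun_Sub (mem_set mU : U \in mfun).
pose V' : {mfun T >-> R} := mfun_Sub (mem_set mV : V \in mfun).
pose UV' : {mfun T >-> (R * R)%type} := mfun_Sub (mem_set mUV : (fun w => (U w, V w)) \in mfun).
pose m1 : probability _ R := distribution P U'.
pose m2 : probability _ R := distribution P V'.
pose m12 : probability _ R := distribution P UV'.
have mE X : measurable X -> (m1 \x m2)%E X = m12 X.
  apply: product_measure_unique => A B mA mB.
  exact: ind.
have mf : measurable_fun setT (fun z : R * R => (z.1 * z.2)%:E).
  by apply/measurable_EFinP; exact: measurable_funM.
have i12 : (m1 \x m2)%E.-integrable setT (fun z : R * R => (z.1 * z.2)%:E).
  apply/integrableP; split => //.
  rewrite (eq_measure_integral m12); last by move=> A mA _; exact: mE.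
  rewrite ge0_integral_distribution//; last exact: measurableT_comp.
  by case/integrableP: iUV.
rewrite /Rintegral -(_ : (\int[m12]_z (z.1 * z.2)%:E = \int[P]_w (U w * V w)%:E)%E); last first.
  by rewrite integral_distribution.
rewrite [in LHS](eq_measure_integral (m1 \x m2)%E); last first.
  by move=> A mA _; apply/esym; exact: mE.
rewrite -integral12_prod_meas1//= /fubini_F.
have iV' : m2.-integrable setT EFin.
  by apply: integrable_pushforward.
have iU' : m1.-integrable setT EFin.
  by apply: integrable_pushforward.
have EV : (\int[m2]_y y%:E)%E = (\int[P]_w (V w)%:E)%E.
  by rewrite integral_distribution.
have EU : (\int[m1]_y y%:E)%E = (\int[P]_w (U w)%:E)%E.
  by rewrite integral_distribution.
have finV : (\int[P]_w (V w)%:E)%E \is a fin_num by exact: integrable_fin_num.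
have finU : (\int[P]_w (U w)%:E)%E \is a fin_num by exact: integrable_fin_num.
transitivity (fine (\int[m1]_x (x%:E * \int[m2]_y y%:E))%E).
  congr fine; apply: eq_integral => x _.
  by rewrite -integralZl.
rewrite EV -(fineK finV) integralZr// EU.
by rewrite fineM// fineK.
Qed.

End Expectations.

Section NormalIntegral.
Context (R : realType).
Local Notation leb := (@lebesgue_measure R).

Lemma ge0_integral_normal_prob (s : R) (f : R -> \bar R) :
  measurable_fun setT f -> (forall x, (0 <= f x)%E) ->
  (\int[normal_prob 0 s]_x f x = \int[leb]_x (f x * (normal_pdf 0 s x)%:E))%E.
Proof.
move=> mf f0.
pose g := Radon_Nikodym_SigmaFinite.f (normal_prob 0 s) leb.
have dom := normal_prob_dominates 0 s.
rewrite -(Radon_Nikodym_SigmaFinite.change_of_variables dom f0)//.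
have ig := Radon_Nikodym_SigmaFinite.f_integrable dom.
have mpdf : measurable_fun setT (fun x => (normal_pdf 0 s x)%:E : \bar R).
  by apply/measurable_EFinP; exact: measurable_normal_pdf.
apply: ae_eq_integral => //.
- by apply: emeasurable_funM => //; exact: measurable_int ig.
- exact: emeasurable_funM.
- apply: ae_eqe_mul2l; apply: integral_ae_eq => // E _ mE.
  by rewrite -(Radon_Nikodym_SigmaFinite.f_integral dom).
Qed.

(** Completing the square turns the integrand into a constant times the normal density of mean
    [c * s ^+ 2]. *)
Lemma normal_prob_mgf (s c : R) : 0 < s ->
  (\int[normal_prob 0 s]_x (expR (c * x))%:E = (expR (c ^+ 2 * s ^+ 2 / 2))%:E)%E.
Proof.
move=> s0; have sne : s != 0 by rewrite gt_eqF.
have mexp : measurable_fun setT (fun x : R => (expR (c * x))%:E).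
  by apply/measurable_EFinP; apply: measurableT_comp => //.
have f0 (x : R) : (0 <= (expR (c * x))%:E)%E by rewrite lee_fin expR_ge0.
rewrite ge0_integral_normal_prob//.
transitivity (\int[leb]_x ((expR (c ^+ 2 * s ^+ 2 / 2))%:E *
   (normal_pdf (c * s ^+ 2) s x)%:E))%E.
  apply: eq_integral => x _; rewrite -!EFinM; congr EFin.
  rewrite /normal_pdf (negbTE sne) /normal_fun mulrCA [RHS]mulrCA -!expRD.
  congr (_ * expR _); rewrite -mulr_natr; field; exact: sne.
rewrite ge0_integralZl ?lee_fin ?expR_ge0//.
- by rewrite integral_normal_pdf mule1.
- by apply/measurable_EFinP; exact: measurable_normal_pdf.
- by move=> x _; rewrite lee_fin normal_pdf_ge0.
Qed.

End NormalIntegral.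

Section Increments.
Context d (T : measurableType d) (R : realType) (P : probability T R)
  (W : R -> T -> R).
Hypothesis BM : standard_brownian_motion P W.
Variables (mu sigma : R).
Hypothesis sigma0 : 0 < sigma.
Local Notation X := (drifted_process mu sigma W).
Local Notation gamma := (2 * mu / sigma ^+ 2).
Implicit Types (t h c : R).

Lemma ge0_integral_increment t h (f : R -> \bar R) : 0 <= t -> 0 < h ->
  measurable_fun setT f -> (forall x, (0 <= f x)%E) ->
  (\int[P]_w f (W (t + h) w - W t w)%R = \int[normal_prob 0 (Num.sqrt h)]_x f x)%E.
Proof.
move=> t0 h0 mf f0.
have mD : measurable_fun setT (fun w => W (t + h) w - W t w).
  by apply: (measurable_increment BM) => //; rewrite lerDl ltW.
pose D0 : T -> measurableTypeR R := fun w => W (t + h) w - W t w.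
pose D' : {mfun T >-> measurableTypeR R} := mfun_Sub (mem_set (mD : measurable_fun setT D0) : D0 \in mfun).
rewrite -[LHS](@ge0_integral_distribution _ _ _ _ _ P D' f mf f0).
apply: eq_measure_integral => A mA _.
have := @bm_normal _ _ _ _ _ BM t (t + h) t0 _ A mA.
by rewrite ltrDl addrAC subrr add0r => /(_ h0); exact.
Qed.

Lemma increment_mgf t h c : 0 <= t -> 0 < h ->
  (\int[P]_w (expR (c * (W (t + h) w - W t w)))%:E = (expR (c ^+ 2 * h / 2))%:E)%E.
Proof.
move=> t0 h0; have mexp : measurable_fun setT (fun x : R => (expR (c * x))%:E).
  by apply/measurable_EFinP; apply: measurableT_comp => //.
rewrite (ge0_integral_increment (f := fun x => (expR (c * x))%:E))//.
by rewrite normal_prob_mgf ?sqrtr_gt0// sqr_sqrtr// ltW.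
Qed.

Let mincr t h : 0 <= t -> 0 < h -> measurable_fun setT (fun w => W (t + h) w - W t w).
Proof. by move=> t0 h0; apply: (measurable_increment BM) => //; rewrite lerDl ltW. Qed.

Lemma integrable_expR_increment t h c : 0 <= t -> 0 < h ->
  P.-integrable setT (fun w => (expR (c * (W (t + h) w - W t w)))%:E).
Proof.
move=> t0 h0; apply/integrableP; split.
  apply/measurable_EFinP; apply: measurableT_comp => //.
  by apply: measurable_funM => //; exact: mincr.
under eq_integral do rewrite gee0_abs ?lee_fin ?expR_ge0//.
by rewrite increment_mgf// ltry.
Qed.

Lemma integrable_increment t h : 0 <= t -> 0 < h ->
  P.-integrable setT (fun w => (W (t + h) w - W t w)%:E).
Proof.
move=> t0 h0.
apply: (le_integrable measurableT (g := fun w => ((expR (1 * (W (t + h) w - W t w)))%:E +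
   (expR (-1 * (W (t + h) w - W t w)))%:E)%E)).
- by apply/measurable_EFinP; exact: mincr.
- move=> w _; rewrite /= lee_fin mul1r mulN1r; set y := _ - _.
  rewrite [leRHS]ger0_norm ?addr_ge0 ?expR_ge0//.
  have := expR_ge1Dx y; have := expR_ge1Dx (- y).
  have := expR_ge0 y; have := expR_ge0 (- y).
  by rewrite ler_norml => ????; apply/andP; split; lra.
- by apply: integrableD => //; exact: integrable_expR_increment.
Qed.

(* [E (c D) <= E (exp (c D)) - 1 = o(c)] for both signs of [c]. *)
Lemma mean_increment t h : 0 <= t -> 0 < h ->
  \int[P]_w (W (t + h) w - W t w) = 0.
Proof.
move=> t0 h0; have iD := integrable_increment t0 h0.
set m := Rintegral _ _ _.
have key c : 1 + c * m <= expR (c ^+ 2 * h / 2).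
  have <- : \int[P]_w (expR (c * (W (t + h) w - W t w))) = expR (c ^+ 2 * h / 2).
    by rewrite /Rintegral increment_mgf.
  have ic : P.-integrable setT (EFin \o fun w => c * (W (t + h) w - W t w)).
    exact: RintegrableZl.
  rewrite -(RintegralZl c measurableT iD) -[X in X + _](Rintegral_prob_cst P).
  have i1 : P.-integrable setT (EFin \o fun _ : T => 1 : R).
    exact: Rintegrable_cst.
  rewrite -RintegralD//; apply: le_Rintegral => //.
  - exact: RintegrableD.
  - exact: integrable_expR_increment.
  - by move=> w _; exact: expR_ge1Dx.
pose v := h / 2 * expR (h / 2).
have v0 : 0 <= v by rewrite mulr_ge0 ?expR_ge0// divr_ge0// ltW.
have small c : `|c| <= 1 -> c * m <= c ^+ 2 * v.
  move=> c1; have c2 : 0 <= c ^+ 2 <= 1.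
    by rewrite sqr_ge0/= -[c ^+ 2]real_normK ?num_real// exprn_ile1.
  set z := c ^+ 2 * h / 2.
  have z0 : 0 <= z by rewrite divr_ge0// mulr_ge0 ?(ltW h0)//; case/andP: c2.
  have zh : z <= h / 2 by rewrite /z ler_pM2r ?invr_gt0// ler_piMl ?(ltW h0)//; case/andP: c2.
  have e1 : expR z - 1 <= z * expR (h / 2).
    have := expR_ge1Dx (- z); rewrite expRN.
    have ez := expR_gt0 z => hz.
    have : (1 - z) * expR z <= 1 by rewrite -ler_pdivlMr// mul1r.
    have : z * expR z <= z * expR (h / 2) by rewrite ler_wpM2l// ler_expR.
    by nra.
  have := key c; rewrite -/z.
  rewrite (_ : c ^+ 2 * v = z * expR (h / 2)); last by rewrite /v /z; field.
  by lra.
apply/eqP/negP => /negP m0.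
(* The choice [c = m / k] has size at most 1, and [small] would give
   [m ^+ 2 / k <= m ^+ 2 / k * (v / k)], impossible as [v < k] and [m] is nonzero. *)
pose k := v + `|m| + 1.
have k0 : 0 < k by rewrite /k; have := normr_ge0 m; lra.
have kv : v < k by rewrite /k; have := normr_ge0 m; lra.
have m2 : 0 < m ^+ 2 by rewrite exprn_even_gt0.
have := small (m / k).
rewrite normrM [`|k^-1|]gtr0_norm ?invr_gt0// ler_pdivrMr// mul1r.
have -> : `|m| <= k by rewrite /k; lra.
move=> /(_ isT); apply/negP; rewrite -ltNge.
rewrite (_ : (m / k) ^+ 2 * v = m ^+ 2 / k * (v / k)); last by field; rewrite gt_eqF.
rewrite [ltRHS](_ : _ = m ^+ 2 / k); last by ring.
rewrite gtr_pMr ?divr_gt0// ltr_pdivrMr// mul1r.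
exact: kv.
Qed.

End Increments.

(** * Mean change over a step *)

Lemma lipschitz_measurable (R : realType) (f : R -> R) (B : R) :
  (forall x y, `|f x - f y| <= B * `|x - y|) -> measurable_fun setT f.
Proof.
move=> fB; apply: continuous_measurable_fun => x.
apply/cvgrPdist_le => e e0.
have B1 : 0 < `|B| + 1 by rewrite ltr_wpDl.
exists (e / (`|B| + 1)) => /=; first by rewrite divr_gt0.
move=> y /= xy; rewrite (le_trans (fB _ _))//.
rewrite (@le_trans _ _ ((`|B| + 1) * `|x - y|))//.
  by rewrite ler_wpM2r// (le_trans (ler_norm _))// lerDl.
by rewrite mulrC -ler_pdivlMr// ltW.
Qed.

Section OneStep.
Context d (T : measurableType d) (R : realType) (P : probability T R)
  (W : R -> T -> R).
Hypotheses (BM : standard_brownian_motion P W) (cW : forall w, continuous (W^~ w)).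
Variables (mu sigma a : R).
Hypotheses (sigma0 : 0 < sigma) (a0 : 0 < a).
Local Notation X := (drifted_process mu sigma W).
Local Notation gamma := (2 * mu / sigma ^+ 2).
Implicit Types (t h c : R) (w : T).

Lemma drifted_continuous w : continuous (X^~ w).
Proof.
move=> t; apply: cvgD; apply: cvgM; try exact: cvg_cst.
  exact: cvg_id.
exact: cW.
Qed.

Lemma drifted0 w : X 0 w = 0.
Proof. by rewrite /drifted_process (bm_start BM) !mulr0 addr0. Qed.

Lemma drifted_increment t h w :
  X (t + h) w - X t w = mu * h + sigma * (W (t + h) w - W t w).
Proof. by rewrite /drifted_process; ring. Qed.

Lemma measurable_drifted_history t m j : (j <= m.+1)%N ->
  measurable_fun [set: history W t] (X (grid_time t m j)).
Proof.
move=> jm; apply: measurable_funD => //; apply: measurable_funM => //.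
exact: measurable_history.
Qed.

Lemma history_measurable t (f : T -> R) : 0 <= t ->
  measurable_fun [set: history W t] f -> measurable_fun [set: T] f.
Proof.
move=> t0 mf _ A mA; rewrite setTI.
have [|//] := history_indep BM t0 ltr01 (@measurableT _ R) (A := f @^-1` A).
by have := mf measurableT A mA; rewrite setTI.
Qed.

Let mhist_X t : measurable_fun [set: history W t] (X t).
Proof. by have := @measurable_drifted_history t 0%N 1%N isT; rewrite grid_time_end. Qed.

(** Takes the place of conditional expectation: coefficients frozen at [t] multiply centred
    functions of the next increment. *)
Lemma history_expectation t h (U : T -> R) (psi : R -> R) (C : R) :
  0 <= t -> 0 < h -> measurable_fun [set: history W t] U ->
  (forall w, `|U w| <= C) -> measurable_fun setT psi ->
  P.-integrable setT (EFin \o (fun w => psi (W (t + h) w - W t w))) ->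
  \int[P]_w psi (W (t + h) w - W t w) = 0 ->
  \int[P]_w (U w * psi (W (t + h) w - W t w)) = 0.
Proof.
move=> t0 h0 mU UC mpsi ipsi e.
rewrite (indep_expectation (history_measurable t0 mU) UC ipsi) ?e ?mulr0//.
move=> A B mA mB.
have mB' : measurable (psi @^-1` B) by rewrite -[X in measurable X]setTI; exact: mpsi.
have [|_] := history_indep BM t0 h0 mB' (A := U @^-1` A).
  by have := mU measurableT A mA; rewrite setTI.
exact.
Qed.

Lemma drifted_mgf t h c : 0 <= t -> 0 < h ->
  \int[P]_w expR (c * (X (t + h) w - X t w)) =
  expR (c * mu * h + c ^+ 2 * sigma ^+ 2 * h / 2).
Proof.
move=> t0 h0.
rewrite (eq_Rintegral P (g := fun w => expR (c * mu * h) * expR ((c * sigma) * (W (t + h) w - W t w)))).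
  rewrite RintegralZl//; last exact: integrable_expR_increment.
  by rewrite /Rintegral increment_mgf// -expRD exprMn.
by move=> w _; rewrite -expRD drifted_increment; congr expR; ring.
Qed.

Lemma integrable_drifted_exp t h c : 0 <= t -> 0 < h ->
  P.-integrable setT (EFin \o (fun w => expR (c * (X (t + h) w - X t w)))).
Proof.
move=> t0 h0.
rewrite (_ : (fun w => _) = (fun w => expR (c * mu * h) * expR ((c * sigma) * (W (t + h) w - W t w)))).
  by apply: RintegrableZl; exact: integrable_expR_increment.
by apply/funext => w; rewrite -expRD drifted_increment; congr expR; ring.
Qed.

(** The exponent [- gamma * mu + gamma ^+ 2 * sigma ^+ 2 / 2] vanishes because
    [gamma * sigma ^+ 2 = 2 * mu]. *)
Lemma drifted_gamma_mgf t h : 0 <= t -> 0 < h ->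
  \int[P]_w expR (- gamma * (X (t + h) w - X t w)) = 1.
Proof.
move=> t0 h0; rewrite drifted_mgf// -[RHS]expR0; congr expR.
by field; rewrite gt_eqF.
Qed.

Let psiW (psi : R -> R) t h : (fun w => psi (X (t + h) w - X t w)) =
  (fun w => (psi \o (fun z => mu * h + sigma * z)) (W (t + h) w - W t w)).
Proof. by apply/funext => w; rewrite drifted_increment. Qed.

Let mshift h : measurable_fun setT (fun z : R => mu * h + sigma * z).
Proof. by apply: measurable_funD => //; apply: measurable_funM. Qed.

Lemma measurable_scale g : measurable_fun setT (@scale R g).
Proof.
rewrite /scale; case: (g == 0) => //; apply: measurable_funM => //.
by apply: measurable_funB => //; apply: measurableT_comp.
Qed.

Lemma measurable_recover g : measurable_fun setT (@recover R g).
Proof. by apply: measurableT_comp => //. Qed.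

Lemma scale_increment_mean t h : 0 <= t -> 0 < h ->
  P.-integrable setT (EFin \o (fun w => scale gamma (- (X (t + h) w - X t w)))) /\
  \int[P]_w scale gamma (- (X (t + h) w - X t w)) = 0.
Proof.
move=> t0 h0; rewrite /scale; case: (boolP (gamma == 0)) => g0.
  have mu0 : mu = 0.
    move: g0; rewrite !mulf_eq0 invr_eq0 expf_eq0/= (gt_eqF sigma0) orbF.
    by rewrite pnatr_eq0/= => /eqP.
  rewrite (_ : (fun w => _) = (fun w => (- sigma) * (W (t + h) w - W t w))); last first.
    by apply/funext => w; rewrite drifted_increment mu0; ring.
  have i := integrable_increment BM t0 h0.
  split; first exact: RintegrableZl.
  by rewrite RintegralZl// (mean_increment BM)// mulr0.
have i := integrable_drifted_exp (- gamma) t0 h0.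
have ib : P.-integrable setT (EFin \o (fun w => expR (- gamma * (X (t + h) w - X t w)) - 1)).
  by apply: RintegrableB => //; exact: Rintegrable_cst.
rewrite (_ : (fun w => _) = (fun w => gamma^-1 * (expR (- gamma * (X (t + h) w - X t w)) - 1))); last first.
  by apply/funext => w; rewrite mulrN mulNr mulrC.
split; first exact: RintegrableZl.
rewrite RintegralZl// RintegralB//; last exact: Rintegrable_cst.
by rewrite drifted_gamma_mgf// Rintegral_prob_cst subrr mulr0.
Qed.

(** For [gamma <= 0] this is the exponential martingale; for [gamma > 0] the function [recover] is
    constantly 1. *)
Lemma recover_increment_mean t h : 0 <= t -> 0 < h ->
  P.-integrable setT (EFin \o (fun w => recover gamma (- (X (t + h) w - X t w)) - 1)) /\
  \int[P]_w (recover gamma (- (X (t + h) w - X t w)) - 1) = 0.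
Proof.
move=> t0 h0.
have ir : P.-integrable setT (EFin \o (fun w => recover gamma (- (X (t + h) w - X t w)))).
  rewrite (_ : (fun w => _) = (fun w => expR (- Num.min gamma 0 * (X (t + h) w - X t w)))).
    exact: integrable_drifted_exp.
  by apply/funext => w; rewrite /recover mulNr mulrN.
split; first by apply: RintegrableB => //; exact: Rintegrable_cst.
rewrite RintegralB//; last exact: Rintegrable_cst.
rewrite Rintegral_prob_cst (eq_Rintegral P (g := fun w => expR (- Num.min gamma 0 * (X (t + h) w - X t w)))); last first.
  by move=> w _; rewrite /recover mulNr mulrN.
have [g0|g0] := leP gamma 0.
  by rewrite drifted_gamma_mgf// subrr.
by rewrite drifted_mgf// oppr0 expr0n/= !mul0r addr0 expR0 subrr.
Qed.

Variables (F dF : nat -> R -> R) (rho K B : R) (n : nat).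
Hypothesis V : value_functions F dF (scale_trunc gamma a) (recover_trunc gamma) a rho K B n.
Local Notation A0 := (val_cst X a F rho n).
Local Notation A1 := (val_scale X a dF n).
Local Notation A2 := (val_recover X a F n).
Local Notation u := (stage_value X a F dF (scale_trunc gamma a) (recover_trunc gamma) rho n).
Local Notation D t w := (running_max X t w - X t w).

Let mF k : (k <= n)%N -> measurable_fun setT (F k).
Proof. by move=> kn; apply: (lipschitz_measurable (B := B)) => x y; exact: (vf_lip V). Qed.

Let mdF k : (k <= n)%N -> measurable_fun setT (dF k).
Proof. by move=> kn; apply: (lipschitz_measurable (B := B)) => x y; exact: (vf_dlip V). Qed.

Let mA1 t : 0 <= t -> measurable_fun [set: history W t] (A1 t).
Proof.
move=> t0; apply: measurable_val_scale => //; first exact: drifted_continuous.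
by move=> m j; exact: measurable_drifted_history.
Qed.

Let mA2 t : 0 <= t -> measurable_fun [set: history W t] (A2 t).
Proof.
move=> t0; apply: measurable_val_recover => //; first exact: drifted_continuous.
by move=> m j; exact: measurable_drifted_history.
Qed.

Let mA0 t : 0 <= t -> measurable_fun [set: history W t] (A0 t).
Proof.
move=> t0; apply: measurable_val_cst => //; first exact: drifted_continuous.
by move=> m j; exact: measurable_drifted_history.
Qed.

Let mM t : 0 <= t -> measurable_fun [set: history W t] (running_max X t).
Proof.
move=> t0; apply: measurable_running_max => //; first exact: drifted_continuous.
by move=> m j; exact: measurable_drifted_history.
Qed.

Let mX t : 0 <= t -> measurable_fun [set: T] (X t).
Proof. by move=> t0; apply: (history_measurable t0); exact: mhist_X. Qed.

Let mD t : 0 <= t -> measurable_fun [set: history W t] (fun w => D t w).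
Proof. by move=> t0; apply: measurable_funB => //; exact: mM. Qed.

Let D0 t w : 0 <= t -> 0 <= D t w.
Proof.
by move=> t0; rewrite subr_ge0; apply: running_max_ge => //; exact: drifted_continuous.
Qed.

Lemma measurable_stage_value s t : 0 <= s -> 0 <= t ->
  measurable_fun [set: T] (fun w => u s w (X t w)).
Proof.
move=> s0 t0; have mMX : measurable_fun [set: T] (fun w => running_max X s w - X t w).
  by apply: measurable_funB; [exact: (history_measurable s0 (mM s0))|exact: mX].
apply: measurable_funD; first apply: measurable_funD.
- exact: (history_measurable s0 (mA0 s0)).
- apply: measurable_funM; first exact: (history_measurable s0 (mA1 s0)).
  apply: measurableT_comp => //; apply: (lipschitz_measurable (B := B)) => x y.
  exact: (vf_Slip V).
- apply: measurable_funM; first exact: (history_measurable s0 (mA2 s0)).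
  apply: measurableT_comp => //; apply: (lipschitz_measurable (B := B)) => x y.
  exact: (vf_rlip V).
Qed.

Lemma stage_value_bound t w y : 0 <= t -> `|u t w y| <= B + B ^+ 2.
Proof. by move=> t0; apply: (val_bound V) => //; exact: drifted_continuous. Qed.

Let coef t w (t0 : 0 <= t) := val_coefficients V (@drifted_continuous w) a0 t0.

(** The outer [B] bounds the coefficients; inside, [2 * B] bounds the truncated functions, the
    exponential accounts for [scale] at a drawdown up to [a], and 1 for [recover]. *)
Definition tail_cst : R := B * (2 * B + expR ((1 + `|gamma|) * a) + 1).

Let B1 := vf_B1 V.

Let tail_cst_ge0 : 0 <= tail_cst.
Proof.
have B1' := B1; have e0 := expR_ge0 ((1 + `|gamma|) * a).
by rewrite mulr_ge0//; lra.
Qed.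

Let expR_abs (c z : R) : 0 <= c -> expR (c * `|z|) <= expR (c * z) + expR (- c * z).
Proof.
move=> c0; have [z0|z0] := leP 0 z; first by rewrite ger0_norm// lerDl expR_ge0.
by rewrite ltr0_norm// mulrN mulNr lerDr expR_ge0.
Qed.

Let remainder t h w := u t w (X (t + h) w) - u t w (X t w) -
  (A1 t w * expR (gamma * D t w)) * scale gamma (- (X (t + h) w - X t w)) -
  (A2 t w * recover gamma (D t w)) * (recover gamma (- (X (t + h) w - X t w)) - 1).

(** For an increment [y] with [|y| < 1] the truncations are inactive and the defect is 0. Otherwise
    it is at most a constant times [expR (c * |y|)], and [|y| >= 1] allows multiplication by
    [expR (theta * (|y| - 1)) >= 1]. *)
Let remainder_bound t h w (theta : R) : 0 <= t -> 0 < h -> 0 <= theta ->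
  `|remainder t h w| <= tail_cst * expR (- theta) *
     (expR ((1 + `|gamma| + theta) * (X (t + h) w - X t w)) +
      expR (- (1 + `|gamma| + theta) * (X (t + h) w - X t w))).
Proof.
move=> t0 h0 th0; have [A1B A2B A1D] := coef w t0.
have D0' := D0 w t0; have B1' := B1.
set y := X (t + h) w - X t w; set c := 1 + `|gamma|; set z := D t w in D0' A1D *; have a0' := a0.
have g0 := normr_ge0 gamma.
have zE : running_max X t w - X (t + h) w = z - y by rewrite /z /y; ring.
have zm : -1 <= z by lra.
have rem : remainder t h w = A1 t w * (scale_trunc gamma a (z - y) - scale gamma (z - y)
      - (scale_trunc gamma a z - scale gamma z)) +
    A2 t w * (recover_trunc gamma (z - y) - recover gamma (z - y)).
  rewrite /remainder /stage_value zE -/z -/y scaleB recoverB (recover_truncE _ zm).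
  ring.
have rhs0 : 0 <= tail_cst * expR (- theta) * (expR ((c + theta) * y) + expR (- (c + theta) * y)).
  apply: mulr_ge0; last by rewrite addr_ge0 ?expR_ge0.
  by apply: mulr_ge0; [exact: tail_cst_ge0|exact: expR_ge0].
have S1 : A1 t w * (scale_trunc gamma a z - scale gamma z) = 0.
  have [->|/A1D za] := eqVneq (A1 t w) 0; first by rewrite mul0r.
  by rewrite scale_truncE ?subrr ?mulr0//; apply/andP; split; lra.
rewrite mulrBr S1 subr0 in rem.
have [y1|y1] := ltP `|y| 1.
  move: y1; rewrite ltr_norml => /andP[y1 y2].
  rewrite rem (recover_truncE gamma (z := z - y)); last by lra.
  rewrite subrr mulr0 addr0.
  have [->|/A1D za] := eqVneq (A1 t w) 0; first by rewrite mul0r normr0.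
  by rewrite scale_truncE ?subrr ?mulr0 ?normr0//; apply/andP; split; lra.
have c0 : 0 <= c by rewrite /c; lra.
have ct0 : 0 <= c + theta by rewrite addr_ge0.
apply: (@le_trans _ _ (tail_cst * expR (c * `|y|))); last first.
  rewrite -mulrA ler_wpM2l// (@le_trans _ _ (expR (- theta) * expR ((c + theta) * `|y|)))//.
    rewrite -expRD ler_expR [(c + theta) * _]mulrDl.
    have h1 : theta <= theta * `|y| by rewrite ler_peMr.
    by lra.
  by rewrite ler_wpM2l ?expR_ge0// expR_abs.
have e1 : 1 <= expR (c * `|y|) by rewrite -expR0 ler_expR mulr_ge0.
have b1 : `|A1 t w * (scale_trunc gamma a (z - y) - scale gamma (z - y))| <=
    B * (B + expR (c * a)) * expR (c * `|y|).
  have [->|/A1D za] := eqVneq (A1 t w) 0.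
    by rewrite mul0r normr0 !mulr_ge0 ?addr_ge0 ?expR_ge0//; lra.
  rewrite normrM -[leRHS]mulrA ler_pM//  (le_trans (ler_normB _ _))// [leRHS]mulrDl lerD//.
    by rewrite (le_trans (vf_S V _))// ler_peMr//; lra.
  rewrite (le_trans (scale_bound _ _))//.
  have zy : `|z - y| <= a + `|y|.
    by rewrite (le_trans (ler_normB _ _))// lerD2r ger0_norm// ltW.
  rewrite (@le_trans _ _ (expR (c * `|z - y|)))//.
    rewrite (_ : c * `|z - y| = `|z - y| + `|gamma| * `|z - y|); last by rewrite /c; ring.
    rewrite expRD ler_wpM2r ?expR_ge0//.
    by rewrite (le_trans _ (expR_ge1Dx _))// lerDr.
  by rewrite -expRD ler_expR -mulrDr ler_wpM2l.
have b2 : `|A2 t w * (recover_trunc gamma (z - y) - recover gamma (z - y))| <=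
    B * (B + 1) * expR (c * `|y|).
  rewrite normrM -[leRHS]mulrA ler_pM// (le_trans (ler_normB _ _))// [leRHS]mulrDl lerD//.
    by rewrite (le_trans (vf_r V _))// ler_peMr//; lra.
  rewrite mul1r gtr0_norm ?expR_gt0// ler_expR.
  have k0 : Num.min gamma 0 <= 0 by rewrite ge_min lexx orbT.
  have kg := min0_norm gamma.
  rewrite mulrBr (@le_trans _ _ (`|Num.min gamma 0 * y|))//.
    rewrite -[leRHS]add0r lerD ?mulr_le0_ge0//.
    by rewrite (le_trans (ler_norm _))// normrN.
  by rewrite normrM ler_wpM2r// (le_trans kg)// /c; lra.
rewrite rem (le_trans (ler_normD _ _))// (le_trans (lerD b1 b2))//.
rewrite -mulrDl ler_wpM2r ?expR_ge0// /tail_cst -/c.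
by rewrite -mulrDr ler_wpM2l//; lra.
Qed.

(** The free parameter [theta] trades the small factor [expR (- theta)] against exponential moments
    of higher order. *)
Lemma one_step t h (theta : R) : 0 <= t -> 0 < h -> 0 <= theta ->
  `|\int[P]_w u t w (X (t + h) w) - \int[P]_w u t w (X t w)| <=
  tail_cst * expR (- theta) *
  (expR ((1 + `|gamma| + theta) * mu * h + (1 + `|gamma| + theta) ^+ 2 * sigma ^+ 2 * h / 2) +
   expR (- (1 + `|gamma| + theta) * mu * h + (1 + `|gamma| + theta) ^+ 2 * sigma ^+ 2 * h / 2)).
Proof.
move=> t0 h0 th0; have th' : 0 <= t + h by rewrite addr_ge0// ltW.
set c := 1 + `|gamma| + theta.
have i1 : P.-integrable setT (EFin \o (fun w => u t w (X (t + h) w))).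
  by apply: (bounded_integrable _ (C := B + B ^+ 2)); [exact: measurable_stage_value|
    move=> w; exact: stage_value_bound].
have i2 : P.-integrable setT (EFin \o (fun w => u t w (X t w))).
  by apply: (bounded_integrable _ (C := B + B ^+ 2)); [exact: measurable_stage_value|
    move=> w; exact: stage_value_bound].
pose U1 w := A1 t w * expR (gamma * D t w).
pose U2 w := A2 t w * recover gamma (D t w).
have B1' := B1.
have mU1 : measurable_fun [set: history W t] U1.
  apply: measurable_funM; first exact: mA1.
  apply: measurableT_comp => //; apply: measurable_funM => //; exact: mD.
have mU2 : measurable_fun [set: history W t] U2.
  apply: measurable_funM; first exact: mA2.
  by apply: measurableT_comp; [exact: measurable_recover|exact: mD].
have U1B w : `|U1 w| <= B * expR (`|gamma| * a).
  have [A1B _ A1D] := coef w t0; rewrite /U1.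
  have [->|/A1D za] := eqVneq (A1 t w) 0.
    by rewrite mul0r normr0 mulr_ge0 ?expR_ge0//; lra.
  rewrite normrM ler_pM// gtr0_norm ?expR_gt0// ler_expR.
  rewrite (le_trans (ler_norm _))// normrM ler_wpM2l// ger0_norm ?D0//.
  exact: ltW.
have U2B w : `|U2 w| <= B.
  have [_ A2B _] := coef w t0; rewrite /U2 normrM -[leRHS]mulr1 ler_pM//.
  by rewrite gtr0_norm ?expR_gt0// recover_le1// D0.
have [is1 es1] := scale_increment_mean t0 h0.
have [is2 es2] := recover_increment_mean t0 h0.
pose p1 := scale gamma \o -%R \o (fun z => mu * h + sigma * z).
pose p2 := (fun z => recover gamma (- z) - 1) \o (fun z => mu * h + sigma * z).
have e1 : (fun w => scale gamma (- (X (t + h) w - X t w))) = (fun w => p1 (W (t + h) w - W t w)).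
  by rewrite (psiW (fun z => scale gamma (- z))).
have e2 : (fun w => recover gamma (- (X (t + h) w - X t w)) - 1) = (fun w => p2 (W (t + h) w - W t w)).
  by rewrite (psiW (fun z => recover gamma (- z) - 1)).
have mp1 : measurable_fun setT p1.
  by apply: measurableT_comp => //; apply: measurableT_comp => //; exact: measurable_scale.
have mp2 : measurable_fun setT p2.
  apply: measurableT_comp => //; apply: measurable_funB => //.
  by apply: measurableT_comp => //; exact: measurable_recover.
have z1 : \int[P]_w (U1 w * scale gamma (- (X (t + h) w - X t w))) = 0.
  have -> : (fun w => U1 w * scale gamma (- (X (t + h) w - X t w))) =
            (fun w => U1 w * p1 (W (t + h) w - W t w)).
    by apply/funext => w; congr (_ * _); exact: (congr1 (@^~ w) e1).
  by apply: (history_expectation t0 h0 mU1 U1B mp1); rewrite -e1.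
have z2 : \int[P]_w (U2 w * (recover gamma (- (X (t + h) w - X t w)) - 1)) = 0.
  have -> : (fun w => U2 w * (recover gamma (- (X (t + h) w - X t w)) - 1)) =
            (fun w => U2 w * p2 (W (t + h) w - W t w)).
    by apply/funext => w; congr (_ * _); exact: (congr1 (@^~ w) e2).
  by apply: (history_expectation t0 h0 mU2 U2B mp2); rewrite -e2.
have prodi (U Z : T -> R) C : measurable_fun [set: history W t] U ->
    (forall w, `|U w| <= C) -> P.-integrable setT (EFin \o Z) ->
    P.-integrable setT (EFin \o (fun w => U w * Z w)).
  move=> mU UC iZ; apply: (le_integrable measurableT _ _ (RintegrableZl C iZ)).
    apply/measurable_EFinP; apply: measurable_funM; first exact: (history_measurable t0).
    by apply/measurable_EFinP; case/integrableP: iZ.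
  move=> w _; rewrite /= lee_fin !normrM ler_wpM2r//.
  by rewrite (le_trans (UC w))// ler_norm.
have iz1 := prodi _ _ _ mU1 U1B is1.
have iz2 := prodi _ _ _ mU2 U2B is2.
have irem : P.-integrable setT (EFin \o remainder t h).
  by apply: RintegrableB => //; apply: RintegrableB => //; exact: RintegrableB.
have -> : \int[P]_w u t w (X (t + h) w) - \int[P]_w u t w (X t w) = \int[P]_w remainder t h w.
  rewrite [RHS]RintegralB//; last by apply: RintegrableB => //; exact: RintegrableB.
  rewrite RintegralB//; last exact: RintegrableB.
  by rewrite RintegralB// z1 z2 !subr0.
have ie s : P.-integrable setT (EFin \o (fun w => expR (s * (X (t + h) w - X t w)))).
  exact: integrable_drifted_exp.
rewrite (le_trans (Rintegral_norm_le (g := fun w => tail_cst * expR (- theta) *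
     (expR (c * (X (t + h) w - X t w)) + expR (- c * (X (t + h) w - X t w)))) _ _ _))//.
- by apply/measurable_EFinP; case/integrableP: irem.
- by apply: RintegrableZl; exact: RintegrableD.
- by move=> w; exact: remainder_bound.
rewrite RintegralZl//; last exact: RintegrableD.
by rewrite RintegralD// !drifted_mgf// sqrrN.
Qed.

End OneStep.

Lemma bounded_convergence d (T : measurableType d) (R : realType)
    (P : probability T R) (f_ : nat -> T -> R) (f : T -> R) (C : R) :
  (forall m, measurable_fun setT (f_ m)) -> measurable_fun setT f ->
  (forall m w, `|f_ m w| <= C) -> {ae P, forall w, f_ m w @[m --> \oo] --> f w} ->
  \int[P]_w f_ m w @[m --> \oo] --> \int[P]_w f w.
Proof.
move=> mf_ mf fC cf.
have [||||| if' _ h] := @dominated_convergence _ _ _ P setT measurableT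
  (fun m w => (f_ m w)%:E) (fun w => (f w)%:E) (fun=> C%:E).
- by move=> m; exact/measurable_EFinP.
- exact/measurable_EFinP.
- move: cf; apply: filterS => w cw _.
  by apply/fine_cvgP; split; [apply: nearW|exact: cw].
- exact: finite_measure_integrable_cst.
- by apply: aeW => w m _; rewrite /= lee_fin.
by apply: fine_cvg; rewrite fineK//; exact: integrable_fin_num.
Qed.

Section ValueMean.
Context d (T : measurableType d) (R : realType) (P : probability T R)
  (W : R -> T -> R).
Hypotheses (BM : standard_brownian_motion P W) (cW : forall w, continuous (W^~ w)).
Variables (mu sigma a : R).
Hypotheses (sigma0 : 0 < sigma) (a0 : 0 < a).
Local Notation X := (drifted_process mu sigma W).
Local Notation gamma := (2 * mu / sigma ^+ 2).
Variables (F dF : nat -> R -> R) (rho K B : R) (n : nat).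
Hypothesis V : value_functions F dF (scale_trunc gamma a) (recover_trunc gamma) a rho K B n.
Hypotheses (K0 : 0 <= K) (n0 : (0 < n)%N).
Local Notation u := (stage_value X a F dF (scale_trunc gamma a) (recover_trunc gamma) rho n).
Local Notation err := (step_error X a F dF (scale_trunc gamma a) (recover_trunc gamma) rho n).
Local Notation C := (4 * (B + B ^+ 2)).

Let cX w : continuous (X^~ w). Proof. exact: drifted_continuous. Qed.
Let X0 w : X 0 w = 0. Proof. exact: (drifted0 BM). Qed.

Lemma stage_value_start w : u 0 w (X 0 w) = F n 0.
Proof.
have p0 : past X a 0 0 w by rewrite past0.
have m0 : max_at X a 0 w = running_max X 0 w by [].
rewrite (val_recovering _ _ _ _ _ (@cX w) a0 (k := 0%N))//; last first.
  by rewrite /recovering /recovered p0 /= m0 ltxx.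
by rewrite running_max0 ?X0//; rewrite subrr (vf_r0 V) mul1r subn0.
Qed.

Let mu2 s t : 0 <= s -> 0 <= t -> measurable_fun [set: T] (fun w => u s w (X t w)).
Proof. by move=> s0 t0; apply: (measurable_stage_value BM cW a0 V). Qed.

Let iu s t : 0 <= s -> 0 <= t -> P.-integrable setT (EFin \o (fun w => u s w (X t w))).
Proof.
move=> s0 t0; apply: (bounded_integrable _ (C := B + B ^+ 2)); first exact: mu2.
by move=> w; apply: (stage_value_bound cW a0 V).
Qed.

Let merr h i : 0 <= h -> measurable_fun setT (fun w => err w h i).
Proof. by move=> h0; apply: measurable_funB; apply: mu2; rewrite mulr_ge0. Qed.

Let msum h N : 0 <= h -> measurable_fun setT (fun w => \sum_(i < N) err w h i).
Proof. by move=> h0; apply: measurable_sum => i; exact: merr. Qed.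

(** Each step first moves the path with the stage frozen, whose effect is small in mean, and then
    updates the stage, whose effect is small along the path. *)
Let telescope h N : 0 <= h ->
  \int[P]_w u (N%:R * h) w (X (N%:R * h) w) - F n 0 =
  \int[P]_w (\sum_(i < N) err w h i) +
  \sum_(i < N) (\int[P]_w u (i%:R * h) w (X (i%:R * h + h) w) -
                \int[P]_w u (i%:R * h) w (X (i%:R * h) w)).
Proof.
move=> h0; have ih i : 0 <= i%:R * h by rewrite mulr_ge0.
elim: N => [|N IH].
  rewrite !big_ord0 addr0 mul0r.
  rewrite (eq_Rintegral P (g := fun=> F n 0)); last by move=> w _; rewrite stage_value_start.
  rewrite [X in _ = X](eq_Rintegral P (g := fun=> 0)); last by move=> w _; rewrite big_ord0.
  by rewrite !Rintegral_prob_cst subrr.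
rewrite big_ord_recr/=.
rewrite [X in _ = X + _](eq_Rintegral P (g := fun w => \sum_(i < N) err w h i + err w h N)); last first.
  by move=> w _; rewrite big_ord_recr.
have ierr i : P.-integrable setT (EFin \o (fun w => err w h i)).
  by apply: RintegrableB; exact: iu.
have isum : P.-integrable setT (EFin \o (fun w => \sum_(i < N) err w h i)).
  apply: (bounded_integrable _ (C := C * (2 * n%:R + K))); first exact: msum.
  by move=> w; apply: (sum_step_error V).
rewrite [X in _ = X + _]RintegralD// addrACA -IH.
rewrite [X in _ = _ + (X + _)]RintegralB; [|by []|exact: iu|exact: iu].
have alg (p q r f : R) : p - f = q - f + (p - r + (r - q)) by ring.
have -> : N.+1%:R * h = N%:R * h + h by rewrite -natr1 mulrDl mul1r.
exact: alg.
Qed.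

Let small_sum w (N0 : nat) (e : R) : 0 < e ->
  \forall m \near \oo, `|\sum_(i < N0 * m.+1 ^ 2) err w ((m.+1%:R ^+ 2)^-1) i| <= e.
Proof.
move=> e0; have B1 := vf_B1 V; have K0' := K0; have a0' := a0.
pose D := C * (2 * n%:R + K).
have n1 : 1 <= n%:R :> R by rewrite ler1n.
have B0 : 0 < B by lra.
have D0 : 0 < D.
  by rewrite /D mulr_gt0 ?ltr_wpDr// ?mulr_gt0 ?addr_gt0 ?exprn_gt0//; lra.
pose e' := Num.min (Num.min 1 (a / 2)) (e / D).
have e'0 : 0 < e' by rewrite !lt_min ltr01 !divr_gt0.
have e'1 : e' <= 1 by rewrite !ge_min lexx.
have e'a : e' < a.
  apply: (@le_lt_trans _ _ (a / 2)); last by lra.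
  by rewrite !ge_min lexx orbT.
have e'e : e' <= e / D by rewrite ge_min lexx orbT.
have [del del0 hdel] := path_unif_cont (@cX w) N0%:R e'0.
exists (Num.truncn del^-1).+1 => // m /= hm.
have m1 : 0 < m.+1%:R :> R by rewrite ltr0n.
have hh : (m.+1%:R ^+ 2)^-1 < del.
  rewrite invf_plt ?posrE ?exprn_gt0//.
  apply: (@lt_le_trans _ _ m.+1%:R).
    rewrite (lt_trans (truncnS_gt _))// ltr_nat ltnS; exact: hm.
  by rewrite expr2 ler_peMr ?ler1n// ltW.
have h0 : 0 <= (m.+1%:R ^+ 2)^-1 :> R by rewrite invr_ge0 exprn_ge0.
rewrite (le_trans (sum_step_error_osc V (@cX w) a0 (X0 w) K0 h0 (ltW e'0) e'1 e'a _))//.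
  move=> i iN; apply: hdel.
  - by rewrite mulr_ge0.
  - by rewrite ler_wpM2r// ler_nat.
  - rewrite ler_pdivrMr ?exprn_gt0// -natrX -natrM ler_nat; exact: iN.
  - by rewrite -natr1 mulrDl mul1r addrC addKr.
rewrite mulrAC -/D mulrC -ler_pdivlMr//.
Qed.

Lemma value_mean (N0 : nat) : \int[P]_w u N0%:R w (X N0%:R w) = F n 0.
Proof.
apply/eqP; rewrite -subr_eq0 -normr_eq0; apply/eqP.
set D := `|_|.
(* With mesh [theta^-2] for [theta = m.+1], the exponents in [one_step] stay bounded, while
   [expR (- theta)] beats the [N0 * theta ^ 2] steps. *)
pose hm (m : nat) : R := (m.+1%:R ^+ 2)^-1.
pose Nm m := (N0 * m.+1 ^ 2)%N.
have h0 m : 0 < hm m by rewrite invr_gt0 exprn_gt0// ltr0n.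
have Nh m : (Nm m)%:R * hm m = N0%:R.
  by rewrite /Nm natrM natrX mulfK// expf_neq0// pnatr_eq0.
pose c := 1 + `|gamma|.
pose E := expR ((c + 1) * `|mu| + (c + 1) ^+ 2 * sigma ^+ 2 / 2).
pose tl := tail_cst mu sigma a B.
have tl0 : 0 <= tl.
  have B1 := vf_B1 V; have e0 := expR_ge0 ((1 + `|gamma|) * a).
  by rewrite /tl /tail_cst mulr_ge0//; lra.
have c0 : 0 <= c by rewrite addr_ge0.
have key m : D <= `|\int[P]_w (\sum_(i < Nm m) err w (hm m) i)| +
    (Nm m)%:R * (tl * expR (- m.+1%:R) * (2 * E)).
  rewrite /D -(Nh m) (telescope (Nm m) (ltW (h0 m))).
  rewrite (le_trans (ler_normD _ _))// lerD2l (le_trans (ler_norm_sum _ _ _))//.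
  apply: (@le_trans _ _ (\sum_(i < Nm m) (tl * expR (- m.+1%:R) * (2 * E)))); last first.
    by rewrite sumr_const card_ord -[leLHS]mulr_natl.
  apply: ler_sum => i _.
  have ih : 0 <= i%:R * hm m by rewrite mulr_ge0// ltW.
  rewrite (le_trans (one_step BM cW sigma0 a0 V ih (h0 m) (theta := m.+1%:R) _))//.
  apply: ler_wpM2l; first by rewrite mulr_ge0 ?expR_ge0.
  rewrite -/c (_ : 2 * E = E + E); last by ring.
  have m1 : 1 <= m.+1%:R :> R by rewrite ler1n.
  have m0 : 0 < m.+1%:R :> R by lra.
  have b1 : (c + m.+1%:R) * hm m <= c + 1.
    rewrite ler_pdivrMr ?exprn_gt0// expr2.
    have : c <= c * m.+1%:R by rewrite ler_peMr.
    have : c * m.+1%:R <= c * (m.+1%:R * m.+1%:R) by rewrite ler_wpM2l// ler_peMr// ltW.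
    have : m.+1%:R <= m.+1%:R * m.+1%:R :> R by rewrite ler_peMr// ltW.
    by lra.
  have b2 : (c + m.+1%:R) ^+ 2 * hm m <= (c + 1) ^+ 2.
    rewrite ler_pdivrMr ?exprn_gt0// -exprMn ler_sqr ?nnegrE; try by rewrite ?mulr_ge0//; lra.
    by rewrite mulrDl mul1r lerD2r ler_peMr.
  have b3 : (c + m.+1%:R) ^+ 2 * sigma ^+ 2 * hm m / 2 <= (c + 1) ^+ 2 * sigma ^+ 2 / 2.
    by rewrite ler_pM2r ?invr_gt0// mulrAC ler_wpM2r// sqr_ge0.
  have b0 : 0 <= (c + m.+1%:R) * hm m by rewrite mulr_ge0 ?(ltW (h0 m))//; lra.
  have b4 : `|(c + m.+1%:R) * mu * hm m| <= (c + 1) * `|mu|.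
    by rewrite mulrAC normrM ler_wpM2r// ger0_norm.
  by rewrite lerD// ler_expR lerD// ?mulNr (le_trans (ler_norm _))// ?normrN.
have lim1 : `|\int[P]_w (\sum_(i < Nm m) err w (hm m) i)| @[m --> \oo] --> (0 : R).
  rewrite -[X in _ --> X](normr0 R); apply: cvg_norm.
  rewrite -[X in _ --> X](Rintegral_prob_cst P 0).
  apply: (bounded_convergence (C := C * (2 * n%:R + K))) => //.
  - by move=> m; apply: msum; exact: ltW.
  - by move=> m w; apply: (sum_step_error V) => //; exact: ltW.
  - apply: aeW => w; apply/cvgr0Pnorm_le => e e0.
    exact: small_sum.
have lim2 : (Nm m)%:R * (tl * expR (- m.+1%:R) * (2 * E)) @[m --> \oo] --> (0 : R).
  apply/cvgr0Pnorm_le => e e0.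
  pose L := N0%:R * tl * (2 * E) * 6.
  have E0 : 0 <= E by exact: expR_ge0.
  have L0 : 0 <= L by apply: mulr_ge0 => //; apply: mulr_ge0; apply: mulr_ge0.
  exists (Num.truncn (L / e)).+1 => // m /= hm'.
  have m0 : 0 < m.+1%:R :> R by rewrite ltr0n.
  rewrite ger0_norm; last first.
    apply: mulr_ge0 => //; apply: mulr_ge0; apply: mulr_ge0 => //; exact: expR_ge0.
  (* The cubic term of the exponential series, with [6 = 3!]; one power more than the number of
     steps. *)
  have ex : expR (- m.+1%:R) <= 6 / m.+1%:R ^+ 3 :> R.
    rewrite expRN -[leRHS]invrK lef_pV2 ?posrE ?expR_gt0 ?invr_gt0 ?divr_gt0 ?exprn_gt0//.
    rewrite invf_div.
    have := @expR_ge1Dxn R m.+1%:R 2 (ltW m0).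
    by apply: le_trans; rewrite lerDr.
  apply: (@le_trans _ _ (L / m.+1%:R)).
    rewrite /Nm natrM natrX.
    apply: (@le_trans _ _ (N0%:R * m.+1%:R ^+ 2 * (tl * (6 / m.+1%:R ^+ 3) * (2 * E)))).
      by rewrite ler_wpM2l ?mulr_ge0 ?exprn_ge0// ler_wpM2r ?mulr_ge0 ?expR_ge0// ler_wpM2l.
    by rewrite le_eqVlt; apply/orP; left; apply/eqP; rewrite /L; field; rewrite gt_eqF.
  rewrite ler_pdivrMr// mulrC -ler_pdivrMr//.
  by rewrite (le_trans (ltW (truncnS_gt _)))// ler_nat (leq_trans _ (leqW hm')).
have : D <= 0.
  have lim : (fun m => `|\int[P]_w (\sum_(i < Nm m) err w (hm m) i)| + (Nm m)%:R * (tl * expR (- m.+1%:R) * (2 * E))) m @[m --> \oo] --> (0 + 0 : R) by exact: cvgD.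
  rewrite addr0 in lim; apply: (cvgr_to_ge lim).
  by apply: nearW => m; exact: key.
by move=> D0; apply/eqP; rewrite eq_le D0 /D normr_ge0.
Qed.

End ValueMean.

(** * Null events *)

Section NormalTail.
Variable R : realType.

Lemma normal_prob_itv_ge (s u v b : R) : s != 0 -> u <= v ->
  (forall x, u <= x <= v -> `|x| <= b) ->
  ((normal_peak s * expR (- b ^+ 2 / (s ^+ 2 *+ 2)) * (v - u))%:E <=
   normal_prob 0 s `[u, v])%E.
Proof.
move=> s0 uv hb; set k := normal_peak s * _.
have k0 : 0 <= k by rewrite mulr_ge0 ?expR_ge0 ?normal_peak_ge0.
have -> : ((k * (v - u))%:E = \int[@lebesgue_measure R]_(x in `[u, v]) (cst k%:E x))%E.
  rewrite integral_cst//= lebesgue_measure_itv/= lte_fin.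
  have [_|vu] := ltP u v; first by rewrite -EFinB -EFinM.
  have -> : u = v by apply/eqP; rewrite eq_le uv vu.
  by rewrite subrr mulr0 mule0.
apply: ge0_le_integral => //=.
- by apply/measurable_EFinP; apply: measurable_funTS; exact: measurable_normal_pdf.
- move=> x; rewrite in_itv/= => xuv; rewrite lee_fin /normal_pdf (negbTE s0).
  rewrite /k ler_wpM2l ?normal_peak_ge0// ler_expR subr0 ler_wpM2r//.
    by rewrite invr_ge0 pmulrn_lge0// sqr_ge0.
  rewrite lerN2 -[x ^+ 2]real_normK ?num_real// ler_sqr ?nnegrE//; first exact: hb.
  by rewrite (le_trans (normr_ge0 x))// hb.
Qed.

(** The standard normal density at 2, the least density on [[1, 2]], hence a lower bound for the
    mass of that interval. *)
Definition upper_tail : R := (expR 2)^-1 / Num.sqrt (pi *+ 2).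

Lemma upper_tail_gt0 : 0 < upper_tail.
Proof.
by rewrite /upper_tail divr_gt0 ?invr_gt0 ?expR_gt0// sqrtr_gt0 pmulrn_lgt0// pi_gt0.
Qed.

(* The mass of one standard deviation beyond the first does not depend on [s]. *)
Lemma normal_prob_upper_tail (s : R) : 0 < s ->
  (upper_tail%:E <= normal_prob 0 s `[s, (2 * s)%R])%E.
Proof.
move=> s0; have sne : s != 0 by rewrite gt_eqF.
have h := @normal_prob_itv_ge s s (2 * s) (2 * s) sne.
apply: le_trans (h _ _); last 2 first.
- by have := s0; lra.
- by move=> x /andP[x1 x2]; rewrite ger0_norm//; have := s0; lra.
rewrite lee_fin le_eqVlt; apply/orP; left; apply/eqP.
rewrite /upper_tail /normal_peak.
have -> : - (2 * s) ^+ 2 / (s ^+ 2 *+ 2) = - 2.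
  by rewrite -mulr_natr; field.
rewrite -mulrnAr sqrtrM ?sqr_ge0// sqrtr_sqr gtr0_norm// expRN.
have p0 : Num.sqrt (pi *+ 2) != 0 :> R by rewrite gt_eqF// sqrtr_gt0 pmulrn_lgt0// pi_gt0.
have e0 : expR 2 != 0 :> R by rewrite gt_eqF// expR_gt0.
by field; rewrite p0 e0 sne.
Qed.

Lemma normal_prob_lt1 (A : set R) (u v : R) : measurable A -> u < v ->
  (forall x, u <= x <= v -> ~ A x) -> (normal_prob 0 1 A < 1)%E.
Proof.
move=> mA uv hA.
pose b := `|u| + `|v|.
have hb x : u <= x <= v -> `|x| <= b.
  move=> /andP[ux xv]; rewrite /b ler_norml; have := ler_norm (- u); have := ler_norm v.
  have := normr_ge0 u; have := normr_ge0 v; rewrite normrN => *; apply/andP; split; lra.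
have h := @normal_prob_itv_ge 1 u v b (oner_neq0 R) (ltW uv) hb.
have pos : (0 < normal_prob 0 1 `[u, v])%E.
  apply: lt_le_trans h; rewrite lte_fin !mulr_gt0 ?expR_gt0 ?subr_gt0//.
  by rewrite normal_peak_gt0 ?oner_neq0.
have le : (normal_prob 0 1 A + normal_prob 0 1 `[u, v] <= 1)%E.
  have disj : A `&` `[u, v] = set0.
    by rewrite -subset0 => x [Ax]; rewrite /= in_itv/= => /hA.
  have := probability_le1 (normal_prob (0 : R) 1) (measurableU _ _ mA (measurable_itv `[u, v])).
  by rewrite measureU.
have fA : normal_prob 0 1 A \is a fin_num by exact: fin_num_measure.
have fB : normal_prob (0 : R) 1 `[u, v] \is a fin_num by exact: fin_num_measure.
rewrite -(fineK fA) -(fineK fB) in pos le *.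
by move: pos le; rewrite -EFinD !lee_fin !lte_fin; lra.
Qed.

End NormalTail.

Section NullEvents.
Context d (T : measurableType d) (R : realType) (P : probability T R)
  (W : R -> T -> R).
Hypotheses (BM : standard_brownian_motion P W) (cW : forall w, continuous (W^~ w)).
Variables (mu sigma a : R).
Hypotheses (sigma0 : 0 < sigma) (a0 : 0 < a).
Local Notation X := (drifted_process mu sigma W).

Let cX w : continuous (X^~ w). Proof. exact: drifted_continuous. Qed.

Let mW t : 0 <= t -> measurable_fun setT (W t).
Proof. exact: (bm_measurable BM). Qed.

(* Some unit increment after time [j] makes a drawdown. *)
Lemma hunting_forever_negligible :
  P.-negligible [set w | exists j : nat, forall i : nat,
    running_max X (j%:R + i%:R) w - X (j%:R + i%:R) w < a].
Proof.
pose A : set R := [set y | - a < mu + sigma * y].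
have mA : measurable A.
  have : measurable_fun setT (fun y : R => - a < mu + sigma * y).
    by apply: measurable_fun_ltr => //; apply: measurable_funD => //; apply: measurable_funM.
  by move/measurable_bool_set.
pose c := (- a - mu) / sigma.
have cE y : y <= c -> ~ A y.
  rewrite /c ler_pdivlMr// /A/= mulrC => h; apply/negP; rewrite -leNgt; lra.
have q1 : (normal_prob 0 1 A < 1)%E.
  apply: (@normal_prob_lt1 R A (c - 1) c mA); first by lra.
  by move=> x /andP[_]; exact: cE.
pose E j m := [set w | forall i : 'I_m, A (W (j%:R + i.+1%:R) w - W (j%:R + i%:R) w)].
have mE j m : measurable (E j m).
  rewrite (_ : E j m = \bigcap_(i in [set i | (i < m)%N])
     ((fun w => W (j%:R + i.+1%:R) w - W (j%:R + i%:R) w) @^-1` A)).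
    apply: bigcap_measurableType => i _.
    rewrite -[X in measurable X]setTI; apply: measurable_funB => //; exact: mW.
  apply/seteqP; split => w /= h i; last by apply: (h i); exact: ltn_ord.
  by move=> im; exact: (h (Ordinal im)).
have PE j m : P (E j m) = ((fine (normal_prob 0 1 A)) ^+ m)%:E.
  have tS i : (i < m)%N -> j%:R + i%:R < j%:R + i.+1%:R :> R by rewrite ltrD2l ltr_nat.
  have h := @bm_independent _ _ _ _ _ BM m (fun i => j%:R + i%:R) _ tS (fun=> A) (fun=> mA).
  rewrite /E h ?addr_ge0//.
  have -> : (\prod_(i < m) P ((fun w => W (j%:R + i.+1%:R) w - W (j%:R + i%:R) w)%R @^-1` A) =
     \prod_(i < m) (fine (normal_prob 0 1 A))%:E)%E.
    apply: eq_bigr => i _.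
    have := @bm_normal _ _ _ _ _ BM (j%:R + i%:R) (j%:R + i.+1%:R) _ _ A mA.
    rewrite addr_ge0// ltrD2l ltr_nat ltnSn => /(_ isT isT).
    rewrite opprD addrACA subrr add0r -natr1 addrAC subrr add0r sqrtr1 => e.
    by rewrite fineK ?fin_num_measure.
  by rewrite prodEFin big_const_ord iter_mulr_1.
have null j : P.-negligible (\bigcap_m E j m).
  have mI : measurable (\bigcap_m E j m) by exact: bigcapT_measurable.
  apply/negligibleP => //; apply/eqP; rewrite eq_le measure_ge0 andbT.
  set q := fine (normal_prob 0 1 A) in PE.
  have q0 : 0 <= q by rewrite /q fine_ge0.
  have q1' : q < 1.
    by rewrite -lte_fin /q fineK// fin_num_measure.
  have fI : P (\bigcap_m E j m) \is a fin_num by exact: fin_num_measure.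
  suff h : (P (\bigcap_m E j m) <= 0%:E)%E by exact: h.
  rewrite -(fineK fI) lee_fin.
  have lim : q ^+ m @[m --> \oo] --> (0 : R) by apply: cvg_expr; rewrite ger0_norm.
  apply: (cvgr_to_ge lim); apply: nearW => m.
  rewrite -lee_fin (fineK fI) -(PE j m); apply: le_measure; rewrite ?inE//.
  by move=> w; apply.
apply: negligibleS (negligible_bigcup null) => w [j hj].
exists j => // m _ i; rewrite /A/=.
have t1 : 0 <= j%:R + i%:R :> R by rewrite addr_ge0.
(* The maximum at the end of a unit interval is at least the path at its start, so a drawdown below
   [a] at the end forces the increment into [A]. *)
have h1 : X (j%:R + i%:R) w <= running_max X (j%:R + i.+1%:R) w.
  by apply: running_max_ge => //; rewrite lerD2l ler_nat.
have := hj i.+1.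
by move: h1; rewrite /drifted_process -natr1; lra.
Qed.

End NullEvents.

Section ProbabilityBounds.
Context d (T : measurableType d) (R : realType) (P : probability T R).

Lemma prob_le_Rintegral (A : set T) (g : T -> R) : measurable A ->
  P.-integrable setT (EFin \o g) -> (forall w, 0 <= g w) -> (forall w, A w -> 1 <= g w) ->
  fine (P A) <= \int[P]_w g w.
Proof.
move=> mA ig g0 gA.
have e : P A = (\int[P]_w (\1_A w)%:E)%E by rewrite integral_indic// setIT.
have -> : fine (P A) = \int[P]_w \1_A w by rewrite e.
have i1 : P.-integrable setT (EFin \o \1_A).
  apply: (bounded_integrable _ (C := 1)); first exact: measurable_indic.
  by move=> w; rewrite indicE; case: (_ \in _); rewrite ?normr1 ?normr0.
apply: le_Rintegral => // w _; rewrite indicE.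
by case: (boolP (w \in A)) => // /set_mem /gA.
Qed.

Lemma Rintegral_le_prob (A : set T) (g : T -> R) : measurable A ->
  P.-integrable setT (EFin \o g) -> (forall w, g w <= 1) -> (forall w, ~ A w -> g w <= 0) ->
  \int[P]_w g w <= fine (P A).
Proof.
move=> mA ig g1 gA.
have e : P A = (\int[P]_w (\1_A w)%:E)%E by rewrite integral_indic// setIT.
have -> : fine (P A) = \int[P]_w \1_A w by rewrite e.
have i1 : P.-integrable setT (EFin \o \1_A).
  apply: (bounded_integrable _ (C := 1)); first exact: measurable_indic.
  by move=> w; rewrite indicE; case: (_ \in _); rewrite ?normr1 ?normr0.
apply: le_Rintegral => // w _; rewrite indicE.
by case: (boolP (w \in A)) => // /negP wA; apply: gA => Aw; apply: wA; exact: mem_set.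
Qed.

Lemma prob_fineD (A B : set T) : measurable A -> measurable B ->
  fine (P (A `|` B)) <= fine (P A) + fine (P B).
Proof.
move=> mA mB; rewrite -lee_fin EFinD !fineK ?fin_num_measure//; last exact: measurableU.
exact: measureU2.
Qed.

Lemma prob_fine_le (A B : set T) : measurable A -> measurable B -> A `<=` B ->
  fine (P A) <= fine (P B).
Proof.
move=> mA mB AB; rewrite -lee_fin !fineK ?fin_num_measure//.
by apply: le_measure; rewrite ?inE.
Qed.

End ProbabilityBounds.

Section Unbounded.
Context d (T : measurableType d) (R : realType) (P : probability T R)
  (W : R -> T -> R).
Hypotheses (BM : standard_brownian_motion P W) (cW : forall w, continuous (W^~ w)).
Variables (mu sigma : R).
Hypotheses (sigma0 : 0 < sigma) (mu0 : 0 <= mu).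
Local Notation X := (drifted_process mu sigma W).
Implicit Types K c : R.

Let cX w : continuous (X^~ w). Proof. exact: drifted_continuous. Qed.

Let below K (N : nat) := [set w | running_max X N%:R w <= K].

Let mbelowH K N : <<s cylinders W N%:R >> (below K N).
Proof.
have h : measurable_fun [set: history W N%:R] (running_max X N%:R).
  apply: measurable_running_max => //.
  by move=> m j; exact: measurable_drifted_history.
have : measurable_fun [set: history W N%:R] (fun w => running_max X N%:R w <= K).
  exact: measurable_fun_ler.
by move/measurable_bool_set.
Qed.

Let mbelow K N : measurable (below K N).
Proof.
by have [] := history_indep BM (ler0n R N) ltr01 (@measurableT _ R) (@mbelowH K N).
Qed.

Let mX t : 0 <= t -> measurable_fun setT (X t).
Proof.
move=> t0; apply: measurable_funD => //; apply: measurable_funM => //.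
exact: (bm_measurable BM).
Qed.

Let low N c := [set w | X N%:R w < - c].

Let mlow N c : measurable (low N c).
Proof.
have : measurable_fun setT (fun w => X N%:R w < - c).
  by apply: measurable_fun_ltr => //; exact: mX.
by move/measurable_bool_set.
Qed.

Let low_small N c : fine (P (low N.+1 c)) <=
  expR (- c) * \int[P]_w expR (-1 * (X (0 + N.+1%:R) w - X 0 w)).
Proof.
have N0 : 0 < N.+1%:R :> R by rewrite ltr0n.
have i := integrable_drifted_exp BM mu sigma (-1) (lexx 0) N0.
rewrite -RintegralZl//; apply: prob_le_Rintegral => //.
- exact: RintegrableZl.
- move=> w; rewrite /low/= add0r (drifted0 BM) subr0 -expRD => h.
  by rewrite -[leLHS]expR0 ler_expR; lra.
Qed.

Let below_step K N c : 0 <= K -> 0 <= c -> exists N',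
  fine (P (below K N')) <= (1 - upper_tail R) * fine (P (below K N)) + fine (P (low N c)).
Proof.
move=> K0 c0; pose k := (Num.truncn ((K + c) / sigma)).+1.
have kK : (K + c) / sigma < k%:R by exact: truncnS_gt.
have k0 : 0 < k%:R :> R by rewrite ltr0n.
pose h : R := k%:R ^+ 2.
have h0 : 0 < h by rewrite exprn_gt0.
exists (N + k ^ 2)%N.
pose C : set R := [set y | sigma * y <= K + c].
have mC : measurable C.
  have : measurable_fun setT (fun y : R => sigma * y <= K + c).
    by apply: measurable_fun_ler => //; apply: measurable_funM.
  by move/measurable_bool_set.
have [_ ind] := history_indep BM (ler0n R N) h0 mC (@mbelowH K N).
set E := [set w | C _] in ind.
have mE : measurable E.
  rewrite /E -[X in measurable X]setTI; apply: (measurable_increment BM) => //.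
  by rewrite lerDl ltW.
have PE : fine (P E) <= 1 - upper_tail R.
  have e := @bm_normal _ _ _ _ _ BM N%:R (N%:R + h) (ler0n _ _) _ C mC.
  rewrite ltrDl addrAC subrr add0r in e.
  rewrite /E (e h0).
  have -> : Num.sqrt h = k%:R by rewrite /h sqrtr_sqr ger0_norm// ltW.
  have ut := normal_prob_upper_tail k0.
  have le1 : (normal_prob 0 k%:R C + normal_prob 0 k%:R `[k%:R, (2 * k%:R)%R] <= 1)%E.
    have disj : C `&` `[k%:R, (2 * k%:R)%R] = set0.
      rewrite -subset0 => y [Cy]; rewrite /= in_itv/= => /andP[ky _].
      move: Cy kK; rewrite /C/= ltr_pdivrMr// => h1 h2.
      have := lt_le_trans h2 (_ : k%:R * sigma <= y * sigma).
      by rewrite ler_pM2r// ky mulrC => /(_ isT); rewrite ltNge h1.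
    have := probability_le1 (normal_prob (0 : R) k%:R) (measurableU _ _ mC (measurable_itv `[k%:R, (2 * k%:R)%R])).
    by rewrite measureU.
  have fA : normal_prob 0 k%:R C \is a fin_num by exact: fin_num_measure.
  have fB : normal_prob (0 : R) k%:R `[k%:R, (2 * k%:R)%R] \is a fin_num by exact: fin_num_measure.
  rewrite -(fineK fA) -(fineK fB) in le1; rewrite -(fineK fB) in ut.
  by move: le1 ut; rewrite -EFinD !lee_fin; lra.
have -> : (1 - upper_tail R) * fine (P (below K N)) + fine (P (low N c)) =
    fine (P (below K N)) * (1 - upper_tail R) + fine (P (low N c)) by rewrite mulrC.
apply: (@le_trans _ _ (fine (P (below K N `&` E)) + fine (P (low N c)))).
  apply: le_trans (prob_fineD _ _ _); [|exact: measurableI|exact: mlow].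
  apply: prob_fine_le => //; first by apply: measurableU => //; exact: measurableI.
  move=> w; rewrite /below/= natrD natrX -/h => Mw.
  (* A path that is not below [-c] at time [N] and does not exceed [K] by [N + h] has [sigma] times
     its increment of [W] at most [K + c], since the drift [mu * h] is nonnegative. *)
  have [Xc|Xc] := ltP (X N%:R w) (- c); [by right|left; split].
    apply: le_trans Mw; apply: running_max_homo => //.
    by rewrite lerDl ltW.
  rewrite /E /C/=.
  have := running_max_ge (@cX w) (s := N%:R + h) (t := N%:R + h).
  rewrite addr_ge0 ?(ltW h0)// lexx => /(_ isT isT) hX.
  have := drifted_increment W mu sigma N%:R h w.
  have : 0 <= mu * h by rewrite mulr_ge0// ltW.
  by lra.
rewrite lerD2r ind fineM ?fin_num_measure// ler_wpM2l//.
by rewrite fine_ge0.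
Qed.

(* Each time the process is at a height above [-c], it exceeds [K] later on
   with a probability at least [upper_tail]. *)
Lemma bounded_above_negligible : P.-negligible
  [set w | exists K : nat, forall N : nat, running_max X N%:R w <= K%:R].
Proof.
have null (K : nat) : P.-negligible (\bigcap_N below K%:R N).
  have mI : measurable (\bigcap_N below K%:R N) by exact: bigcapT_measurable.
  apply/negligibleP => //; apply/eqP; rewrite eq_le measure_ge0 andbT.
  suff h : (P (\bigcap_N below K%:R N) <= 0%:E)%E by exact: h.
  have fI : P (\bigcap_N below K%:R N) \is a fin_num by exact: fin_num_measure.
  rewrite -(fineK fI) lee_fin; set r := fine _.
  have rle N : r <= fine (P (below K%:R N)).
    by apply: prob_fine_le => //; move=> w; apply.
  have step N : r <= (1 - upper_tail R) * fine (P (below K%:R N.+1)).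
    apply/ler_addgt0Pr => e e0.
    set m := \int[P]_w expR (-1 * (X (0 + N.+1%:R) w - X 0 w)).
    have m0 : 0 <= m by apply: Rintegral_ge0 => w _; exact: expR_ge0.
    have [c c0 hc] : exists2 c : R, 0 <= c & expR (- c) * m <= e.
      exists (m / e); first by rewrite divr_ge0// ltW.
      rewrite expRN mulrC ler_pdivrMr ?expR_gt0// mulrC -ler_pdivrMr//.
      by rewrite (le_trans _ (expR_ge1Dx _))// lerDr.
    have [N' hN'] := below_step N.+1 (ler0n R K) c0.
    rewrite (le_trans (rle N'))// (le_trans hN')// lerD2l.
    by rewrite (le_trans (low_small N c)).
  have lim : P (below K%:R N) @[N --> \oo] --> P (\bigcap_N below K%:R N).
    apply: nonincreasing_cvg_mu => //.
    - by rewrite ltey_eq fin_num_measure.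
    - move=> N N' NN; apply/subsetPset => w; rewrite /below/=.
      apply: le_trans; apply: running_max_homo => //.
      by rewrite ler_nat.
  have lim' : fine (P (below K%:R N)) @[N --> \oo] --> r.
    by apply: fine_cvg; rewrite fineK.
  have lim2 : (1 - upper_tail R) * fine (P (below K%:R N.+1)) @[N --> \oo] --> (1 - upper_tail R) * r.
    apply: cvgMr.
    by have := lim'; rewrite -(cvg_shiftS (fun N => fine (P (below K%:R N)))).
  (* The horizon [N] goes to infinity on the right-hand side; a strict contraction then leaves only
     [r <= 0]. *)
  have : r <= (1 - upper_tail R) * r.
    by apply: (cvgr_to_ge lim2); apply: nearW => N; exact: step.
  have u0 := upper_tail_gt0 R.
  rewrite mulrBl mul1r => h.
  have : upper_tail R * r <= 0 by lra.
  by rewrite pmulr_rle0.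
apply: negligibleS (negligible_bigcup null) => w [K hK].
by exists K => // N _; exact: hK.
Qed.

End Unbounded.

(** * Passage to the limit *)

Section Limit.
Context d (T : measurableType d) (R : realType) (P : probability T R)
  (W : R -> T -> R).
Hypotheses (BM : standard_brownian_motion P W) (cW : forall w, continuous (W^~ w)).
Variables (mu sigma a : R).
Hypotheses (sigma0 : 0 < sigma) (a0 : 0 < a).
Local Notation X := (drifted_process mu sigma W).
Local Notation gamma := (2 * mu / sigma ^+ 2).
Variables (F dF : nat -> R -> R) (rho K B : R) (n : nat).
Hypothesis V : value_functions F dF (scale_trunc gamma a) (recover_trunc gamma) a rho K B n.
Hypotheses (K0 : 0 <= K) (n0 : (0 < n)%N).
Local Notation u := (stage_value X a F dF (scale_trunc gamma a) (recover_trunc gamma) rho n).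
Local Notation M t w := (running_max X t w).

Let cX w : continuous (X^~ w). Proof. exact: drifted_continuous. Qed.
Let X0 w : X 0 w = 0. Proof. exact: (drifted0 BM). Qed.

Let measurable_from_history t (f : T -> R) : 0 <= t ->
  measurable_fun [set: history W t] f -> measurable_fun setT f.
Proof. by move=> t0; apply: (history_measurable BM t0). Qed.

Let mF k : (k <= n)%N -> measurable_fun setT (F k).
Proof. by move=> kn; apply: (lipschitz_measurable (B := B)) => x y; exact: (vf_lip V). Qed.

Let mhX t m j : (j <= m.+1)%N -> measurable_fun [set: history W t] (X (grid_time t m j)).
Proof. exact: measurable_drifted_history. Qed.

Definition stopped_max (N : nat) w : R :=
  if past X a n N%:R w then max_at X a n w else 0.

Lemma measurable_stopped_max N : measurable_fun setT (stopped_max N).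
Proof.
apply: (measurable_from_history (ler0n R N)).
by apply: measurable_max_at => //; exact: mhX.
Qed.

Let mpast N : measurable_fun setT (past X a n N%:R).
Proof.
have h : measurable_fun [set: history W N%:R] (past X a n N%:R).
  by apply: measurable_past => //; exact: mhX.
(* Passing from the history to the full sigma-algebra is stated for real functions, hence the detour
   through the values 0 and 1. *)
have h1 : measurable_fun setT (fun w => (past X a n N%:R w)%:R : R).
  by apply: (measurable_from_history (ler0n R N)); exact: measurable_natr_bool.
have : measurable_fun setT (fun w => 0 < ((past X a n N%:R w)%:R : R)).
  exact: measurable_fun_ltr.
by congr (measurable_fun _ _); apply/funext => w; case: past; rewrite ?ltr01 ?ltxx.
Qed.

Definition payoff w : R :=
  if (drawdown_time X a n w < +oo)%E then rho * F 0%N (max_at X a n w) else 0.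

Let payoffN (N : nat) w : R :=
  if past X a n N%:R w then rho * F 0%N (max_at X a n w) else 0.

Let mpayoffN N : measurable_fun setT (payoffN N).
Proof.
rewrite (_ : payoffN N = fun w => if past X a n N%:R w then rho * F 0%N (stopped_max N w) else 0).
  apply: measurable_fun_ifT => //; apply: measurable_funM => //.
  by apply: measurableT_comp; [exact: mF|exact: measurable_stopped_max].
by apply/funext => w; rewrite /payoffN /stopped_max; case: past.
Qed.

Lemma past_eventually w : (drawdown_time X a n w < +oo)%E ->
  \forall N \near \oo, past X a n N%:R w.
Proof.
have := drawdown_time_ge0 X w a n; rewrite /past.
case: drawdown_time => [r| |]//; rewrite lee_fin => r0 _.
exists (Num.truncn r).+1 => // N /= hN; rewrite lee_fin.
by rewrite (le_trans (ltW (truncnS_gt _)))// ler_nat.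
Qed.

Lemma never_past w t : ~ (drawdown_time X a n w < +oo)%E -> past X a n t w = false.
Proof.
move=> h; apply/negbTE/negP => pn; have [r [e _ _ _]] := past_fin pn.
by apply: h; rewrite e ltry.
Qed.

Lemma measurable_payoff : measurable_fun setT payoff.
Proof.
apply: (measurable_fun_cvg mpayoffN) => w _.
rewrite /payoff; have [f|f] := boolP (drawdown_time X a n w < +oo)%E.
  apply: cvg_near_cst; apply: filterS (past_eventually f) => N pN.
  by rewrite /payoffN pN.
apply: cvg_near_cst; apply: nearW => N.
by rewrite /payoffN never_past//; exact/negP.
Qed.

(** For [mu < 0] a path may remain in recovery forever, and its value need not become constant. This
    part is subtracted to make the difference settle on every relevant path, and is shown separately
    to vanish in mean. *)
Let recover_part (N : nat) w : R :=
  if 0 <= mu then 0 else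
  val_recover X a F n N%:R w * recover_trunc gamma (M N%:R w - X N%:R w).

Let mrecover_part N : measurable_fun setT (recover_part N).
Proof.
rewrite /recover_part; case: (0 <= mu) => //.
apply: (measurable_from_history (ler0n R N)).
apply: measurable_funM.
  by apply: measurable_val_recover => // m j; exact: mhX.
apply: (measurableT_comp (f := recover_trunc gamma)).
  by apply: (lipschitz_measurable (B := B)) => x y; exact: (vf_rlip V).
apply: measurable_funB; first by apply: measurable_running_max => //; exact: mhX.
by have := @mhX N%:R 0%N 1%N isT; rewrite grid_time_end.
Qed.

Let B1 := vf_B1 V.

Let recover_part_bound N w : `|recover_part N w| <= B * B.
Proof.
rewrite /recover_part; case: (0 <= mu).
  by rewrite normr0 mulr_ge0// (le_trans ler01).
have [_ h _] := val_coefficients V (@cX w) a0 (ler0n R N).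
by rewrite normrM ler_pM// (vf_r V).
Qed.

Let last_stage w : ~ (drawdown_time X a n w < +oo)%E ->
  exists k r, [/\ (k < n)%N, drawdown_time X a k w = r%:E &
    forall t, past X a k.+1 t w = false].
Proof.
suff h j : ~ (drawdown_time X a j w < +oo)%E -> exists k r,
    [/\ (k < j)%N, drawdown_time X a k w = r%:E & forall t, past X a k.+1 t w = false].
  exact: h.
elim: j => [|j IH] hj; first by rewrite /= ltry in hj.
have [fj|fj] := boolP (drawdown_time X a j w < +oo)%E.
  have := drawdown_time_ge0 X w a j; move: fj.
  case E : (drawdown_time X a j w) => [r| |]// _ _; exists j, r; split => //.
  move=> t; apply/negbTE/negP => pn; have [s [e _ _ _]] := past_fin pn.
  by apply: hj; rewrite e ltry.
have [k [r [kj e h]]] := IH (elimN idP fj).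
by exists k, r; split => //; exact: ltnW.
Qed.

(** If the n-th drawdown never occurs, a last finite one does. A recovery after it would mean
    hunting forever; the absence of recovery bounds the maximum, which is excluded for [mu >= 0],
    and for [mu < 0] makes [recover_part] the entire value. *)
Let eventually_payoff w :
  ~ (exists j : nat, forall i : nat, M (j%:R + i%:R) w - X (j%:R + i%:R) w < a) ->
  (0 <= mu -> ~ exists L : nat, forall N : nat, M N%:R w <= L%:R) ->
  \forall N \near \oo, u N%:R w (X N%:R w) - recover_part N w = payoff w.
Proof.
move=> hN1 hN2; rewrite /payoff.
have [f|f] := boolP (drawdown_time X a n w < +oo)%E.
  apply: filterS (past_eventually f) => N pN.
  rewrite (val_done _ _ _ _ _ (@cX w) a0 _ pN) /recover_part.
  rewrite (val_recover_done _ (@cX w) a0 pN) mul0r.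
  by case: ifP; rewrite subr0.
have [k [r [kn er nS]]] := last_stage (elimN idP f).
have r0 : 0 <= r by have := drawdown_time_ge0 X w a k; rewrite er lee_fin.
have pk t : r <= t -> past X a k t w by move=> rt; rewrite /past er lee_fin.
have [[t1 rt1]|nr] := pselect (exists t, recovered X a k t w).
  exfalso; apply: hN1; exists (Num.truncn t1).+1 => i.
  apply: (hunting_drawdown (@cX w) a0 (k := k)).
  rewrite /hunting nS andbT; apply: (recovered_homo (@cX w) _ rt1).
  by rewrite (le_trans (ltW (truncnS_gt _)))// lerDl.
have rN t : r <= t -> recovering X a k t w.
  by move=> rt; rewrite /recovering pk//; apply/negP => h; apply: nr; exists t.
have [mu0|mu0] := leP 0 mu.
  exfalso; apply: (hN2 mu0); exists (Num.truncn (max_at X a k w)).+1 => N.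
  apply: le_trans (ltW (truncnS_gt _)).
  have [rn|nr'] := leP r N%:R.
    by have /andP[p q] := rN _ rn; rewrite (not_recovered (@cX w) p q).
  have /andP[p q] := rN _ (lexx r); rewrite -(not_recovered (@cX w) p q).
  by apply: running_max_homo => //; exact: ltW.
exists (Num.truncn r).+1 => // N /= hN.
have rNN : r <= N%:R by rewrite (le_trans (ltW (truncnS_gt _)))// ler_nat.
rewrite (val_recovering _ _ _ _ _ (@cX w) a0 _ kn (rN _ rNN)) /recover_part.
by rewrite leNgt mu0/= (val_recoverE _ (@cX w) a0 kn (rN _ rNN)) mulrC subrr.
Qed.

Let recover_part_mean : \int[P]_w recover_part N w @[N --> \oo] --> (0 : R).
Proof.
rewrite /recover_part; have [mu0|mu0] := leP 0 mu.
  rewrite (_ : (fun N => _) = fun=> 0); first exact: cvg_cst.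
  by apply/funext => N; rewrite Rintegral_prob_cst.
have g0 : gamma < 0 by rewrite pmulr_llt0 ?invr_gt0 ?exprn_gt0// pmulr_rlt0.
(* As [gamma < 0], [M >= 0] and [M >= X], the factor [expR (gamma * (M - X))] is at most
   [expR (- (gamma / 2) * X)], whose mean at time [t] is [expR (- (gamma * mu / 4) * t)]; here
   [gamma * mu > 0]. *)
pose c := gamma * mu / 4.
have c0 : 0 < c by rewrite divr_gt0// nmulr_rgt0.
have B0 : 0 <= B by apply: le_trans B1.
pose g N w := val_recover X a F n N%:R w * recover_trunc gamma (M N%:R w - X N%:R w).
have mg N : measurable_fun setT (g N).
  by have := mrecover_part N; rewrite /recover_part leNgt mu0.
have bound N : `|\int[P]_w g N.+1 w| <= B * expR (- (c * N.+1%:R)).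
  have N0 : 0 < N.+1%:R :> R by rewrite ltr0n.
  have i := integrable_drifted_exp BM mu sigma (- (gamma / 2)) (lexx 0) N0.
  rewrite (le_trans (Rintegral_norm_le (g := fun w => B * expR (- (gamma / 2) *
     (X (0 + N.+1%:R) w - X 0 w))) _ _ _))//.
  - exact: RintegrableZl.
  - move=> w; rewrite /g add0r X0 subr0.
    have [_ h _] := val_coefficients V (@cX w) a0 (ler0n R N.+1).
    rewrite normrM ler_pM//.
    have D0 : 0 <= M N.+1%:R w - X N.+1%:R w by rewrite subr_ge0 running_max_ge.
    have M0 : 0 <= M N.+1%:R w.
      by rewrite -(X0 w) running_max_ge.
    rewrite recover_truncE; last by lra.
    rewrite /recover gtr0_norm ?expR_gt0// ler_expR (min_idPl (ltW g0)).
    have h1 : gamma * M N.+1%:R w <= 0 by rewrite mulr_le0_ge0// ltW.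
    have h2 : gamma * (M N.+1%:R w - X N.+1%:R w) <= 0 by rewrite mulr_le0_ge0// ltW.
    by move: h1 h2; rewrite !mulrBr; move: gamma => gm; lra.
  - rewrite RintegralZl// drifted_mgf// ler_wpM2l// ler_expR le_eqVlt.
    by apply/orP; left; apply/eqP; rewrite /c; field; rewrite gt_eqF.
rewrite -(cvg_shiftS (fun N => \int[P]_w g N w)).
apply/cvgr0Pnorm_le => e e0.
exists (Num.truncn (B / e / c)).+1 => // N /= hN.
rewrite (le_trans (bound N))// expRN ler_pdivrMr ?expR_gt0// -ler_pdivrMl// mulrC.
apply: (le_trans _ (expR_ge1Dx _)); rewrite (@le_trans _ _ (c * N.+1%:R))// ?lerDr//.
have : B / e / c <= N.+1%:R.
  by rewrite (le_trans (ltW (truncnS_gt _)))// ler_nat (leq_trans hN).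
by rewrite ler_pdivrMr// (mulrC B) (mulrC c).
Qed.

Lemma payoff_mean : \int[P]_w payoff w = F n 0.
Proof.
have iN N : P.-integrable setT (EFin \o (fun w => u N%:R w (X N%:R w))).
  apply: (bounded_integrable _ (C := B + B ^+ 2)).
    exact: (measurable_stage_value BM cW a0 V).
  by move=> w; apply: (stage_value_bound cW a0 V).
have ir N : P.-integrable setT (EFin \o recover_part N).
  by apply: (bounded_integrable _ (C := B * B)).
have lim1 : \int[P]_w (u N%:R w (X N%:R w) - recover_part N w) @[N --> \oo] -->
    \int[P]_w payoff w.
  apply: (bounded_convergence (C := B + B ^+ 2 + B * B)).
  - move=> N; apply: measurable_funB => //.
    exact: (measurable_stage_value BM cW a0 V).
  - exact: measurable_payoff.
  - move=> N w; rewrite (le_trans (ler_normB _ _))// lerD//.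
    by apply: (stage_value_bound cW a0 V).
  - have n1 := hunting_forever_negligible BM cW mu a sigma0.
    have [mu0|mu0] := leP 0 mu.
      have n2 := bounded_above_negligible BM cW sigma0 mu0.
      apply: negligibleS (negligibleU n1 n2) => w /= h; apply: contrapT => /not_orP[h1 h2].
      by apply: h; apply: cvg_near_cst; apply: eventually_payoff.
    apply: negligibleS n1 => w /= h; apply: contrapT => h1.
    apply: h; apply: cvg_near_cst; apply: eventually_payoff => // mu0'.
    by move: mu0; rewrite ltNge mu0'.
have lim2 : \int[P]_w (u N%:R w (X N%:R w) - recover_part N w) @[N --> \oo] --> F n 0.
  rewrite (_ : (fun N => _) = (fun N => F n 0 - \int[P]_w recover_part N w)).
    by rewrite -[X in _ --> X]subr0; apply: cvgB; [exact: cvg_cst|exact: recover_part_mean].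
  apply/funext => N; rewrite RintegralB//.
  by rewrite (value_mean BM cW sigma0 a0 V K0 n0).
by apply: cvg_unique lim1 lim2.
Qed.

End Limit.

(** * From ramp payoffs to the exceedance probability *)

Section ContinuousPaths.
Context d (T : measurableType d) (R : realType) (P : probability T R)
  (W : R -> T -> R).
Hypotheses (BM : standard_brownian_motion P W) (cW : forall w, continuous (W^~ w)).
Variables (mu sigma a x : R) (n : nat).
Hypotheses (sigma0 : 0 < sigma) (a0 : 0 < a) (x0 : 0 < x).
Local Notation X := (drifted_process mu sigma W).
Local Notation gamma := (2 * mu / sigma ^+ 2).
Local Notation l := (drawdown_rate gamma a).
Local Notation rho := (recover gamma a).

Definition exceedance := [set w |
  x < max_at X a n.+1 w /\ (drawdown_time X a n.+1 w < +oo)%E].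

Lemma measurable_exceedance : measurable exceedance.
Proof.
rewrite (_ : exceedance =
    \bigcup_N [set w | x < stopped_max W mu sigma a n.+1 N w]).
  apply: bigcupT_measurable => N; apply/measurable_bool_set.
  by apply: measurable_fun_ltr => //; exact: (measurable_stopped_max BM cW).
apply/seteqP; split => w /=.
  move=> [xM tf]; have [N _ /(_ N (leqnn N)) pN] := past_eventually tf.
  by exists N => //=; rewrite /stopped_max pN.
(* The default value 0 of [stopped_max] does not exceed the positive level [x]. *)
move=> [N _] /=; rewrite /stopped_max; case: ifP => [pN h|_]; last first.
  by have := x0; lra.
by split => //; have [r [-> _ _ _]] := past_fin pN; rewrite ltry.
Qed.

Let l0 : 0 < l. Proof. by have [] := drawdown_rate_scale gamma a0. Qed.
Let rho0 : 0 < rho. Proof. exact: expR_gt0. Qed.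
Let rho1 : rho <= 1. Proof. by apply: recover_le1; exact: ltW. Qed.

Let ramp y eps w := payoff W mu sigma a (value l rho y eps) rho n.+1 w.

Let ramp01 y eps w : 0 < eps -> 0 <= ramp y eps w <= 1.
Proof.
move=> e0; rewrite /ramp /payoff; case: ifP => _; last by rewrite lexx ler01.
exact: value0_le.
Qed.

Let ramp_integrable y eps : 0 < eps -> P.-integrable setT (EFin \o ramp y eps).
Proof.
move=> e0; have [B V] := value_functionsP gamma y n.+1 a0 e0.
apply: (bounded_integrable _ (C := 1)); first exact: (measurable_payoff BM cW a0 V).
by move=> w; have /andP[h1 h2] := ramp01 y w e0; rewrite ger0_norm.
Qed.

Let ramp_mean y eps : 0 <= y -> 0 < eps ->
  `|\int[P]_w ramp y eps w - rho ^+ n * erlang n.+1 (l * y)| <= 2 * (l * eps).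
Proof.
move=> y0 e0; have [B V] := value_functionsP gamma y n.+1 a0 e0.
have K0 : 0 <= y + eps by rewrite addr_ge0// ltW.
rewrite /ramp (payoff_mean BM cW sigma0 a0 V K0)//.
exact: value_start.
Qed.

(** The ramps starting at [x] and at [x - eps] enclose the indicator. Each mean is within
    [2 * (l * eps)] of its Erlang value, and the two Erlang values differ by at most [l * eps], for
    a total of [3 * l * eps]. *)
Lemma exceedance_prob : fine (P exceedance) = rho ^+ n * erlang n.+1 (l * x).
Proof.
set p := fine _; set q := _ * _.
have near eps : 0 < eps -> eps <= x -> `|p - q| <= 3 * l * eps.
  move=> e0 ex.
  have xe : 0 <= x - eps by rewrite subr_ge0.
  have lo : \int[P]_w ramp x eps w <= p.
    apply: Rintegral_le_prob.
    - exact: measurable_exceedance.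
    - exact: ramp_integrable.
    - by move=> w; have /andP[] := ramp01 x w e0.
    - move=> w hw; rewrite /ramp /payoff; case: ifP => // tf.
      by rewrite value0_gt// leNgt; apply/negP => h; apply: hw.
  have hi : p <= \int[P]_w ramp (x - eps) eps w.
    apply: prob_le_Rintegral.
    - exact: measurable_exceedance.
    - exact: ramp_integrable.
    - by move=> w; have /andP[] := ramp01 (x - eps) w e0.
    - move=> w [h tf]; rewrite /ramp /payoff tf value0_lt//.
      by rewrite subrK ltW.
  have := ramp_mean (ltW x0) e0; have := ramp_mean xe e0.
  have lx : 0 <= l * x by rewrite mulr_ge0// ltW.
  have lxe : 0 <= l * (x - eps) by rewrite mulr_ge0// ltW.
  have := erlang_lipschitz n lxe lx.
  rewrite [X in _ <= X](_ : _ = l * eps); last first.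
    by rewrite -mulrBr addrAC subrr add0r mulrN normrN gtr0_norm// mulr_gt0.
  rewrite -/q => h1 h2 h3.
  have h4 : `|rho ^+ n * erlang n.+1 (l * (x - eps)) - q| <= l * eps.
    rewrite /q -mulrBr normrM -[leRHS]mul1r ler_pM// ger0_norm ?exprn_ge0 ?(ltW rho0)//.
    by rewrite exprn_ile1// ltW.
  move: h2 h3 h4 lo hi; rewrite !ler_norml -(mulrA 3).
  move: (\int[P]_w ramp x eps w) (\int[P]_w ramp (x - eps) eps w) => I1 I2.
  move: p q (rho ^+ n * _) (l * eps) (mulr_gt0 l0 e0) => p' q' r le0 lpos.
  move=> /andP[? ?] /andP[? ?] /andP[? ?] ? ?; apply/andP; split; lra.
apply/eqP; rewrite -subr_eq0 -normr_le0 leNgt; apply/negP => D0.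
set D := `|p - q| in D0 near.
(* [eps <= x] keeps the lower ramp at a nonnegative level, and the denominator [4 * l] makes the
   error at most three quarters of [D]. *)
pose eps := Num.min x (D / (4 * l)).
have e0 : 0 < eps by rewrite lt_min x0 divr_gt0// mulr_gt0.
have : `|p - q| <= 3 * l * eps by apply: near => //; rewrite ge_min lexx.
suff : 3 * l * eps < D by move=> h1 h2; have := lt_le_trans h1 h2; rewrite ltxx.
apply: (@le_lt_trans _ _ (3 * l * (D / (4 * l)))).
  by rewrite ler_wpM2l ?mulr_ge0 ?(ltW l0)// ge_min lexx orbT.
rewrite (_ : 3 * l * (D / (4 * l)) = 3 / 4 * D); last by field; rewrite gt_eqF.
by lra.
Qed.

End ContinuousPaths.

(** * Reduction to paths continuous on the whole line *)

Section NonnegativeTimes.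
Context (T : Type) (R : realType) (X Y : R -> T -> R) (w : T).
Hypothesis XY : forall t, 0 <= t -> X t w = Y t w.

Lemma eq_running_max t : running_max X t w = running_max Y t w.
Proof.
rewrite /running_max; congr (sup _); apply/seteqP; split => _ /= [s st <-];
  by exists s => //; move: st; rewrite in_itv/= => /andP[/XY].
Qed.

Lemma eq_drawdown_time a n : drawdown_time X a n w = drawdown_time Y a n w.
Proof.
elim: n => [//|n IH] /=; rewrite -IH; have := drawdown_time_ge0 X w a n.
case: drawdown_time => [r| |]//; rewrite lee_fin => r0.
congr (ereal_inf _); apply/seteqP; split => _ /= [t [rt D M] <-];
  exists t => //; move: D M; rewrite !eq_running_max (XY (ltW (le_lt_trans r0 rt))) => D M;
  by split.
Qed.

End NonnegativeTimes.

Section Extension.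
Context d (T : measurableType d) (R : realType) (P : probability T R)
  (W : R -> T -> R).
Hypothesis BM : standard_brownian_motion P W.

(** A Brownian path is only known to be continuous on [[0, +oo[]; the constant extension to the left
    is continuous everywhere, and running maxima and drawdown times depend on nonnegative times
    only. *)
Let W' (t : R) w := W (Num.max t 0) w.

Let W'E t : 0 <= t -> W' t = W t.
Proof. by move=> t0; rewrite /W' (max_idPl t0). Qed.

Lemma extension_continuous w : continuous (W'^~ w).
Proof.
move=> t U; rewrite /W' => nU.
have A0 (s : R) : `[0, +oo[%classic (Num.max s 0) by rewrite /= in_itv/= andbT le_max lexx orbT.
have /subspace_continuousP := @bm_continuous _ _ _ _ _ BM w; move=> /(_ _ (A0 t) U nU).
have mc : {for t, continuous (fun s : R => Num.max s 0)}.
  by apply: continuous_max => //; exact: cst_continuous.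
by move=> /mc; rewrite /nbhs/=; apply: (@filterS _ (nbhs t)) => s /= h; exact: (h (A0 s)).
Qed.

Lemma extension_brownian : standard_brownian_motion P W'.
Proof.
split.
- by move=> t t0; rewrite W'E//; exact: (bm_measurable BM).
- by move=> w; rewrite W'E// (bm_start BM).
- by move=> w; apply: continuous_subspaceT; exact: extension_continuous.
- move=> s t s0 st A mA; rewrite !W'E//; first exact: (bm_normal BM).
  by rewrite (le_trans s0)// ltW.
- move=> n t t0 tS.
  have ti i : (i <= n)%N -> 0 <= t i.
    elim: i => // i IH im; rewrite (le_trans (IH (ltnW im)))// ltW//.
    exact: tS.
  have e : (fun (i : 'I_n) w => W' (t i.+1) w - W' (t i) w) =
           (fun (i : 'I_n) w => W (t i.+1) w - W (t i) w).
    by apply/funext => i; rewrite !W'E// ti// ltnW.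
  by rewrite e; exact: (bm_independent BM).
Qed.

End Extension.

Theorem corollary3p1 (R : realType) (d : measure_display)
    (T : measurableType d) (P : probability T R) (W : R -> T -> R)
    (mu sigma a : R) (n : nat) (x : R) :
  standard_brownian_motion P W -> 0 < sigma -> 0 < a -> (1 <= n)%N -> 0 < x ->
  let X := drifted_process mu sigma W in
  let tau := drawdown_time X a in
  let gamma := 2 * mu / sigma ^+ 2 in
  let y := drawdown_rate gamma a * x in
  P [set w | x < running_max X (fine (tau n w)) w /\ (tau n w < +oo)%E] =
  (if 0 <= mu
   then expR (- y) * \sum_(0 <= m < n) (m`!%:R)^-1 * y ^+ m
   else expR ((n.-1)%:R * gamma * a) * expR (- y) *
        \sum_(0 <= m < n) (m`!%:R)^-1 * y ^+ m)%:E.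
Proof.
move=> BM sigma0 a0; case: n => // n _ x0 X tau gamma y.
pose W' t w := W (Num.max t 0) w.
have BM' : standard_brownian_motion P W' := extension_brownian BM.
have cW' w : continuous (W'^~ w) := @extension_continuous _ _ _ _ _ BM w.
pose X' := drifted_process mu sigma W'.
have XX t w : 0 <= t -> X t w = X' t w.
  by move=> t0; rewrite /X /X' /drifted_process /W' (max_idPl t0).
rewrite (_ : [set w | _] = exceedance W' mu sigma a x n); last first.
  apply/seteqP; split => w /=; rewrite /exceedance/= /max_at /tau
    (eq_drawdown_time (fun t => XX t w)) (eq_running_max (fun t => XX t w)) //.
have me := measurable_exceedance BM' cW' mu sigma n a0 x0.
rewrite -[LHS]fineK ?fin_num_measure//; congr EFin.
rewrite (exceedance_prob BM' cW' mu n sigma0 a0 x0) -/gamma -/y /erlang /exp_psum.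
have s2 : 0 < (sigma ^+ 2)^-1 by rewrite invr_gt0 exprn_gt0.
have gE : (gamma < 0) = (mu < 0).
  by rewrite /gamma pmulr_llt0// pmulr_rlt0.
(* Here [n] is one less than in the statement, so [rho ^+ n] is already the required power; [gamma]
   has the sign of [mu], which makes [rho] equal to 1 or to [expR (gamma * a)]. *)
rewrite /recover; have [mu0|mu0] := leP 0 mu.
  rewrite (min_idPr _); last by rewrite leNgt gE -leNgt.
  by rewrite mul0r expR0 expr1n mul1r.
rewrite (min_idPl _); last by rewrite ltW// gE.
by rewrite -expRM_natl mulrA !mulrA.
Qed.
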